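(* Let $\Pi_{\mathrm{NIP}}$ be the set of all hereditary classes of graphs that are NIP. Then $\Pi_{\mathrm{NIP}}$ is a decomposition horizon, i.e. $\Pi_{\mathrm{NIP}}^{\ast}=\Pi_{\mathrm{NIP}}$. Equivalently: let $\mathscr C$ be a hereditary class of graphs such that for every positive integer $p$ there exist a hereditary NIP class $\mathscr D_p$ and a non-decreasing function $f_p:\mathbb N\to\mathbb N$ with $f_p(n)=n^{o(1)}$ such that the vertex set of every graph $G\in\mathscr C$ can be partitioned into at most $f_p(|G|)$ parts in such a way that the union of any $p$ parts induces a subgraph of $G$ belonging to $\mathscr D_p$. Then $\mathscr C$ is NIP.
   Context: Graphs are finite and simple; formulas are first-order formulas in the language of graphs (a binary adjacency relation $E$ and equality). A class $\mathscr C$ of graphs is independent if there is a formula $\varphi(\bar x,\bar y)$ such that for every $n\in\mathbb N$ there exist $G\in\mathscr C$ and tuples $\bar u_1,\dots,\bar u_n\in V(G)^{|\bar x|}$ and $\bar v_J\in V(G)^{|\bar y|}$ for $J\subseteq[n]$ with $G\models\varphi(\bar u_i,\bar v_J)\iff i\in J$; otherwise $\mathscr C$ is NIP (dependent). A hereditary class is a class of graphs closed under isomorphism and induced subgraphs. A hereditary class property is a set $\Pi$ of hereditary classes such that $\mathscr C\in\Pi$, $\mathscr D$ hereditary and $\mathscr D\subseteq\mathscr C$ imply $\mathscr D\in\Pi$. For non-decreasing $f:\mathbb N\to\mathbb N$ and positive integer $p$, a class $\mathscr C$ has an $f$-bounded $\Pi$-decomposition with parameter $p$ if there is $\mathscr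 D_p\in\Pi$ such that every $G\in\mathscr C$ has a partition $V_1,\dots,V_N$ of $V(G)$ with $N\le f(|G|)$ and $G[V_{i_1}\cup\dots\cup V_{i_p}]\in\mathscr D_p$ for all $i_1,\dots,i_p\in[N]$. $\Pi^\ast$ is the set of hereditary classes $\mathscr C$ such that for every positive integer $p$, $\mathscr C$ has an $f$-bounded $\Pi$-decomposition with parameter $p$ for some non-decreasing $f$ with $f(n)=n^{o(1)}$. $\Pi$ is a decomposition horizon if $\Pi^\ast=\Pi$. *)

(* Defs.v *)
From mathcomp Require Import all_boot.
Set Implicit Arguments. Unset Strict Implicit. Unset Printing Implicit Defensive.

Record graph := Graph {
  vtx : finType;
  adj : rel vtx;
  adj_sym : symmetric adj;
  adj_irr : irreflexive adj }.

Definition gsize (G : graph) : nat := #|vtx G|.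

Section Induced.
Variables (G : graph) (S : {set vtx G}).
Definition ind_vtx : finType := {x : vtx G | x \in S}.
Definition ind_adj : rel ind_vtx := fun x y => adj (val x) (val y).
Lemma ind_adj_sym : symmetric ind_adj.
Proof. by move=> x y; rewrite /ind_adj adj_sym. Qed.
Lemma ind_adj_irr : irreflexive ind_adj.
Proof. by move=> x; rewrite /ind_adj adj_irr. Qed.
Definition induced : graph := Graph ind_adj_sym ind_adj_irr.
End Induced.

Definition isomorphic (G H : graph) : Prop :=
  exists f : vtx G -> vtx H, bijective f /\
    forall x y, adj (f x) (f y) = adj x y.

Definition gclass := graph -> Prop.

Definition hereditary (C : gclass) : Prop :=
  (forall G H, C G -> isomorphic G H -> C H) /\
  (forall G (S : {set vtx G}), C G -> C (induced S)).

Inductive formula :=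
| FAdj of nat & nat
| FEq of nat & nat
| FNeg of formula
| FAnd of formula & formula
| FEx of nat & formula.

Definition upd (T : Type) (rho : nat -> T) (x : nat) (a : T) : nat -> T :=
  fun y => if y == x then a else rho y.

Fixpoint sat (G : graph) (rho : nat -> vtx G) (phi : formula) : Prop :=
  match phi with
  | FAdj x y => adj (rho x) (rho y)
  | FEq x y => rho x = rho y
  | FNeg f => ~ sat rho f
  | FAnd f g => sat rho f /\ sat rho g
  | FEx x f => exists a : vtx G, sat (upd rho x a) f
  end.

Fixpoint free_in (x : nat) (phi : formula) : bool :=
  match phi with
  | FAdj a b => (x == a) || (x == b)
  | FEq a b => (x == a) || (x == b)
  | FNeg f => free_in x f
  | FAnd f g => free_in x f || free_in x g
  | FEx y f => (x != y) && free_in x f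
  end.

(** phi(xbar, ybar) with |xbar| = k, |ybar| = l: the variables of xbar are
    0..k-1 and those of ybar are k..k+l-1; all free variables of phi are
    among them.  G |= phi(u, v) is evaluated under any assignment extending
    (u, v) (it does not depend on the choice, by the free-variable bound). *)
Definition holds_at (G : graph) (k l : nat) (phi : formula)
  (u : 'I_k -> vtx G) (v : 'I_l -> vtx G) : Prop :=
  exists rho : nat -> vtx G,
    (forall j : 'I_k, rho j = u j) /\
    (forall j : 'I_l, rho (k + j) = v j) /\
    sat rho phi.

Definition independent (C : gclass) : Prop :=
  exists (k l : nat) (phi : formula),
    (forall x, free_in x phi -> x < k + l) /\
    forall n : nat, exists G : graph, C G /\
      exists (u : 'I_n -> 'I_k -> vtx G) (v : {set 'I_n} -> 'I_l -> vtx G),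
        forall (i : 'I_n) (J : {set 'I_n}),
          holds_at phi (u i) (v J) <-> i \in J.

Definition NIP (C : gclass) : Prop := ~ independent C.

Definition class_property := gclass -> Prop.

Definition is_hereditary_class_property (Pi : class_property) : Prop :=
  (forall C, Pi C -> hereditary C) /\
  (forall C D, Pi C -> hereditary D -> (forall G, D G -> C G) -> Pi D).

(** f(n) = n^{o(1)}: for every eps > 0 (w.l.o.g. eps = 1/q), eventually
    n^{-eps} <= f(n) <= n^{eps}; for nat-valued f the lower bound is f(n) >= 1. *)
Definition subpoly (f : nat -> nat) : Prop :=
  forall q : nat, 0 < q -> exists N : nat, forall n : nat, N <= n ->
    1 <= f n /\ f n ^ q <= n.

Definition nondecreasing (f : nat -> nat) : Prop :=
  forall m n, m <= n -> f m <= f n.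

Definition bounded_decomposition (Pi : class_property) (f : nat -> nat)
  (p : nat) (C : gclass) : Prop :=
  exists D : gclass, Pi D /\
    forall G : graph, C G ->
      exists (N : nat) (part : vtx G -> 'I_N), N <= f (gsize G) /\
        forall idx : 'I_p -> 'I_N,
          D (induced [set x | [exists j : 'I_p, part x == idx j]]).

Definition Pi_star (Pi : class_property) : class_property :=
  fun C => hereditary C /\
    forall p : nat, 0 < p ->
      exists f : nat -> nat, nondecreasing f /\ subpoly f /\
        bounded_decomposition Pi f p C.

Definition decomposition_horizon (Pi : class_property) : Prop :=
  forall C, Pi_star Pi C <-> Pi C.

Definition Pi_NIP : class_property := fun C => hereditary C /\ NIP C.

(* Main.v *)
(* Only [Pi_star Pi_NIP C -> Pi_NIP C] has content.  Suppose that [C] is independent.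

   1. Compactness and the Erdos-Rado theorem give an Ehrenfeucht-Mostowski structure
   [N], all of whose finite parts embed in graphs of [C], which is existentially
   closed and in which a formula [phi] shatters an indiscernible family.  If [N] coded
   no grid (see [precode]), then any element could be added to either side of a finite
   satisfiability partition over a small [M], and by Zorn's lemma [N] would split into
   more blocks, each finitely satisfiable in [M] over the previous ones, than [phi] has
   parameters.  A composition argument then bounds the number of [phi]-types of tuples
   in a block that the parameters miss, against the shattering of more tuples than
   there are such types.

   2. Hence finite coded grids occur in graphs of [C], and Ramsey's theorem makes them
   order-canonical.  A cell uses a fixed number [p] of vertices and a grid of order [n]
   at most [p * n ^ 2] of them, so in a partition of this subgraph into [n^o(1)] parts,
   the pigeonhole principle yields large subgrids inside the union of [p] parts, i.e.
   in a graph of the NIP class [D_p].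

   3. In canonical grids of a hereditary class, deleting the vertices private to chosen
   blocks of cells encodes any bipartite relation, so [D_p] is independent:
   contradiction. *)

Require Import Defs.
From mathcomp Require Import all_boot.
From mathcomp Require Import boolp classical_sets filter wochoice.
Set Implicit Arguments. Unset Strict Implicit. Unset Printing Implicit Defensive.

(** * Structures and the dichotomy *)

(** Coding is kept quantifier-free: a cell is marked by the presence of one copy of a finite diagram
    and the absence of others, and both facts survive in every induced subgraph that contains the
    grid. To extract it, the failure of a copy to exist has to become a finite diagram that can be
    transported; this is the role of existential closedness. An existentially closed extension need
    not preserve [phi], so the original structure is remembered by a predicate [U], and [phi] is
    evaluated with quantifiers bounded by [U]. Ramsey's theorem with compactness would not directly
    give the Ehrenfeucht-Mostowski structure, because the existence of certificates is not a
    first-order condition; the Erdos-Rado theorem stabilises the types in all terms and formulas at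
    once, within actual models. Finally, the codes form a type that depends only on the terms over
    the naturals and on the quantifier rank of [phi], so each block can be given too many tuples
    before the structure is built. *)

(* [sQ] plays the role of equality; it need not be Leibniz equality, so that
   ultraproducts and term models require no quotient. *)
Record str := Str { car :> eqType; sE : rel car; sQ : rel car }.

Definition gstr (G : graph) : str := Str (@adj G) (@eq_op (vtx G)).

Definition tabp (S S' : str) (h : S -> S') (F : seq S) : Prop :=
  forall x y, x \in F -> y \in F ->
    sE (h x) (h y) = sE x y /\ sQ (h x) (h y) = sQ x y.

(** The map identifies exactly those elements of [F] that [sQ] relates. *)
Definition isC (C : gclass) (S : str) : Prop :=
  forall F : seq S, exists G, C G /\ exists h : S -> gstr G, tabp h F.

Lemma tabp_sub (S S' : str) (h : S -> S') (F F' : seq S) :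
  {subset F' <= F} -> tabp h F -> tabp h F'.
Proof. by move=> sF tF x y /sF xF /sF yF; apply: tF. Qed.

Lemma tabp_comp (S S' S'' : str) (h : S -> S') (h' : S' -> S'') (F : seq S) :
  tabp h F -> tabp h' (map h F) -> tabp (h' \o h) F.
Proof.
move=> th th' x y xF yF /=.
have [-> ->] := th' _ _ (map_f h xF) (map_f h yF); exact: th.
Qed.

Definition agree_on (S S' : str) (F : seq S) (X : pred S) (g h : S -> S') : Prop :=
  forall x, x \in F -> X x -> g x = h x.

(* Existential closedness, for primitive existential formulas given by the
   diagram of [F] with parameters at the positions in [X]: the failure of such a
   formula is witnessed by the diagram of finitely many elements. *)
Definition exclosed (N : str) : Prop :=
  forall (F : seq N) (X : pred N) (al : N -> N),
    (forall g, tabp g F -> ~ agree_on F X g al) ->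
    exists W : seq N, forall h : N -> N, tabp h W ->
      forall g : N -> N, tabp g F -> ~ agree_on F X g (h \o al).

(* The type of every finite tuple over [M] is finitely satisfiable in [M]. *)
Definition reflects (N : str) (M : pred N) : Prop :=
  forall W : seq N, exists h : N -> N, tabp h W /\
    (forall x, x \in W -> M x -> h x = x) /\ (forall x, x \in W -> M (h x)).

(* The cell [(s, t)] is coded by the value at [c] of a copy [g s t] of [F] whose
   row part [X] is [al s] and whose column part [Y] is [be t]; the value is reached
   neither from an earlier column nor from a later row. *)
Definition precode (N : str) (F : seq N) (X Y : pred N) (c : N) (n : nat) : Prop :=
  exists (al be : nat -> N -> N) (g : nat -> nat -> N -> N),
  [/\ forall s t, s < n -> t < n -> [/\ tabp (g s t) F,
        agree_on F X (g s t) (al s) & agree_on F Y (g s t) (be t)],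
      forall s t v w, s < n -> t < n -> v < t -> tabp w F ->
        agree_on F X w (al s) -> agree_on F Y w (be v) -> w c <> g s t c
    & forall s t u w, s < u -> t < n -> u < n -> tabp w F ->
        agree_on F X w (al u) -> agree_on F Y w (be t) -> w c <> g s t c].

Section Dichotomy.
Variables (N : str) (M : pred N).
Hypotheses (EC : exclosed N) (ReM : reflects M).

(** Elements of [F] outside [M], [A] and [B] are copied too, with free images: the condition
    concerns existential types, not only quantifier-free ones. *)
Definition fsat (A B : pred N) : Prop :=
  forall F : seq N, exists h : N -> N,
    [/\ tabp h F, forall x, x \in F -> M x || A x -> h x = x
      & forall x, x \in F -> B x -> M (h x)].

Section Failure.
Variables (A B : pred N) (F : seq N) (c : N).
Hypothesis (cF : c \in F).
Let X : pred N := fun x => M x || A x.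
Let Y : pred N := fun x => B x && ~~ X x.
Hypothesis fsAB : fsat A B.
Hypothesis badR : forall h : N -> N, tabp h F -> agree_on F X h id ->
  (forall x, x \in F -> B x -> M (h x)) -> M (h c) -> False.
Hypothesis badL : forall h : N -> N, tabp h F -> agree_on F X h id ->
  (forall x, x \in F -> B x -> M (h x)) -> h c = c -> False.

Let BM x : x \in F -> X x -> B x -> M x.
Proof.
move=> xF Xx Bx; have [h [_ hX hB]] := fsAB F.
by rewrite -(hX x xF Xx); apply: hB.
Qed.

Let YM (w : N -> N) : agree_on F X w id -> (forall x, x \in F -> Y x -> M (w x)) ->
  forall x, x \in F -> B x -> M (w x).
Proof.
move=> wX wY x xF Bx; case: (boolP (X x)) => Xx; last by apply: wY; rewrite /Y ?Bx.
by rewrite wX //; apply: BM.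
Qed.

(** Otherwise the copy provided by [fsAB] would itself be one of the excluded copies. *)
Lemma failure_fresh : ~~ X c /\ ~~ Y c.
Proof.
split; apply/negP.
  move=> Xc; have [h' [th' h'X h'B]] := fsAB F.
  by apply: (badL th') => //; apply: h'X.
move=> /andP[Bc _]; have [h' [th' h'X h'B]] := fsAB F.
by apply: (badR th') => //; apply: h'B.
Qed.

(* Column tuples are taken in [M], one after the other: the certificate of failure
   given by [exclosed] is part of what the next tuple has to copy. *)
Lemma right_sequence n : exists be : nat -> N -> N,
  (forall t x, t < n -> x \in F -> M (be t x) || ~~ Y x) /\
  forall t, t < n -> exists g : N -> N,
   [/\ tabp g F, agree_on F X g id, agree_on F Y g (be t) &
   forall v w, v < t -> tabp w F -> agree_on F X w id -> agree_on F Y w (be v) -> w c <> g c].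
Proof.
elim: n => [|n [be [beM IH]]]; first by exists (fun _ => id).
pose P := fun x => [|| X x, Y x | x == c].
pose al v x := if X x then x else if Y x then be v x else x.
(* [al v] fixes the row part, puts the column part at [be v] and keeps [c]. Such a copy is excluded
   by [badL], and [W v] certifies this. *)
have cert v : exists W : seq N, v < n -> forall h : N -> N, tabp h W ->
   forall g : N -> N, tabp g F -> ~ agree_on F P g (h \o al v).
  case: (ltnP v n) => vn; last by exists [::].
  have [|W HW] := EC (F := F) (X := P) (al := al v); last by exists W.
  move=> g tg ag; apply: (badL tg).
  - by move=> x xF Xx; rewrite (ag x xF) /P ?Xx // /al Xx.
  - apply: YM => x xF; first by move=> Xx; rewrite (ag x xF) /P ?Xx // /al Xx.
    move=> Yx; rewrite (ag x xF) /P ?Yx ?orbT // /al.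
    have /andP[_ /negbTE ->] := Yx.
    by rewrite Yx; have := beM v x vn xF; rewrite Yx orbF.
  - rewrite (ag c cF) /P ?eqxx ?orbT // /al; case: ifP => // Xc; case: ifP => // Yc.
    exfalso; have [h [th hX hB]] := fsAB F.
    by apply: (badR th) => //; apply: hB => //; case/andP: Yc.
have [W HW] := choice cert.
pose Fn := F ++ flatten [seq map (be v) F | v <- iota 0 n] ++ flatten [seq W v | v <- iota 0 n].
(* [h] fixes [X] and the earlier column tuples, which lie in [M]; so it carries each certificate
   about [c] to the same statement about [h c]. *)
have [h [th hX hB]] := fsAB Fn.
have FFn : {subset F <= Fn} by move=> x xF; rewrite mem_cat xF.
have thF : tabp h F := tabp_sub FFn th.
exists (fun t => if t == n then h else be t); split.
  move=> t x; rewrite ltnS leq_eqVlt; case: eqP => [-> _|_ /= tn] xF; last exact: beM.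
  case: (boolP (Y x)) => [/andP[Bx _]|_]; last by rewrite orbT.
  by rewrite hB //; apply: FFn.
move=> t; rewrite ltnS leq_eqVlt; case: eqP => [-> _|_ /= tn]; last first.
  have [g [g1 g2 g3 g4]] := IH t tn; exists g; split=> // v w vt.
  by rewrite (ltn_eqF (ltn_trans vt tn)); apply: g4.
exists h; split => //; first by move=> x xF Xx; apply: hX => //; apply: FFn.
move=> v w vn tw wX; rewrite (ltn_eqF vn) => wY wc.
apply: (HW v vn h _ w tw).
  apply: tabp_sub th => x xW; rewrite !mem_cat; apply/orP; right; apply/orP; right.
  by apply/flattenP; exists (W v) => //; apply: map_f; rewrite mem_iota.
move=> x xF /=; rewrite /al /P; case: (boolP (X x)) => [Xx _|Xx /=].
  by rewrite wX // hX //; apply: FFn.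
case: (boolP (Y x)) => [Yx _|Yx /= /eqP ->]; last by rewrite wc.
rewrite wY // hX //.
  rewrite !mem_cat; apply/orP; right; apply/orP; left.
  apply/flattenP; exists (map (be v) F); last exact: map_f.
  by apply: (map_f (fun v => map (be v) F)); rewrite mem_iota.
by have := beM v x vn xF; rewrite Yx orbF => ->.
Qed.

(** Each new row is the image of the original one under a reflection into [M], which leaves the
    column tuples in place because they already lie in [M]. Columns are separated by [badL], through
    [right_sequence]; rows are separated by [badR], because all coded values lie in [M]. *)
Lemma precode_of_failure n : precode F X Y c n.
Proof.
have [be [beM Hbe]] := right_sequence n.
have /choice[g0 Hg0] : forall t, exists g : N -> N, t < n ->
   [/\ tabp g F, agree_on F X g id, agree_on F Y g (be t) &
   forall v w, v < t -> tabp w F -> agree_on F X w id -> agree_on F Y w (be v) -> w c <> g c].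
  by move=> t; case: (ltnP t n) => [/Hbe[g ?]|_]; [exists g | exists id].
suff /(_ n)[al [g [H1 H2 H3]]] : forall m, exists (al : nat -> N -> N) (g : nat -> nat -> N -> N),
  [/\ forall s t, s < m -> t < n -> [/\ tabp (g s t) F, M (g s t c),
        agree_on F X (g s t) (al s) & agree_on F Y (g s t) (be t)],
      forall s t v w, s < m -> t < n -> v < t -> tabp w F ->
        agree_on F X w (al s) -> agree_on F Y w (be v) -> w c <> g s t c
    & forall s t u w, s < u -> t < n -> u < m -> tabp w F ->
        agree_on F X w (al u) -> agree_on F Y w (be t) -> w c <> g s t c] by
  exists al, be, g; split=> // s t sn tn; have [] := H1 s t sn tn.
elim=> [|m [al [g [H1 H2 H3]]]]; first by exists (fun _ => id), (fun _ _ => id).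
pose P := fun x => [|| X x, Y x | x == c].
pose al1 v z x := if X x then x else if Y x then be v x else z.
have cert (vz : nat * N) : exists W : seq N,
    (forall g : N -> N, tabp g F -> ~ agree_on F P g (al1 vz.1 vz.2)) ->
    forall h : N -> N, tabp h W ->
   forall g : N -> N, tabp g F -> ~ agree_on F P g (h \o al1 vz.1 vz.2).
  have [H|H] := pselect (forall g : N -> N, tabp g F -> ~ agree_on F P g (al1 vz.1 vz.2)); last by exists [::].
  by have [W HW] := EC H; exists W.
have [W HW] := choice cert.
(* The pairs of a column and a value to be certified: values of the original row, for comparing
   columns, and values of the previous rows, for comparing rows. *)
pose Z := [seq (v, g0 t c) | v <- iota 0 n, t <- iota 0 n] ++
   flatten [seq [seq (t, g s t c) | t <- iota 0 n] | s <- iota 0 m].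
pose Fn := F ++ flatten [seq map (g0 v) F | v <- iota 0 n] ++ flatten (map W Z)
   ++ flatten [seq map (be v) F | v <- iota 0 n] ++ [seq z.2 | z <- Z].
have [h [th [hM hB]]] := ReM Fn.
have [notX notY] := failure_fresh.
have beFn v x : v < n -> x \in F -> be v x \in Fn.
  move=> vn xF; rewrite !mem_cat; apply/or4P; apply: Or44; apply/orP; left.
  apply/flattenP; exists (map (be v) F); last exact: map_f.
  by apply: (map_f (fun v => map (be v) F)); rewrite mem_iota.
have hbe v x : v < n -> x \in F -> Y x -> h (be v x) = be v x.
  move=> vn xF Yx; apply: hM; first exact: beFn.
  by have := beM v x vn xF; rewrite Yx orbF.
have ZFn z : z \in Z -> z.2 \in Fn.
  by move=> zZ; rewrite !mem_cat (map_f snd zZ) !orbT.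
have WFn z : z \in Z -> {subset W z <= Fn}.
  move=> zZ x xW; rewrite !mem_cat; apply/or4P; apply: Or43.
  by apply/flattenP; exists (W z) => //; apply: map_f.
have main v z w : v < n -> (v, z) \in Z ->
   (forall g : N -> N, tabp g F -> ~ agree_on F P g (al1 v z)) ->
   tabp w F -> agree_on F X w h -> agree_on F Y w (be v) -> w c <> h z.
  move=> vn zZ bad tw wX wY wc; apply: (HW (v, z) bad h _ w tw).
    by apply: tabp_sub th; apply: WFn.
  move=> x xF /=; rewrite /al1 /P; case: (boolP (X x)) => [Xx _|Xx /=]; first by rewrite wX.
  case: (boolP (Y x)) => [Yx _|Yx /= /eqP ->]; last by rewrite wc.
  by rewrite wY // hbe.
exists (fun s => if s == m then h else al s),
  (fun s t => if s == m then h \o g0 t else g s t); split.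
- move=> s t; rewrite ltnS leq_eqVlt; case: eqP => [-> _|_ /= sm] tn; last exact: H1.
  have [t1 t2 t3 t4] := Hg0 t tn.
  have sub0 : {subset map (g0 t) F <= Fn}.
    move=> x xF; rewrite !mem_cat; apply/or4P; apply: Or42.
    apply/flattenP; exists (map (g0 t) F) => //.
    by apply: (map_f (fun t => map (g0 t) F)); rewrite mem_iota.
  split.
  + by apply: tabp_comp => //; apply: tabp_sub th.
  + by apply: hB; apply: sub0; apply: map_f.
  + by move=> x xF Xx /=; rewrite t2.
  + by move=> x xF Yx /=; rewrite t3 // hbe.
- move=> s t v w; rewrite ltnS leq_eqVlt; case: eqP => [-> _|_ /= sm] tn vt tw; last exact: H2.
  have [t1 t2 t3 t4] := Hg0 t tn.
  have vn := ltn_trans vt tn.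
  apply: (main v) => //.
    rewrite mem_cat; apply/orP; left.
    by apply/allpairsP; exists (v, t); rewrite !mem_iota /=.
  move=> g' tg' ag'; apply: (t4 v g' vt tg').
  + by move=> x xF Xx; rewrite ag' /P ?Xx // /al1 Xx.
  + move=> x xF Yx; rewrite ag' /P ?Yx ?orbT // /al1.
    by have /andP[_ /negbTE ->] := Yx; rewrite Yx.
  + by rewrite ag' /P ?eqxx ?orbT // /al1 (negbTE notX) (negbTE notY).
- move=> s t u w su tn; rewrite ltnS leq_eqVlt; case: eqP => [um _|_ /= um] tw.
    rewrite (@ltn_eqF s m) -?um // => wX wY.
    have [t1 Mg t3 t4] := H1 s t (leq_trans su (eq_leq um)) tn.
    have zZ : (t, g s t c) \in Z.
      rewrite mem_cat; apply/orP; right; apply/flattenP.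
      exists [seq (t, g s t c) | t <- iota 0 n].
        by apply: (map_f (fun s => [seq (t, g s t c) | t <- iota 0 n])); rewrite mem_iota -um.
      by apply: (map_f (fun t => (t, g s t c))); rewrite mem_iota.
    (* The earlier value lies in [M], so [h] fixes it; [badR] excludes the copies that are the
       identity on the row part and send [c] to this value. *)
    have -> : g s t c = h (g s t c) by rewrite hM //; exact: (ZFn _ zZ).
    apply: (main t) => // g' tg' ag'; apply: (badR tg').
    + by move=> x xF Xx; rewrite ag' /P ?Xx // /al1 Xx.
    + apply: YM => x xF; first by move=> Xx; rewrite ag' /P ?Xx // /al1 Xx.
      move=> Yx; rewrite ag' /P ?Yx ?orbT // /al1.
      have /andP[_ /negbTE ->] := Yx.
      by rewrite Yx; have := beM t x tn xF; rewrite Yx orbF.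
    + by rewrite ag' /P ?eqxx ?orbT // /al1 (negbTE notX) (negbTE notY).
have sm : s < m := ltn_trans su um.
by rewrite (ltn_eqF sm); apply: H3.
Qed.
End Failure.

(** Each of the two failures has a finite witness. Both witnesses together with [c] form a single
    diagram, and its failure codes grids of every order. *)
Theorem dichotomy (A B : pred N) (c : N) :
  (forall (F : seq N) (X Y : pred N) c, c \in F -> ~~ X c -> ~~ Y c -> ~ forall n, precode F X Y c n) ->
  fsat A B -> fsat A (predU1 c B) \/ fsat (predU1 c A) B.
Proof.
move=> noc fsAB.
have [|/existsNP[F1 bad1]] := pselect (fsat A (predU1 c B)); first by left.
have [|/existsNP[F2 bad2]] := pselect (fsat (predU1 c A) B); first by right.
exfalso; pose F := c :: F1 ++ F2.
have s1 : {subset F1 <= F} by move=> x xF; rewrite inE mem_cat xF orbT.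
have s2 : {subset F2 <= F} by move=> x xF; rewrite inE mem_cat xF !orbT.
have cF : c \in F by rewrite inE eqxx.
have badR h : tabp h F -> agree_on F (fun x => M x || A x) h id ->
    (forall x, x \in F -> B x -> M (h x)) -> M (h c) -> False.
  move=> th hX hB hc; apply: bad1; exists h; split; first exact: tabp_sub th.
    by move=> x xF Xx; apply: hX => //; apply: s1.
  by move=> x xF /= /orP[/eqP->//|Bx]; apply: hB => //; apply: s1.
have badL h : tabp h F -> agree_on F (fun x => M x || A x) h id ->
    (forall x, x \in F -> B x -> M (h x)) -> h c = c -> False.
  move=> th hX hB hc; apply: bad2; exists h; split; first exact: tabp_sub th.
    move=> x xF /orP[Mx|/= /orP[/eqP->//|Ax]]; apply: hX; rewrite ?Mx ?Ax ?orbT //; exact: s2.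
  by move=> x xF /= Bx; apply: hB => //; apply: s2.
have [nX nY] := failure_fresh cF fsAB badR badL.
by apply: (noc F _ _ c cF nX nY) => n; apply: precode_of_failure.
Qed.

End Dichotomy.

(** * Splitting the structure into finitely satisfiable blocks *)

Section Partition.
Variables (N : str) (M : pred N).
Hypotheses (EC : exclosed N) (ReM : reflects M).
Hypothesis noc : forall (F : seq N) (X Y : pred N) c, c \in F -> ~~ X c -> ~~ Y c ->
  ~ forall n, precode F X Y c n.

Lemma fsat_trans (A B1 B2 : pred N) :
  fsat M A B1 -> fsat M (predU A B1) B2 -> fsat M A (predU B1 B2).
Proof.
move=> f1 f2 F; have [h2 [t2 h2A h2B]] := f2 F.
have [h1 [t1 h1A h1B]] := f1 (map h2 F).
exists (h1 \o h2); split; first exact: tabp_comp.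
  move=> x xF xA /=; have e : h2 x = x.
    by apply: h2A => //=; case/orP: xA => ->; rewrite ?orbT.
  by rewrite e h1A // -e map_f.
move=> x xF /= /orP[B1x|B2x].
  have e : h2 x = x by apply: h2A => //=; rewrite B1x !orbT.
  by rewrite e; apply: h1B => //; rewrite -e map_f.
have Mx := h2B x xF B2x.
by rewrite h1A ?Mx // map_f.
Qed.

Lemma fsat_ext (A A' B B' : pred N) : A =1 A' -> B =1 B' -> fsat M A B -> fsat M A' B'.
Proof.
move=> eA eB f F; have [h [t hA hB]] := f F.
by exists h; split=> // x xF; rewrite -?eA -?eB; [apply: hA | apply: hB].
Qed.

Definition lowp (g : N -> option nat) (s : nat) : pred N :=
  fun x => if g x is Some t then t <= s else false.
Definition highp (g : N -> option nat) (s : nat) : pred N :=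
  fun x => if g x is Some t then s < t else false.
Definition goodp (m : nat) (g : N -> option nat) : Prop :=
  (forall x t, g x = Some t -> t <= m) /\
  forall s, s < m -> fsat M (lowp g s) (highp g s).
Definition extp (g g' : N -> option nat) : Prop :=
  forall x t, g x = Some t -> g' x = Some t.

(** [c] goes into block [s0], the first cut at which it cannot join the upper side (or [m] if there
    is none). At a later cut [t] it cannot join the upper side either: by transitivity over the
    blocks between [s0] and [t] it would then join it at [s0]. So the dichotomy puts it on the lower
    side there. *)
Lemma extend_goodp m g c : goodp m g -> g c = None ->
  exists g', [/\ goodp m g', extp g g' & g' c <> None].
Proof.
move=> [gm gf] gc.
pose bad s := (s < m) && ~~ `[< fsat M (lowp g s) (predU1 c (highp g s)) >].
have [s0 [s0m lt0 ge0]] : exists s0, [/\ s0 <= m,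
    forall s, s < m -> s < s0 -> fsat M (lowp g s) (predU1 c (highp g s))
  & forall s, s < m -> s0 <= s -> fsat M (predU1 c (lowp g s)) (highp g s)].
  have dich s (sm : s < m) := dichotomy EC ReM c noc (gf s sm).
  have [[s bads]|nobad] := pselect (exists s, bad s); last first.
    exists m; split=> // s sm; last by rewrite leqNgt sm.
    by move=> _; apply: contrapT => nf; apply: nobad; exists s; rewrite /bad sm; apply/asboolP.
  have [s0 /andP[s0m /asboolP bad0] min0] := @ex_minnP bad (ex_intro _ s bads).
  exists s0; split; first exact: ltnW.
    move=> t tm ts0; apply: contrapT => nf; have := min0 t.
    by rewrite /bad tm leqNgt ts0 /= => F; apply: notF; apply: F; apply/asboolP.
  move=> t tm s0t; case: (dich t tm) => // ft; exfalso; apply: bad0.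
  pose mid : pred N := fun x => if g x is Some u then s0 < u <= t else false.
  have f1 : fsat M (lowp g s0) mid.
    move=> F; have [h [th hA hB]] := gf s0 s0m F; exists h; split=> // x xF.
    by rewrite /mid => mx; apply: hB => //; rewrite /highp; case: (g x) mx => // u /andP[].
  apply: fsat_ext (fsat_trans f1 (B2 := predU1 c (highp g t)) _) => //.
    move=> x; rewrite /= /mid /highp; case: (g x) => [u|]; last by rewrite orbF.
    case: eqP => //= _; rewrite ?orbT //.
    case: (leqP u t) => ut; rewrite ?andbT ?orbF ?andbF //=.
    by rewrite (leq_ltn_trans s0t ut).
  apply: fsat_ext ft => // x; rewrite /= /mid /lowp; case: (g x) => //= u.
  case: (leqP u s0) => /= us; first by rewrite (leq_trans us s0t).
  by [].
exists (fun x => if x == c then Some s0 else g x); split.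
- split.
    by move=> x t; case: eqP => [_ [<-]//|_]; apply: gm.
  move=> s sm; case: (ltnP s s0) => ss0.
    apply: fsat_ext (lt0 s sm ss0) => x; rewrite /= /lowp /highp; case: eqP => [->|] //=.
    by rewrite gc leqNgt ss0.
  apply: fsat_ext (ge0 s sm ss0) => x; rewrite /= /lowp /highp; case: eqP => [->|] //=.
  by rewrite gc ltnNge ss0.
- by move=> x t gx; case: eqP => // xc; rewrite xc gc in gx.
- by rewrite eqxx.
Qed.

Theorem fsat_partition m g0 : goodp m g0 -> exists p : N -> nat,
  [/\ forall x, p x <= m, forall x t, g0 x = Some t -> p x = t
    & forall s, s < m -> fsat M (fun x => p x <= s) (fun x => s < p x)].
Proof.
move=> good0.
pose T := {g : N -> option nat | goodp m g /\ extp g0 g}.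
pose R : rel T := fun g h => `[< extp (sval g) (sval h) >].
have [||||g gmax] := @Zorn T R.
- by move=> g; apply/asboolP.
- by move=> g1 g2 g3 /asboolP h1 /asboolP h2; apply/asboolP => x t /h1/h2.
- move=> [g hg] [h hh] /asboolP /= h1 /asboolP /= h2; apply: eq_exist; apply: funext => x.
  case e: (g x) => [t|]; first by rewrite (h1 x t e).
  by case e': (h x) => [t|] //; rewrite -e (h2 x t e').
- move=> A totA.
  (* Adding the initial assignment makes the union well-behaved for the empty chain as well. *)
  pose i0 : T := exist _ g0 (conj good0 (fun x t e => e)).
  pose A' g := A g \/ g = i0.
  have tot' g h : A' g -> A' h -> extp (sval g) (sval h) \/ extp (sval h) (sval g).
    move=> [Ag|->]; last by left; case: (svalP h).
    move=> [Ah|->]; last by right; case: (svalP g).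
    by case: (totA g h Ag Ah) => /asboolP; [left | right].
  have /choice[u Hu] : forall x, exists o : option nat,
      (forall g, A' g -> sval g x <> None -> sval g x = o)
      /\ (forall t, o = Some t -> exists g, A' g /\ sval g x = Some t).
    move=> x; have [[g [Ag [t gx]]]|none] := pselect (exists g, A' g /\ exists t, sval g x = Some t).
      exists (Some t); split; last by move=> t' [<-]; exists g.
      move=> h Ah; case e: (sval h x) => [t'|] // _.
      by case: (tot' g h Ag Ah) => [/(_ x t gx)|/(_ x t' e)]; rewrite ?e ?gx.
    exists None; split => // g Ag; case e: (sval g x) => [t|] // _.
    by case: none; exists g; split=> //; exists t.
  have fin (F : seq N) : exists g, A' g /\ forall x, x \in F -> sval g x = u x.
    elim: F => [|y F [g [Ag IH]]]; first by exists i0; split=> //; right.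
    case e: (u y) => [t|]; last first.
      exists g; split=> // x; rewrite inE => /orP[/eqP->|]; last exact: IH.
      have [H _] := Hu y; rewrite e; case e': (sval g y) => [t|] //.
      by rewrite -e -(H g Ag) e'.
    have [_ /(_ _ e)[h [Ah hy]]] := Hu y.
    case: (tot' g h Ag Ah) => gh.
      exists h; split=> // x; rewrite inE => /orP[/eqP->|xF]; first by rewrite e.
      have := IH x xF; case e': (u x) => [t'|] => [/gh //|gx].
      case e'': (sval h x) => [t'|] //; have [H _] := Hu x.
      by rewrite -e' -(H h Ah) e''.
    exists g; split=> // x; rewrite inE => /orP[/eqP->|xF]; last exact: IH.
    by rewrite e; apply: gh.
  have gu : goodp m u /\ extp g0 u.
    split; last first.
      move=> x t e; have [/(_ i0 (or_intror erefl))] := Hu x.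
      by rewrite /= e => <-.
    split.
      move=> x t e; have [_ /(_ t e)[g [_ gx]]] := Hu x.
      by have [[gm _] _] := svalP g; apply: gm gx.
    move=> s sm F; have [g [_ gF]] := fin F.
    have [[_ /(_ s sm)/(_ F)[h [th hA hB]]] _] := svalP g.
    exists h; split=> // x xF.
      by move=> H; apply: hA => //; rewrite /lowp gF.
    by move=> H; apply: hB => //; rewrite /highp gF.
  exists (exist _ u gu) => g Ag; apply/asboolP => x t e /=.
  by have [/(_ g (or_introl Ag))] := Hu x; rewrite e => <-.
have [gg eg] := svalP g.
have tot x : sval g x <> None.
  move=> gx; have [h [gh eh hx]] := extend_goodp gg gx.
  have Ph : goodp m h /\ extp g0 h by split=> // y t /eg/eh.
  have := gmax (exist _ h Ph); rewrite /R => H.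
  have e : exist _ h Ph = g by apply: H; apply/asboolP.
  by apply: hx; have <- : sval g = h by rewrite -e.
exists (fun x => odflt 0 (sval g x)); split.
- move=> x; have := @tot x; case e: (sval g x) => [t|] // _ /=; exact: (gg.1 x t e).
- by move=> x t /eg ->.
- move=> s sm; apply: fsat_ext (gg.2 s sm) => x; rewrite /lowp /highp;
  by have := @tot x; case: (sval g x).
Qed.

End Partition.

(** * Composition of types over a partition *)

(** [U] will be the original structure inside an existentially closed extension. Free variables may
    still take values outside it. *)
Fixpoint ssat (S : str) (U : pred S) (rho : nat -> S) (psi : formula) : Prop :=
  match psi with
  | FAdj x y => sE (rho x) (rho y)
  | FEq x y => sQ (rho x) (rho y)
  | FNeg f => ~ ssat U rho f
  | FAnd f g => ssat U rho f /\ ssat U rho g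
  | FEx x f => exists a, U a /\ ssat U (upd rho x a) f
  end.

Fixpoint qrank (psi : formula) : nat :=
  match psi with
  | FNeg f => qrank f
  | FAnd f g => maxn (qrank f) (qrank g)
  | FEx _ f => (qrank f).+1
  | _ => 0
  end.

Lemma upd_upd_same (T : Type) (rho : nat -> T) x a b : upd (upd rho x a) x b = upd rho x b.
Proof. by apply: funext => y; rewrite /upd; case: (y == x). Qed.

Lemma upd_upd_swap (T : Type) (rho : nat -> T) x y a b : y != x ->
  upd (upd rho x a) y b = upd (upd rho y b) x a.
Proof.
move=> yx; apply: funext => z; rewrite /upd.
by case: (z =P y) => [->|_] //; rewrite (negbTE yx).
Qed.

Section Types.
Variable Mi : Type.

(** No element of the structure enters these types: lower blocks are seen only through sets of
    traces. Hence the number of codes can be exceeded in advance. *)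
Definition trace : Type := Mi -> bool * bool.
Definition color : Type := (trace * (trace -> Prop) * (trace -> Prop))%type.
Definition code0 : Type :=
  ((nat -> option color) * (nat -> nat -> option (bool * bool)))%type.
Fixpoint codeT (q : nat) : Type :=
  if q is q'.+1 then (codeT q' * (nat -> codeT q' -> Prop))%type else code0.

End Types.

Section Composition.
Variables (N : str) (M U : pred N) (Mi : Type) (emb : Mi -> N) (m : nat) (p : N -> nat).
Hypotheses (symE : symmetric (@sE N)) (symQ : symmetric (@sQ N)).
Hypothesis embP : forall x, M x -> exists i, emb i = x.
Hypothesis pm : forall x, p x <= m.
Hypothesis pfs : forall s, s < m -> fsat M (fun x => p x <= s) (fun x => s < p x).
Variable s : nat.

Definition tr (v : N) : trace Mi := fun i => (sE v (emb i), sQ v (emb i)).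
(* Adjacency between an element of the block [s] and an element of another block
   is a function of the traces on [M] for the blocks above [s], and of the last
   two components for the blocks below [s]. *)
Definition col (v : N) : color Mi :=
  (tr v, fun t => exists x, [/\ p x < s, tr x = t & sE x v],
         fun t => exists x, [/\ p x < s, tr x = t & sQ x v]).
Definition inA (v : N) : bool := U v && (p v == s).
Definition code_0 (rho : nat -> N) : code0 Mi :=
  (fun x => if inA (rho x) then Some (col (rho x)) else None,
   fun x y => if inA (rho x) && inA (rho y)
              then Some (sE (rho x) (rho y), sQ (rho x) (rho y)) else None).
(** The Ehrenfeucht-Fraisse type of rank [q] of the part of the assignment inside the block, with
    colours as unary predicates and moves confined to the block. *)
Fixpoint code (q : nat) (rho : nat -> N) : codeT Mi q :=
  if q is q'.+1 then
    (code q' rho, fun x h => exists a, inA a /\ code q' (upd rho x a) = h)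
  else code_0 rho.

(** If [w] lies above the block, move it into [M] over the block: its adjacencies are then read in
    the common trace. If it lies below and is adjacent to [v], the colour provides a lower [x] with
    the trace of [w] that is adjacent to [v']; moving [v'] into [M] over the lower blocks shows that
    [x] and [w] behave alike towards it. *)
Lemma col_adj (v v' w : N) : p v = s -> p v' = s -> p w <> s -> col v = col v' ->
  sE v w = sE v' w /\ sQ v w = sQ v' w.
Proof.
move=> pv pv' /eqP pw [etr eE eQ].
wlog suff H : v v' pv pv' etr eE eQ / (sE v w -> sE v' w) /\ (sQ v w -> sQ v' w).
  have [h1 h2] := H v v' pv pv' etr eE eQ.
  have [h3 h4] := H v' v pv' pv (esym etr) (esym eE) (esym eQ).
  by split; apply/idP/idP.
have tr2 x y i : tr x = tr y -> sE x (emb i) = sE y (emb i) /\ sQ x (emb i) = sQ y (emb i).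
  by move=> /(congr1 (fun f => f i)) [-> ->].
case: (ltngtP (p w) s) pw => // pws _.
  have sm : s.-1 < m by rewrite -ltnS (ltn_predK pws) ltnS -pv pm.
  have low x : p x < s -> p x <= s.-1 by move=> h; rewrite -ltnS (ltn_predK pws).
  split => H.
    have [x [px ex Ex]] : exists x, [/\ p x < s, tr x = tr w & sE x v'].
      have : exists x, [/\ p x < s, tr x = tr w & sE x v] by exists w; rewrite symE.
      by move/(congr1 (fun f => f (tr w))): eE => ->.
    have [h [th hA hB]] := pfs sm [:: x; w; v'].
    have [/embP[i ei]] : M (h v').
      by apply: hB; rewrite ?inE ?eqxx ?orbT // pv' (ltn_predK pws).
    have [e1 _] : sE (h x) (h v') = sE x v' /\ sQ (h x) (h v') = sQ x v'.
      by apply: th; rewrite !inE eqxx ?orbT.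
    have [e2 _] : sE (h w) (h v') = sE w v' /\ sQ (h w) (h v') = sQ w v'.
      by apply: th; rewrite !inE eqxx ?orbT.
    have hx : h x = x by apply: hA; rewrite ?inE ?eqxx ?low ?orbT.
    have hw : h w = w by apply: hA; rewrite ?inE ?eqxx ?low ?orbT.
    move: e1 e2; rewrite hx hw -ei (tr2 _ _ i ex).1 => -> e2.
    by rewrite symE -e2.
  have [x [px ex Ex]] : exists x, [/\ p x < s, tr x = tr w & sQ x v'].
    have : exists x, [/\ p x < s, tr x = tr w & sQ x v] by exists w; rewrite symQ.
    by move/(congr1 (fun f => f (tr w))): eQ => ->.
  have [h [th hA hB]] := pfs sm [:: x; w; v'].
  have [/embP[i ei]] : M (h v').
    by apply: hB; rewrite ?inE ?eqxx ?orbT // pv' (ltn_predK pws).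
  have [_ e1] : sE (h x) (h v') = sE x v' /\ sQ (h x) (h v') = sQ x v'.
    by apply: th; rewrite !inE eqxx ?orbT.
  have [_ e2] : sE (h w) (h v') = sE w v' /\ sQ (h w) (h v') = sQ w v'.
    by apply: th; rewrite !inE eqxx ?orbT.
  have hx : h x = x by apply: hA; rewrite ?inE ?eqxx ?low ?orbT.
  have hw : h w = w by apply: hA; rewrite ?inE ?eqxx ?low ?orbT.
  move: e1 e2; rewrite hx hw -ei (tr2 _ _ i ex).2 => -> e2.
  by rewrite symQ -e2.
have [h [th hA hB]] := pfs (leq_trans pws (pm w)) [:: v; v'; w].
have [/embP[i ei]] : M (h w) by apply: hB; rewrite ?inE ?eqxx ?orbT.
have e1 : sE (h v) (h w) = sE v w /\ sQ (h v) (h w) = sQ v w.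
  by apply: th; rewrite !inE eqxx ?orbT.
have e2 : sE (h v') (h w) = sE v' w /\ sQ (h v') (h w) = sQ v' w.
  by apply: th; rewrite !inE eqxx ?orbT.
have hv : h v = v by apply: hA; rewrite ?inE ?eqxx ?pv ?leqnn ?orbT.
have hv' : h v' = v' by apply: hA; rewrite ?inE ?eqxx ?pv' ?leqnn ?orbT.
move: e1 e2; rewrite hv hv' -ei => -[<- <-] [<- <-].
by have [-> ->] := tr2 _ _ i etr.
Qed.

Lemma code_code0 q rho rho' : code q rho = code q rho' -> code_0 rho = code_0 rho'.
Proof. by elim: q => //= q IH [/IH]. Qed.

Lemma code_ext q rho rho' :
  (forall x, inA (rho x) = inA (rho' x)) -> (forall x, inA (rho x) -> rho x = rho' x) ->
  code q rho = code q rho'.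
Proof.
elim: q rho rho' => [|q IH] rho rho' eA eR.
  rewrite /= /code_0; congr pair.
    by apply: funext => x; rewrite -eA; case: ifP => // /eR ->.
  apply: funext => x; apply: funext => y; rewrite -!eA.
  by case: ifP => // /andP[/eR -> /eR ->].
congr pair; first exact: (IH rho rho' eA eR).
apply: funext => x; apply: funext => h; apply: propext.
suff e a : code q (upd rho x a) = code q (upd rho' x a).
  by split=> -[a [Aa <-]]; exists a; split.
by apply: IH => y; rewrite /upd; case: eqP => // _; apply: eR.
Qed.

Lemma code_0_out rho rho' x a : ~~ inA a ->
  code_0 rho = code_0 rho' -> code_0 (upd rho x a) = code_0 (upd rho' x a).
Proof.
move=> /negbTE na [e1 e2]; congr pair.
  apply: funext => y; rewrite /upd; case: (y == x); first by rewrite na.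
  by move/(congr1 (fun f => f y)): e1.
apply: funext => y; apply: funext => z; rewrite /upd.
case: (y == x); first by rewrite na.
case: (z == x); first by rewrite na !andbF.
by move/(congr1 (fun f => f y z)): e2.
Qed.

Lemma code_out q rho rho' x a : ~~ inA a ->
  code q rho = code q rho' -> code q (upd rho x a) = code q (upd rho' x a).
Proof.
move=> na; elim: q rho rho' => [|q IH] rho rho'; first exact: code_0_out.
move=> [e0 e1]; congr pair; first exact: IH.
apply: funext => y; apply: funext => h; apply: propext.
have e2 b : (exists a, inA a /\ code q (upd rho y a) = b) <->
   (exists a, inA a /\ code q (upd rho' y a) = b).
  by move/(congr1 (fun f => f y b)): e1 => ->.
case: (y =P x) => [yx|/eqP yx].
  subst y; split=> -[b [Ab]]; rewrite upd_upd_same => eb.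
    by have [c [Ac ec]] := (e2 h).1 (ex_intro _ b (conj Ab eb)); exists c; rewrite upd_upd_same.
  by have [c [Ac ec]] := (e2 h).2 (ex_intro _ b (conj Ab eb)); exists c; rewrite upd_upd_same.
split=> -[b [Ab eb]].
  have [|c [Ac ec]] := (e2 (code q (upd rho y b))).1; first by exists b.
  exists c; split=> //; rewrite -eb !(@upd_upd_swap _ _ x y) //.
  by apply: IH.
have [|c [Ac ec]] := (e2 (code q (upd rho' y b))).2; first by exists b.
exists c; split=> //; rewrite -eb !(@upd_upd_swap _ _ x y) //.
by apply: IH.
Qed.

(** Back-and-forth: an element of the block is answered as the codes prescribe, any other element is
    answered by itself. [col_adj] settles the atoms between the two kinds. *)
Lemma code_ssat psi q rho rho' : qrank psi <= q -> code q rho = code q rho' ->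
  (forall x, ~~ inA (rho x) -> rho x = rho' x) ->
  (forall x, U (rho x)) -> (forall x, U (rho' x)) ->
  ssat U rho psi <-> ssat U rho' psi.
Proof.
move: psi q rho rho'.
have inE rho rho' x : code_0 rho = code_0 rho' -> inA (rho x) = inA (rho' x).
  by move=> [/(congr1 (fun f => f x))]; case: ifP; case: ifP.
have atom rho rho' x y : code_0 rho = code_0 rho' ->
    (forall x, ~~ inA (rho x) -> rho x = rho' x) ->
    (forall x, U (rho x)) -> (forall x, U (rho' x)) ->
    sE (rho x) (rho y) = sE (rho' x) (rho' y) /\ sQ (rho x) (rho y) = sQ (rho' x) (rho' y).
  move=> e out Urho Urho'; have ein z := inE _ _ z e.
  have [e1 e2] := e.
  have one z w : inA (rho z) -> ~~ inA (rho w) ->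
      sE (rho z) (rho w) = sE (rho' z) (rho' w) /\ sQ (rho z) (rho w) = sQ (rho' z) (rho' w).
    move=> Az nw; rewrite -(out w nw); apply: col_adj.
    - by case/andP: Az => _ /eqP.
    - by move: Az; rewrite ein => /andP[_ /eqP].
    - by apply/eqP; move: nw; rewrite /inA Urho.
    - by move/(congr1 (fun f => f z)): e1; rewrite -ein Az => /Some_inj.
  case: (boolP (inA (rho x))) => Ax; case: (boolP (inA (rho y))) => Ay.
  - by move/(congr1 (fun f => f x y)): e2; rewrite -!ein Ax Ay /= => -[-> ->].
  - exact: one.
  - by rewrite symE symQ (symE (rho' x)) (symQ (rho' x)); apply: one.
  - by rewrite (out x) // (out y).
elim=> [x y|x y|f IH|f IHf g IHg|x f IH] q rho rho' /= qr e out Ur Ur'.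
- by have [-> _] := atom _ _ x y (code_code0 e) out Ur Ur'.
- by have [_ ->] := atom _ _ x y (code_code0 e) out Ur Ur'.
- by rewrite (IH q rho rho').
- move: qr; rewrite geq_max => /andP[qf qg].
  by rewrite (IHf q rho rho') // (IHg q rho rho').
- case: q qr e => // q; rewrite ltnS => qr e.
  have Uu r a : (forall x, U (r x)) -> U a -> forall y, U (upd r x a y).
    by move=> H Ua y; rewrite /upd; case: ifP.
  have [_ /(congr1 (fun f => f x)) e1] := e.
  have step r r' : code q.+1 r = code q.+1 r' -> (forall x, ~~ inA (r x) -> r x = r' x) ->
     (forall x, U (r x)) -> (forall x, U (r' x)) ->
     (exists a, U a /\ ssat U (upd r x a) f) -> (exists a, U a /\ ssat U (upd r' x a) f).
    move=> er outr Hr Hr' [a [Ua fa]].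
    case: (boolP (inA a)) => Aa.
      have [_ /(congr1 (fun f => f x (code q (upd r x a))))] := er.
      have ex : exists b, inA b /\ code q (upd r x b) = code q (upd r x a) by exists a.
      move=> eqP; rewrite eqP in ex; case: ex => b [Ab eb].
      exists b; split; first by case/andP: Ab.
      apply/(IH q (upd r x a)) => //; [| exact: Uu | by apply: Uu => //; case/andP: Ab].
      by move=> y; rewrite /upd; case: ifP => // _; [rewrite Aa | apply: outr].
    exists a; split=> //; apply/(IH q (upd r x a)) => //; try exact: Uu.
      by have [er0 _] := er; apply: code_out.
    by move=> y; rewrite /upd; case: ifP => // _; apply: outr.
  split; first exact: step.
  by apply: step => // y; rewrite -(inE _ _ y (code_code0 e)) => /out.
Qed.
End Composition.

(** * The Erdos-Rado theorem *)

Definition strict_wo (Y : eqType) (lt : rel Y) : Prop :=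
  [/\ irreflexive lt, transitive lt, forall x y, x != y -> lt x y || lt y x
    & well_founded (fun x y => lt x y)].

Lemma strict_wo_exists (Y : eqType) : exists lt : rel Y, strict_wo lt.
Proof.
have [R wR] := well_ordering_principle Y.
have min2 (P : pred Y) (x : Y) : P x -> exists z, P z /\ forall y, P y -> R z y.
  move=> Px; have [|z [[Pz zmin] _]] := wR P; first by exists x.
  by exists z; split=> // y Py; apply: zmin.
have tot x y : R x y || R y x.
  have [|z [zP zmin]] := min2 (pred2 x y) x; first by rewrite /= eqxx.
  case/orP: zP => /eqP e; subst z; first by rewrite zmin //= eqxx orbT.
  by rewrite (zmin x) ?orbT //= eqxx.
have anti x y : R x y -> R y x -> x = y.
  move=> xy yx; have [|z [_ zu]] := wR (pred2 x y); first by exists x; rewrite inE eqxx.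
  have rr w : R w w by have := tot w w; rewrite orbb.
  rewrite -(zu x); last by split; [rewrite inE eqxx | move=> w; rewrite inE => /orP[]/eqP->].
  by apply: zu; split; [rewrite inE eqxx orbT | move=> w; rewrite inE => /orP[]/eqP->].
have rr w : R w w by have := tot w w; rewrite orbb.
have trans y x z : R x y -> R y z -> R x z.
  move=> xy yz; have [|w [wP wm]] := min2 (pred3 x y z) x; first by rewrite /= eqxx.
  have wx : R w x by apply: wm; rewrite /= eqxx.
  have wy : R w y by apply: wm; rewrite /= eqxx orbT.
  have wz : R w z by apply: wm; rewrite /= eqxx !orbT.
  case/or3P: wP => /eqP e; subst w => //.
    by rewrite (anti x y).
  by rewrite -(anti y z).
exists (fun x y => (x != y) && R x y); split.
- by move=> x; rewrite eqxx.
- move=> y x z /andP[xy Rxy] /andP[yz Ryz]; rewrite (trans y) // andbT.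
  by apply/eqP => xz; subst z; rewrite (anti x y) ?eqxx in xy.
- by move=> x y xy; rewrite xy eq_sym xy /=; apply: tot.
- move=> x; apply: contrapT => nx.
  pose P : pred Y := fun x => `[< ~ Acc (fun x y => (x != y) && R x y) x >].
  have [|z [/asboolP nz zm]] := min2 P x; first exact/asboolP.
  apply: nz; constructor => y /andP[yz Ryz]; apply: contrapT => ny.
  have : R z y by apply: zm; apply/asboolP.
  by move=> zy; rewrite (anti y z) ?eqxx in yz.
Qed.

(** Sizes are compared without cardinals: [~ inj_on H X] says that [H] is larger than [X]. *)
Definition inj_on (Y : eqType) (H : pred Y) (X : Type) : Prop :=
  exists f : Y -> X, forall x y, H x -> H y -> f x = f y -> x = y.

Section Ramification.
Variables (Y : eqType) (lt : rel Y) (H0 : pred Y) (T : Type) (n : nat) (F : seq Y -> T).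
Hypothesis wo : strict_wo lt.

Let wf : well_founded (fun x y => lt x y). Proof. by case: wo. Qed.

(* The ramification tree of Erdos and Rado: [x] lies below [y] when [F] does not
   separate them after any increasing tuple of elements below [x]. *)
Definition below_step (x : Y) (rec : forall z, lt z x -> Y -> Prop) (y : Y) : Prop :=
  [/\ H0 x, lt x y, forall z (zx : lt z x), rec z zx x -> rec z zx y
    & forall u, size u = n -> sorted lt u ->
        (forall z, z \in u -> exists zx : lt z x, rec z zx x) -> F (rcons u x) = F (rcons u y)].

Definition below : Y -> Y -> Prop := Fix wf (fun _ => Y -> Prop) below_step.

Lemma belowE x y : below x y <-> [/\ H0 x, lt x y, forall z, below z x -> below z y
  & forall u, size u = n -> sorted lt u -> (forall z, z \in u -> below z x) ->
      F (rcons u x) = F (rcons u y)].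
Proof.
have e z : below z = @below_step z (fun z' _ => below z').
  rewrite /below Fix_eq; first reflexivity.
  move=> w f g fg; by have -> : f = g by apply: functional_extensionality_dep => a; apply: functional_extensionality_dep => b.
have blt z w : below z w -> lt z w by rewrite e => -[].
rewrite {1}e; split=> -[h1 h2 h3 h4]; split=> //.
- by move=> z zx; apply: h3 => //; apply: blt.
- by move=> u su so ub; apply: h4 => // z /ub zx; exists (blt _ _ zx).
- by move=> z zx; apply: h3.
- by move=> u su so ub; apply: h4 => // z /ub[].
Qed.

Lemma below_lt x y : below x y -> lt x y. Proof. by move/belowE => []. Qed.
Lemma below_H0 x y : below x y -> H0 x. Proof. by move/belowE => []. Qed.
Lemma below_trans x y z : below x y -> below y z -> below x z.
Proof. by move=> xy /belowE[_ _ h _]; apply: h. Qed.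
Lemma below_col x y u : below x y -> size u = n -> sorted lt u ->
  (forall z, z \in u -> below z x) -> F (rcons u x) = F (rcons u y).
Proof. by move/belowE => [_ _ _]; apply. Qed.

Lemma below_chain x x' y : below x y -> below x' y -> lt x x' -> below x x'.
Proof.
have [_ tr _ _] := wo.
elim/(well_founded_ind wf): x x' => x IH x' xy x'y xx'.
have h z : below z x -> below z x'.
  move=> zx; apply: IH => //; first exact: below_lt.
    exact: below_trans zx xy.
  by apply: tr xx'; exact: below_lt.
apply/belowE; split=> //; first exact: below_H0 xy.
move=> u su so ux; rewrite (below_col xy) // (below_col x'y) // => z /ux; exact: h.
Qed.

(** Otherwise the smaller of the two would be below the larger one, hence below itself. *)
Lemma below_det x x' : H0 x -> H0 x' -> (forall z, below z x <-> below z x') ->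
  (forall u, size u = n -> sorted lt u -> (forall z, z \in u -> below z x) ->
     F (rcons u x) = F (rcons u x')) -> x = x'.
Proof.
have [ir tr to _] := wo.
wlog: x x' / lt x x'.
  move=> W Hx Hx' e1 e2; case: (x =P x') => // /eqP xx'.
  case/orP: (to _ _ xx') => h; first exact: W.
  apply/esym; apply: W => // [z|u su so ub]; first by split=> /e1.
  by rewrite e2 // => z /ub/e1.
move=> xx' Hx Hx' e1 e2; exfalso.
have /e1/below_lt : below x x' by apply/belowE; split=> // z /e1.
by rewrite ir.
Qed.

(** If the predecessors of every node could be labelled injectively in [X], a node could be
    recovered from the labels used, the tree order on them and the colours of the labelled tuples;
    so [H0] would inject into the set of such descriptions. *)
Lemma ramification (X : Type) :
  ~ inj_on H0 ((X -> Prop) * (X -> X -> Prop) * (seq X -> T -> Prop))%type ->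
  exists2 y, H0 y & ~ inj_on (fun x => `[< below x y >]) X.
Proof.
move=> noinj; apply: contrapT => allinj; apply: noinj.
have [[y0 Hy0]|noH] := pselect (exists y, H0 y); last first.
  exists (fun _ => (fun _ => True, fun _ _ => True, fun _ _ => True)) => x y Hx.
  by case: noH; exists x.
have getj y : H0 y -> inj_on (fun x => `[< below x y >]) X.
  by move=> Hy; apply: contrapT => ni; apply: allinj; exists y.
have /choice[j Hj] : forall y, exists f : Y -> X, H0 y -> forall x x',
    below x y -> below x' y -> f x = f x' -> x = x'.
  move=> y; have [Hy|] := pselect (H0 y).
    have [f fi] := getj y Hy.
    by exists f => _ x x' xy x'y; apply: fi; apply/asboolP.
  by move=> ny; have [f _] := getj y0 Hy0; exists f.
have [ir tr to _] := wo.
pose dom y a := exists x, below x y /\ j y x = a.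
pose re y a b := exists x x', [/\ below x y, below x' y, below x x' & j y x = a /\ j y x' = b].
pose gr y l t := exists u, [/\ forall z, z \in u -> below z y, sorted lt u, size u = n,
   map (j y) u = l & F (rcons u y) = t].
exists (fun y => (dom y, re y, gr y)) => y y' Hy Hy' [edom ere egr].
have match_seq (u u' : seq Y) : (forall z, z \in u -> below z y) ->
    (forall z, z \in u' -> below z y') ->
    (forall x x', x \in u -> below x y -> below x' y' -> j y x = j y' x' -> x = x') ->
    map (j y') u' = map (j y) u -> u = u'.
  move=> bu bu' m; elim: u u' bu bu' m => [|a u IH] [|a' u'] //= bu bu' m [ea eu].
  congr cons.
    by apply: m => //; rewrite ?inE ?eqxx //; (apply: bu || apply: bu'); rewrite inE eqxx.
  apply: IH => // [z zu|z zu|x x' xu]; (apply: bu || apply: bu' || apply: m); by rewrite inE ?zu ?xu orbT.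
(* Equally labelled predecessors of [y] and [y'] are equal, by induction along the order: their own
   predecessors correspond by [re], and the colours by [gr]. *)
have key x : below x y -> forall x', below x' y' -> j y x = j y' x' -> x = x'.
  elim/(well_founded_ind wf): x => x IH xy x' x'y' e.
  have pre z : below z x -> below z x'.
    move=> zx; have zy := below_trans zx xy.
    have : re y (j y z) (j y x) by exists z, x.
    rewrite ere => -[z1 [x1 [z1y x1y z1x1 [ez ex]]]].
    have ex1 : x1 = x' by apply: (Hj y') => //; rewrite ex e.
    have -> : z = z1 by apply: IH => //; exact: below_lt.
    by rewrite -ex1.
  have pre' z : below z x' -> below z x.
    move=> zx; have zy := below_trans zx x'y'.
    have : re y' (j y' z) (j y' x') by exists z, x'.
    rewrite -ere => -[z1 [x1 [z1y x1y z1x1 [ez ex]]]].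
    have ex1 : x1 = x by apply: (Hj y) => //; rewrite ex e.
    rewrite ex1 in z1x1.
    by have <- : z1 = z by apply: IH => //; exact: below_lt.
  apply: below_det; [exact: below_H0 xy | exact: below_H0 x'y' | by move=> z; split; auto |].
  move=> u su so ux.
  have uy z : z \in u -> below z y by move=> /ux zx; exact: below_trans zx xy.
  have : gr y (map (j y) u) (F (rcons u y)) by exists u.
  rewrite egr => -[u' [bu' su' so' eu eF]].
  have uu' : u = u'.
    by apply: match_seq => // z z' zu zy; exact: (IH z (below_lt (ux z zu)) zy z').
  rewrite (below_col xy) // -eF -uu' -(below_col x'y') // => z /ux; exact: pre.
apply: below_det => //.
  move=> z; split=> bz.
    have : dom y (j y z) by exists z.
    by rewrite edom => -[z' [z'y ez]]; rewrite (key z bz z') // -ez.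
  have : dom y' (j y' z) by exists z.
  by rewrite -edom => -[z' [z'y ez]]; rewrite -(key z' z'y z).
move=> u su so ux.
have : gr y (map (j y) u) (F (rcons u y)) by exists u.
rewrite egr => -[u' [bu' su' so' eu eF]].
have uu' : u = u' by apply: match_seq => // z z' zu zy; exact: (key z zy z').
by rewrite -eF uu'.
Qed.
End Ramification.

(** Among the elements below one node [y], the colour of an increasing tuple does not change when
    its last entry is replaced by [y], which lowers the exponent. [X'] is chosen before the order
    and the colouring, so one bound serves all models at once. *)
Theorem erdos_rado (T : Type) (n : nat) (X : Type) : exists X' : Type,
  forall (Y : eqType) (lt : rel Y) (H0 : pred Y) (F : seq Y -> T),
    strict_wo lt -> ~ inj_on H0 X' ->
    exists H : pred Y, [/\ forall x, H x -> H0 x, ~ inj_on H X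
      & exists t, forall s, sorted lt s -> all H s -> size s = n -> F s = t].
Proof.
elim: n X => [|n IH] X.
  exists X => Y lt H0 F _ ni; exists H0; split=> //.
  by exists (F [::]) => -[].
have [X1 HX1] := IH X.
exists ((X1 -> Prop) * (X1 -> X1 -> Prop) * (seq X1 -> T -> Prop))%type.
move=> Y lt H0 F wo ni.
have [y Hy ny] := @ramification Y lt H0 T n F wo X1 ni.
have [H [sub nH [t Ht]]] := HX1 Y lt _ (fun u => F (rcons u y)) wo ny.
exists H; split=> //; first by move=> x /sub /asboolP; apply: below_H0.
exists t => s; case/lastP: s => // u x so; rewrite all_rcons size_rcons => /andP[Hx Hu] [su].
have [ir tr _ _] := wo.
have so' : sorted lt u.
  by move: so; rewrite -cats1 => /cat_sorted2[].
have bel w : H w -> below H0 n F wo w y by move/sub/asboolP.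
rewrite -(Ht u so' Hu su); apply: (below_col (bel x Hx)) => // z zu.
apply: (below_chain (y := y)); [|exact: bel|].
  by apply: bel; move/allP: Hu; apply.
by move: so; rewrite sorted_pairwise // pairwise_rcons => /andP[/allP/(_ z zu)].
Qed.

(** * Existentially closed extensions *)

Lemma fine_ultrafilter (J : eqType) : exists U : set_system (seq J),
  UltraFilter U /\ forall L : seq J, U (fun L' => {subset L <= L'}).
Proof.
pose F : set_system (seq J) := fun P => exists L : seq J, forall L' : seq J, {subset L <= L'} -> P L'.
have PF : ProperFilter F.
  split; first by move=> [L /(_ L)]; apply.
  split.
  - by exists [::].
  - move=> P Q [L1 H1] [L2 H2]; exists (L1 ++ L2) => L' sub; split.
      by apply: H1 => x xL; apply: sub; rewrite mem_cat xL.
    by apply: H2 => x xL; apply: sub; rewrite mem_cat xL orbT.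
  - by move=> P Q PQ [L H]; exists L => L' /H/PQ.
have [U [uU FU]] := ultraFilterLemma PF.
by exists U; split=> // L; apply: FU; exists L.
Qed.

Section Ultra.
Variables (J : Type) (U : set_system J).
Hypothesis uU : UltraFilter U.

Let PU : ProperFilter U. Proof. exact: ultra_proper. Qed.

Definition ulim (b : J -> bool) : bool := `[< U (fun j => b j) >].

Lemma ulim_near (b : J -> bool) : U (fun j => b j = ulim b).
Proof.
rewrite /ulim; have [Ub|nUb] := pselect (U (fun j => b j)).
  by rewrite (asboolT Ub); apply: filterS Ub.
have [//|Uc] := in_ultra_setVsetC (fun j => b j) uU.
by rewrite (asboolF nUb); apply: filterS Uc => j /= /negP/negbTE.
Qed.

Lemma ulim_all (I : eqType) (s : seq I) (b : I -> J -> bool) :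
  U (fun j => forall i, i \in s -> b i j = ulim (b i)).
Proof.
elim: s => [|i s IH]; first by apply: filterS filterT.
apply: filterS (filterI (ulim_near (b i)) IH) => j [h1 h2] i'.
by rewrite inE => /orP[/eqP->|/h2].
Qed.

End Ultra.

(** The limit of the solutions along a fine ultrafilter; a condition sees only finitely many pairs,
    on which the limit equals some solution meeting that condition. *)
Lemma compactness (K J : eqType) (supp : J -> seq K) (Psi : J -> rel K -> rel K -> Prop) :
  (forall j E Q E' Q',
     (forall x y, x \in supp j -> y \in supp j -> E' x y = E x y /\ Q' x y = Q x y) ->
     Psi j E Q -> Psi j E' Q') ->
  (forall L : seq J, exists E Q, forall j, j \in L -> Psi j E Q) ->
  exists E Q, forall j, Psi j E Q.
Proof.
move=> loc fin.
have [U [uU fineU]] := fine_ultrafilter J.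
have PU : ProperFilter U by exact: ultra_proper.
have /choice[S HS] : forall L : seq J, exists S : rel K * rel K, forall j, j \in L -> Psi j S.1 S.2.
  by move=> L; have [E [Q H]] := fin L; exists (E, Q).
exists (fun x y => ulim U (fun L => (S L).1 x y)), (fun x y => ulim U (fun L => (S L).2 x y)) => j.
pose prs := [seq (x, y) | x <- supp j, y <- supp j].
have u1 := ulim_all uU prs (fun p L => (S L).1 p.1 p.2).
have u2 := ulim_all uU prs (fun p L => (S L).2 p.1 p.2).
have [L [[h1 h2] jL]] := filter_ex (filterI (filterI u1 u2) (fineU [:: j])).
apply: loc (HS L j _); last by apply: jL; rewrite inE.
move=> x y xs ys; have pin : (x, y) \in prs by apply/allpairsP; exists (x, y).
by rewrite (h1 _ pin) (h2 _ pin).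
Qed.

(** * Diagrams of tuples and existential closedness *)

Definition pat : Type := (seq (seq bool) * seq (seq bool))%type.

Definition tab (S : str) (l : seq S) : pat :=
  ([seq [seq sE x y | y <- l] | x <- l], [seq [seq sQ x y | y <- l] | x <- l]).

Lemma tab_map (S S' : str) (h : S -> S') (l : seq S) :
  tabp h l -> tab (map h l) = tab l.
Proof.
move=> th; rewrite /tab -!map_comp; congr pair; apply/eq_in_map => x xl /=;
  rewrite -map_comp; apply/eq_in_map => y yl /=; by have [] := th x y xl yl.
Qed.

Lemma size_tab (S : str) (l : seq S) : size (tab l).1 = size l.
Proof. by rewrite size_map. Qed.

Lemma tab_nth (S S' : str) (x0 : S) (y0 : S') (l : seq S) (l' : seq S') i j :
  tab l = tab l' -> i < size l -> j < size l ->
  sE (nth x0 l i) (nth x0 l j) = sE (nth y0 l' i) (nth y0 l' j) /\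
  sQ (nth x0 l i) (nth x0 l j) = sQ (nth y0 l' i) (nth y0 l' j).
Proof.
move=> e il jl; have es : size l = size l' by rewrite -!size_tab e.
have [e1 e2] := e; split.
  have := congr1 (fun t => nth false (nth [::] t i) j) e1.
  by rewrite (nth_map x0) // (nth_map x0) // (nth_map y0) -?es // (nth_map y0) -?es.
have := congr1 (fun t => nth false (nth [::] t i) j) e2.
by rewrite (nth_map x0) // (nth_map x0) // (nth_map y0) -?es // (nth_map y0) -?es.
Qed.

Section Dead.
Variable C : gclass.

(** Only the diagram of [W] matters, so a dead pattern remains dead in every extension. *)
Definition dead (S : str) (W a : seq S) (d : pat) : Prop :=
  ~ exists G, C G /\ exists (h : S -> gstr G) (w : seq (gstr G)),
      tabp h W /\ tab (map h a ++ w) = d.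

Definition ec (S : str) : Prop := forall (a : seq S) (d : pat),
  (exists w, tab (a ++ w) = d) \/
  exists W, {subset a <= W} /\ dead W a d.

Section Extension.
Variables (N0 : str) (x0 : N0).
Hypothesis C0 : isC C N0.

(** [NApp d j a] names the [j]-th new element in a realisation of [d] over [a]. All names exist from
    the start; the stages of the construction only change the relations on them. *)
Inductive names : Type := NBase of N0 | NApp of pat & nat & seq names.

Fixpoint depth (k : names) : nat :=
  match k with
  | NBase _ => 0
  | NApp _ _ a => (foldr maxn 0 (map depth a)).+1
  end.

Let K : eqType := {classic names}.
Definition depths (a : seq K) : nat := foldr maxn 0 (map depth a).

Lemma depthsP (a : seq K) (x : K) : x \in a -> depth x <= depths a.
Proof.
elim: a => //= y a IH; rewrite inE => /orP[/eqP->|/IH h]; rewrite /depths /= leq_max ?leqnn //.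
by rewrite h orbT.
Qed.

Definition nms (a : seq K) (d : pat) : seq K :=
  mkseq (fun j => NApp d j a : K) (size d.1 - size a).

Definition promise (S : rel K * rel K) (p : seq K * pat) : Prop :=
  @tab (Str S.1 S.2) (p.1 ++ nms p.1 p.2) = p.2.

Definition kstr (S : rel K * rel K) : str := Str S.1 S.2.

Definition agree (n : nat) (S S' : rel K * rel K) : Prop :=
  forall x y, depth x <= n -> depth y <= n -> S'.1 x y = S.1 x y /\ S'.2 x y = S.2 x y.

Lemma depth_nms a d x : x \in nms a d -> depth x = (depths a).+1.
Proof. by move=> /mapP[j _ ->]. Qed.

Let Cond : eqType := {classic (seq K + (K * K) + (seq K * pat))%type}.

Definition holds_cond (i : nat) (S : rel K * rel K) (c : Cond) (S' : rel K * rel K) : Prop :=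
  match (c : (seq K + (K * K) + (seq K * pat))%type) with
  | inl (inl F) => exists G, C G /\ exists h : kstr S' -> gstr G, tabp h F
  | inl (inr (x, y)) => depth x <= i -> depth y <= i -> S'.1 x y = S.1 x y /\ S'.2 x y = S.2 x y
  | inr p => promise S' p
  end.

Definition supp_cond (c : Cond) : seq K :=
  match (c : (seq K + (K * K) + (seq K * pat))%type) with
  | inl (inl F) => F
  | inl (inr (x, y)) => [:: x; y]
  | inr p => p.1 ++ nms p.1 p.2
  end.

Lemma promise_loc S S' p :
  (forall x y, x \in p.1 ++ nms p.1 p.2 -> y \in p.1 ++ nms p.1 p.2 ->
     S'.1 x y = S.1 x y /\ S'.2 x y = S.2 x y) -> promise S p -> promise S' p.
Proof.
rewrite /promise => H e; rewrite -[RHS]e -[in LHS](map_id (p.1 ++ _)).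
by apply: (@tab_map (kstr S) (kstr S') id) => x y xs ys; apply: H.
Qed.

Lemma cond_compact i S (P : Cond -> Prop) :
  (forall L : seq Cond, exists S', forall c, c \in L -> P c -> holds_cond i S c S') ->
  exists S', forall c, P c -> holds_cond i S c S'.
Proof.
move=> H; have [||E [Q EQ]] := @compactness K Cond supp_cond (fun c E Q => P c -> holds_cond i S c (E, Q)).
- move=> c E Q E' Q' loc h Pc; move: {h}(h Pc) loc; rewrite /supp_cond /holds_cond.
  case: (c : (_ + _)%type) => [[F|[x y]]|p].
  + by move=> [G [CG [h th]]] loc; exists G; split=> //; exists h => x y xF yF;
       have [-> ->] := th x y xF yF; have /= [-> ->] := loc x y xF yF.
  + move=> h loc dx dy; have := loc x y; rewrite !inE !eqxx ?orbT => /(_ isT isT) /= [-> ->].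
    exact: h.
  + by move=> pr loc; apply: promise_loc pr.
- by move=> L; have [[E Q] HL] := H L; exists E, Q.
- by exists (E, Q).
Qed.

(** A maximal set of promises over tuples of depth [i] is kept, subject to the class and to the
    diagram at depth at most [i]. A promise left out must be dead: otherwise every finite set of
    conditions could be met in a graph of [C] together with this promise, and compactness would
    contradict maximality. *)
Lemma ec_step (i : nat) (S : rel K * rel K) : isC C (kstr S) ->
  exists S', [/\ isC C (kstr S'), agree i S S' &
    forall (a : seq K) d, depths a = i -> promise S' (a, d) \/
      exists W : seq K, [/\ {subset a <= W}, forall x, x \in W -> depth x <= i.+1 & @dead (kstr S') W a d]].
Proof.
move=> CS.
pose base (Sig : seq K * pat -> Prop) (c : Cond) : Prop :=
  match (c : (seq K + (K * K) + (seq K * pat))%type) with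
  | inr p => Sig p | _ => True end.
pose Con (Sig : seq K * pat -> Prop) := (forall p, Sig p -> depths p.1 = i) /\
  exists S', forall c, base Sig c -> holds_cond i S c S'.
pose T := {Sig | Con Sig}.
pose R : rel T := fun A B => `[< forall p, sval A p -> sval B p >].
have Con0 : Con (fun _ => False).
  split=> //; exists S => c; case: (c : (_ + _)%type) => [[F|[x y]]|p] //= _; exact: CS F.
have [||||Sig Smax] := @Zorn T R.
- by move=> A; apply/asboolP.
- by move=> A B D /asboolP h1 /asboolP h2; apply/asboolP => p /h1/h2.
- move=> [A hA] [B hB] /asboolP /= h1 /asboolP /= h2; apply: eq_exist.
  by apply: funext => p; apply: propext; split; [apply: h1 | apply: h2].
- move=> A totA; pose Sg p := exists B, A B /\ sval B p.
  have ConS : Con Sg.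
    split; first by move=> p [B [_ Bp]]; have [h _] := svalP B; apply: h.
    apply: cond_compact => L.
    pose bot : T := exist _ _ Con0.
    have [B [_ HB]] : exists B : T, (A B \/ B = bot) /\
        forall c, c \in L -> base Sg c -> base (sval B) c.
      elim: L => [|c L [B [AB HB]]]; first by exists bot; split=> //; right.
      have [[p ec]|nopr] := pselect (exists p, c = inr p :> (_ + _)%type); last first.
        exists B; split=> // c'; rewrite inE => /orP[/eqP->|]; last exact: HB.
        by move: nopr; rewrite /base; case: (c : (_ + _)%type) => // p []; exists p.
      have [[D [AD Dp]]|nSp] := pselect (Sg p); last first.
        exists B; split=> // c'; rewrite inE => /orP[/eqP->|]; last exact: HB.
        by rewrite /base ec => /nSp.
      have [BD|DB] : (forall q, sval B q -> sval D q) \/ (forall q, sval D q -> sval B q).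
      + case: AB => [AB|->]; last by left.
        by case: (totA B D AB AD) => /asboolP; [left | right].
      + exists D; split; first by left.
        move=> c'; rewrite inE => /orP[/eqP->|]; first by rewrite /base ec.
        move=> /HB H /H; rewrite /base.
        by case: (c' : (_ + _)%type) => [[]|q] //; apply: BD.
      exists B; split=> // c'; rewrite inE => /orP[/eqP->|]; last exact: HB.
      by rewrite /base ec => _; apply: DB.
    have [_ [S' HS']] := svalP B.
    by exists S' => c cL Sc; apply: HS'; apply: HB.
  exists (exist _ Sg ConS) => B AB; apply/asboolP => p Bp; by exists B.
have [depS [S' HS']] := svalP Sig.
have agS' : agree i S S' by move=> x y; apply: (HS' (inl (inr (x, y)))).
have CS' : isC C (kstr S') by move=> F; apply: (HS' (inl (inl F))).
exists S'; split=> // a d da.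
have [Sad|nSad] := pselect (sval Sig (a, d)); first by left; apply: (HS' (inr (a, d))).
right; apply: contrapT => nodead.
pose Sg p := sval Sig p \/ p = (a, d).
suff ConS : Con Sg.
  have e : exist _ Sg ConS = Sig by apply: Smax; apply/asboolP => p Sp; left.
  by apply: nSad; rewrite -e /=; right.
split; first by move=> p [/depS|->].
apply: cond_compact => L.
(* The certificate must stay within depth [i.+1], the part on which the relations of the next stage
   are final. *)
pose W : seq K := a ++ [seq x <- flatten (map supp_cond L) | depth x <= i.+1].
have aW : {subset a <= W} by move=> x xa; rewrite mem_cat xa.
have dW x : x \in W -> depth x <= i.+1.
  rewrite mem_cat mem_filter => /orP[xa|/andP[]//].
  by rewrite (leq_trans (depthsP xa)) // da.
have nd : ~ @dead (kstr S') W a d by move=> dd; apply: nodead; exists W.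
have [G [CG [h [w [th tw]]]]] := contrapT nd.
(* Only the names introduced by the promise [(a, d)] are reinterpreted. Distinct promises introduce
   distinct names, so those already kept are undisturbed. *)
pose pi (x : K) : gstr G := if x \in nms a d then nth (h x) w (index x (nms a d)) else h x.
exists (fun x y => sE (pi x) (pi y), fun x y => sQ (pi x) (pi y)) => c cL bc.
have suppW x : x \in supp_cond c -> depth x <= i.+1 -> x \in W.
  move=> xc dx; rewrite mem_cat mem_filter dx /=; apply/orP; right.
  by apply/flattenP; exists (supp_cond c) => //; apply: map_f.
move: bc suppW; rewrite /base /supp_cond /holds_cond.
case: (c : (_ + _)%type) => [[F|[x y]]|[b e]] bc suppW.
- exists G; split=> //; by exists pi.
- move=> dx dy; have nin z : depth z <= i -> z \notin nms a d.
    by move=> dz; apply/negP => /depth_nms e; rewrite e da ltnn in dz.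
  rewrite /= /pi (negbTE (nin x dx)) (negbTE (nin y dy)).
  have xW : x \in W by apply: suppW; [rewrite !inE eqxx | exact: leqW].
  have yW : y \in W by apply: suppW; [rewrite !inE eqxx orbT | exact: leqW].
  have /= [-> ->] := th x y xW yW; exact: agS'.
- case: bc => [Sp|[eb ee]].
    have db := depS _ Sp; rewrite /= in db.
    have nin z : z \in b ++ nms b e -> z \notin nms a d /\ z \in W.
      move=> zb; split; last first.
        apply: suppW => //; move: zb; rewrite mem_cat => /orP[/depthsP|/depth_nms->]; last by rewrite db.
        by rewrite db => /leqW.
      apply/negP => za; move: zb; rewrite mem_cat => /orP[/depthsP|].
        by rewrite (depth_nms za) db da ltnn.
      move: za => /mapP[j _ ->] /mapP[j' _ [ed _ ea]].
      by apply: nSad; rewrite ed ea.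
    have := HS' (inr (b, e)) Sp; rewrite /holds_cond.
    apply: promise_loc => x y /= /nin[xn xW] /nin[yn yW].
    by rewrite /pi (negbTE xn) (negbTE yn); apply: th.
  subst b e; rewrite /promise /=.
  have tpi : tab (map pi (a ++ nms a d)) = d.
    rewrite map_cat -[RHS]tw; congr (tab (_ ++ _)).
      apply/eq_in_map => x xa; rewrite /pi ifN //.
      by apply/negP => /depth_nms e; have := depthsP xa; rewrite e ltnn.
    have sw : size w = size (nms a d).
      by rewrite /nms size_mkseq -tw size_tab size_cat size_map addKn.
    apply: (@eq_from_nth _ (pi (NBase x0))); first by rewrite size_map.
    move=> j; rewrite size_map => jn; pose k0 : K := NBase x0.
    rewrite (nth_map k0) // /pi mem_nth // index_uniq //; last first.
      by rewrite mkseq_uniq // => j1 j2 [].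
    by apply: set_nth_default; rewrite sw.
  rewrite -{2}tpi; symmetry.
  by apply: (@tab_map (kstr (fun x y => sE (pi x) (pi y), fun x y => sQ (pi x) (pi y))) (gstr G) pi).
Qed.

Theorem ec_extension : exists (N : str) (iota : N0 -> N),
  [/\ forall x y, sE (iota x) (iota y) = sE x y /\ sQ (iota x) (iota y) = sQ x y,
      isC C N & ec N].
Proof.
pose pr0 (k : K) : N0 := if k is NBase x then x else x0.
pose S0 : rel K * rel K := (fun x y => sE (pr0 x) (pr0 y), fun x y => sQ (pr0 x) (pr0 y)).
have CS0 : isC C (kstr S0).
  move=> F; have [G [CG [h th]]] := C0 (map pr0 F).
  exists G; split=> //; exists (h \o pr0); apply: (tabp_comp (h := pr0 : kstr S0 -> N0)) => //.
have /choice[f Hf] : forall iS : nat * (rel K * rel K), exists S', isC C (kstr iS.2) ->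
   [/\ isC C (kstr S'), agree iS.1 iS.2 S' &
    forall (a : seq K) d, depths a = iS.1 -> promise S' (a, d) \/
      exists W : seq K, [/\ {subset a <= W}, forall x, x \in W -> depth x <= iS.1.+1 & @dead (kstr S') W a d]].
  move=> [i S]; have [CS|nCS] := pselect (isC C (kstr S)); last by exists S.
  by have [S' H] := ec_step i CS; exists S'.
pose fix S (i : nat) : rel K * rel K := if i is i'.+1 then f (i', S i') else S0.
have CS i : isC C (kstr (S i)) by elim: i => //= i /(Hf (i, _))[].
have ag1 i : agree i (S i) (S i.+1) by have [] := Hf (i, S i) (CS i).
have ag i j : i <= j -> agree i (S i) (S j).
  move=> /subnK <-; elim: (j - i) => [|k IH] x y dx dy //.
  have [e1 e2] := IH x y dx dy.
  by have [-> ->] := ag1 (k + i) x y (leq_trans dx (leq_addl _ _)) (leq_trans dy (leq_addl _ _)).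
(* The relations on names of depth at most [i] no longer change from stage [i] on. *)
pose Sw : rel K * rel K := (fun x y => (S (maxn (depth x) (depth y))).1 x y,
                            fun x y => (S (maxn (depth x) (depth y))).2 x y).
have agw i : agree i (S i) Sw.
  move=> x y dx dy; rewrite /Sw /=.
  have m : maxn (depth x) (depth y) <= i by rewrite geq_max dx dy.
  by have [-> ->] := ag _ _ m x y (leq_maxl _ _) (leq_maxr _ _).
exists (kstr Sw), (fun x => NBase x : K); split.
- by [].
- move=> F; have [G [CG [h th]]] := CS (depths F) F.
  exists G; split=> //; exists h => x y xF yF.
  have /= [-> ->] := th x y xF yF.
  by have /= [-> ->] := agw (depths F) x y (depthsP xF) (depthsP yF).
move=> a d; have [_ _ /(_ a d erefl)] := Hf (depths a, S (depths a)) (CS (depths a)).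
rewrite -[f _]/(S (depths a).+1); case=> [pr|[W [aW dW dd]]].
  left; exists (nms a d).
  apply: (promise_loc (S := S (depths a).+1) (p := (a, d))) pr => x y xs ys.
  have dx z : z \in a ++ nms a d -> depth z <= (depths a).+1.
    by rewrite mem_cat => /orP[/depthsP/leqW|/depth_nms->].
  exact: (agw (depths a).+1 x y (dx x xs) (dx y ys)).
right; exists W; split=> // -[G [CG [h [w [th tw]]]]]; apply: dd.
exists G; split=> //; exists h, w; split=> // x y xW yW.
have /= [-> ->] := th x y xW yW.
by have /= [-> ->] := agw (depths a).+1 x y (dW x xW) (dW y yW).
Qed.
End Extension.
End Dead.

(** * Ultraproducts *)

Lemma ssat_free (S : str) (U : pred S) psi (rho rho' : nat -> S) :
  (forall x, free_in x psi -> rho x = rho' x) -> ssat U rho psi <-> ssat U rho' psi.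
Proof.
elim: psi rho rho' => [x y|x y|f IH|f IHf g IHg|x f IH] rho rho' /= e.
- by rewrite !e ?eqxx ?orbT.
- by rewrite !e ?eqxx ?orbT.
- by rewrite (IH rho rho').
- by rewrite (IHf rho rho') ?(IHg rho rho') // => x fx; apply: e; rewrite fx ?orbT.
- suff ee a : ssat U (upd rho x a) f <-> ssat U (upd rho' x a) f.
    by split=> -[a [Ua fa]]; exists a; split=> //; apply/ee.
  apply: IH => y fy; rewrite /upd; case: eqP => // yx; apply: e; rewrite fy andbT.
  exact/eqP.
Qed.

Lemma sat_gstr (G : graph) rho psi : sat (G := G) rho psi <-> @ssat (gstr G) predT rho psi.
Proof.
elim: psi rho => [x y|x y|f IH|f IHf g IHg|x f IH] rho //=.
- by split=> [->|/eqP].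
- by rewrite IH.
- by rewrite IHf IHg.
- by split=> [[a /IH fa]|[a [_ /IH fa]]]; exists a.
Qed.

Definition asg (T : Type) (k : nat) (u v : nat -> T) : nat -> T :=
  fun i => if i < k then u i else v (i - k).

Section UltraProduct.
Variables (J : Type) (U : set_system J) (G : J -> graph).
Hypothesis uU : UltraFilter U.
Variable g0 : forall j, vtx (G j).

Let PU : ProperFilter U. Proof. exact: ultra_proper. Qed.

Definition uprod_car : eqType := {classic (forall j, vtx (G j))}.
Definition ev (j : J) (f : uprod_car) : vtx (G j) := (f : forall j, vtx (G j)) j.
Definition uprod : str :=
  @Str uprod_car (fun f g => ulim U (fun j => adj (ev j f) (ev j g)))
                 (fun f g => ulim U (fun j => ev j f == ev j g)).

Lemma uprod_isC (C : gclass) : (forall j, C (G j)) -> isC C uprod.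
Proof.
move=> CG F; pose prs := [seq (x, y) | x <- F, y <- F].
have u1 := ulim_all uU prs (fun p j => adj (ev j p.1) (ev j p.2)).
have u2 := ulim_all uU prs (fun p j => ev j p.1 == ev j p.2).
have [j [h1 h2]] := filter_ex (filterI u1 u2).
exists (G j); split=> //; exists (ev j) => x y xF yF.
have pin : (x, y) \in prs by apply/allpairsP; exists (x, y).
by rewrite /= -(h1 _ pin) -(h2 _ pin).
Qed.

Lemma uprod_los psi (rho : nat -> uprod) :
  ssat predT rho psi <-> U (fun j => sat (fun i => ev j (rho i)) psi).
Proof.
elim: psi rho => [x y|x y|f IH|f IHf g IHg|x f IH] rho /=.
- by split=> [/asboolP|?] //; apply/asboolP.
- split=> [/asboolP|h]; first by apply: filterS => j /eqP.
  by apply/asboolP; apply: filterS h => j /eqP.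
- rewrite IH; split=> [nf|Unf Uf].
    by case: (in_ultra_setVsetC (fun j => sat (fun i => ev j (rho i)) f) uU).
  by have [j [h1 h2]] := filter_ex (filterI Unf Uf).
- rewrite IHf IHg; split=> [[h1 h2]|h]; first exact: filterI.
  by split; apply: filterS h => j [].
- have e a j : (fun i => ev j (upd rho x a i)) = upd (fun i => ev j (rho i)) x (ev j a).
    by apply: funext => i; rewrite /upd; case: ifP.
  split=> [[a [_ /IH fa]]|h].
    by apply: filterS fa => j; rewrite e => fa; exists (ev j a).
  have /all_sig[a Ha] : forall j, {aj : vtx (G j) |
      (exists a, sat (upd (fun i => ev j (rho i)) x a) f) ->
      sat (upd (fun i => ev j (rho i)) x aj) f}.
    move=> j; apply: cid; have [[a fa]|na] := pselect (exists a, sat (upd (fun i => ev j (rho i)) x a) f).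
      by exists a.
    by exists (g0 j) => /na.
  exists (a : uprod_car); split=> //; apply/IH.
  by apply: filterS h => j /(Ha j); rewrite e.
Qed.

End UltraProduct.

Lemma holds_atP (G : graph) (g0 : vtx G) k l phi (u : 'I_k -> vtx G) (v : 'I_l -> vtx G) :
  (forall x, free_in x phi -> x < k + l) ->
  holds_at phi u v <->
  sat (asg k (fun i => if insub i is Some j then u j else g0)
             (fun i => if insub i is Some j then v j else g0)) phi.
Proof.
move=> fr; split; last first.
  move=> h; eexists; split; last split; last exact: h.
    by move=> j; rewrite /asg ltn_ord valK.
  by move=> j /=; rewrite /asg ltnNge leq_addr /= addKn valK.
move=> [rho [hu [hv /sat_gstr h]]]; apply/sat_gstr; move: h.
apply: (@ssat_free (gstr G) predT phi _ _ _).1 => x /fr xkl; rewrite /asg.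
case: ltnP => xk; first by rewrite insubT -hu.
have xl : x - k < l by rewrite ltn_subLR.
by rewrite insubT -hv /= subnKC.
Qed.

Definition shatters (S : str) (U : pred S) (k : nat) (phi : formula) (Y : eqType) (x : Y -> nat -> S) :=
  forall (ys : seq Y) (b : Y -> bool), exists v : nat -> S, (forall i, U (v i)) /\
    forall y, y \in ys -> (ssat U (asg k (x y) v) phi <-> b y).

(** The ultraproduct is indexed by finite lists of elements of [Y], and [y] is interpreted by the
    tuple numbered by its position in the list. One spare tuple keeps the graph nonempty, even for
    the empty list, and gives [inord] a target. *)
Theorem shattered_structure (C : gclass) k l phi (Y : eqType) :
  (forall x, free_in x phi -> x < k + l) ->
  (forall n : nat, exists G : graph, C G /\
      exists (u : 'I_n -> 'I_k -> vtx G) (v : {set 'I_n} -> 'I_l -> vtx G),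
        forall (i : 'I_n) (J : {set 'I_n}), holds_at phi (u i) (v J) <-> i \in J) ->
  exists (S : str) (s0 : S) (x : Y -> nat -> S), isC C S /\ shatters predT k phi x.
Proof.
move=> fr ind.
have /choice[G HG] : forall L : seq Y, exists G : graph, C G /\
    exists (g0 : vtx G) (u : 'I_(size L).+1 -> 'I_k -> vtx G) (v : {set 'I_(size L).+1} -> 'I_l -> vtx G),
        forall i J, holds_at phi (u i) (v J) <-> i \in J.
  move=> L; have [G [CG [u [v H]]]] := ind (size L).+1; exists G; split=> //.
  have [rho _] : holds_at phi (u ord0) (v [set: 'I_(size L).+1]%SET) by apply/H; rewrite inE.
  by exists (rho 0), u, v.
have /all_sig[d Hd] : forall L : seq Y, {d : vtx (G L) * ('I_(size L).+1 -> 'I_k -> vtx (G L)) *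
   ({set 'I_(size L).+1} -> 'I_l -> vtx (G L)) |
   forall i J, holds_at phi (d.1.2 i) (d.2 J) <-> i \in J}.
  move=> L; apply: cid; have [_ [g0 [u [v H]]]] := HG L.
  by exists (g0, u, v).
pose g0 L := (d L).1.1.
have [U [uU fineU]] := fine_ultrafilter Y.
have PU : ProperFilter U by exact: ultra_proper.
pose x (y : Y) (c : nat) : uprod U G :=
  (fun L => if insub c is Some j then (d L).1.2 (inord (index y L)) j else g0 L).
exists (uprod U G), (g0 : uprod U G), x; split.
  by apply: uprod_isC => // L; case: (HG L).
move=> ys b.
pose JL L : {set 'I_(size L).+1} := [set i : 'I__ | has (fun y => b y && (index y L == i)) L]%SET.
pose v (c : nat) : uprod U G :=
  (fun L => if insub c is Some j then (d L).2 (JL L) j else g0 L).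
exists v; split=> // y yys; rewrite uprod_los //.
have key L : y \in L -> (sat (fun i => ev L (asg k (x y) v i)) phi <-> b y).
  move=> yL; set rho := (fun i => _).
  have -> : rho = asg k (fun i => if insub i is Some j then (d L).1.2 (inord (index y L)) j else g0 L)
             (fun i => if insub i is Some j then (d L).2 (JL L) j else g0 L).
    by apply: funext => i; rewrite /rho /asg /ev; case: ifP.
  rewrite -holds_atP // Hd inE inordK; last by rewrite ltnS index_size.
  split=> [/hasP[y' y'L /andP[by' /eqP e]]|by_]; last by apply/hasP; exists y; rewrite ?by_ ?eqxx.
  by rewrite -(nth_index y yL) -e nth_index.
split=> [h|by_].
  have [L [h1 h2]] := filter_ex (filterI h (fineU [:: y])).
  by apply/(key L) => //; apply: h2; rewrite inE.
apply: filterS (fineU [:: y]) => L sub; apply/key => //.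
by apply: sub; rewrite inE.
Qed.

(** * Skolem terms and the Ehrenfeucht-Mostowski structure *)

(* [OW d j] and [OC d j] are the [j]-th elements of a realisation of the diagram [d],
   resp. of a certificate that [d] is not realised; [OF] are the Skolem functions,
   [OV] the parameters of a shattering pattern and [OD] is a default value. *)
Inductive op := OW of pat & nat | OC of pat & nat | OF of nat & formula
  | OV of nat & seq bool | OD.

(** [TVar i c] is the [c]-th coordinate of the tuple with index [i]. *)
Inductive term (I : Type) : Type := TVar of I & nat | TApp of op & seq (term I).
Arguments TApp {I}.

Section TermInd.
Variables (I : Type) (P : term I -> Prop).
Hypothesis PV : forall i c, P (TVar i c).
Fixpoint Pall (ts : seq (term I)) : Prop :=
  if ts is t :: ts' then P t /\ Pall ts' else True.
Hypothesis PA : forall o ts, Pall ts -> P (TApp o ts).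
Fixpoint term_ind' (t : term I) : P t :=
  match t with
  | TVar i c => PV i c
  | TApp o ts => PA o ((fix F ts : Pall ts := match ts with
      | [::] => Logic.I | t :: ts' => conj (term_ind' t) (F ts') end) ts)
  end.
End TermInd.

Fixpoint teval (I : Type) (V : Type) (f : op -> seq V -> V) (z : I -> nat -> V) (t : term I) : V :=
  match t with
  | TVar i c => z i c
  | TApp o ts => f o (map (teval f z) ts)
  end.

Fixpoint tren (I I' : Type) (r : I -> I') (t : term I) : term I' :=
  match t with
  | TVar i c => TVar (r i) c
  | TApp o ts => TApp o (map (tren r) ts)
  end.

Fixpoint tsupp (I : Type) (t : term I) : seq I :=
  match t with
  | TVar i c => [:: i]
  | TApp o ts => flatten (map (@tsupp I) ts)
  end.

Lemma teval_ren (I I' : Type) (V : Type) f (z : I' -> nat -> V) (r : I -> I') t :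
  teval f z (tren r t) = teval f (z \o r) t.
Proof.
elim/term_ind': t => // o ts IH /=; congr (f o _).
by elim: ts IH => //= t ts IH [-> /IH ->].
Qed.

Lemma teval_ext (I : eqType) (V : Type) f (z z' : I -> nat -> V) t :
  (forall i, i \in tsupp t -> z i = z' i) -> teval f z t = teval f z' t.
Proof.
elim/term_ind': t => [i c|o ts IH] /= e; first by rewrite e ?inE.
congr (f o _); elim: ts IH e => //= t ts IH [h hs] e; congr cons.
  by apply: h => i it; apply: e; rewrite mem_cat it.
by apply: IH => // i it; apply: e; rewrite mem_cat it orbT.
Qed.

Lemma tren_ext (I : eqType) (I' : Type) (r r' : I -> I') t :
  (forall i, i \in tsupp t -> r i = r' i) -> tren r t = tren r' t.
Proof.
elim/term_ind': t => [i c|o ts IH] /= e; first by rewrite e ?inE.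
congr (TApp o _); elim: ts IH e => //= t ts IH [h hs] e; congr cons.
  by apply: h => i it; apply: e; rewrite mem_cat it.
by apply: IH => // i it; apply: e; rewrite mem_cat it orbT.
Qed.

Lemma tren_id (I : Type) (t : term I) : tren id t = t.
Proof.
elim/term_ind': t => //= o ts IH; congr (TApp o _).
by elim: ts IH => //= t ts IH [-> /IH ->].
Qed.

Lemma tren_comp (I I' I'' : Type) (r : I -> I') (r' : I' -> I'') t :
  tren r' (tren r t) = tren (r' \o r) t.
Proof.
elim/term_ind': t => //= o ts IH; congr (TApp o _).
by elim: ts IH => //= t ts IH [-> /IH ->].
Qed.

Lemma tsupp_ren (I I' : Type) (r : I -> I') t : tsupp (tren r t) = map r (tsupp t).
Proof.
elim/term_ind': t => //= o ts IH.
by elim: ts IH => //= t ts IH [-> /IH ->]; rewrite map_cat.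
Qed.

(** * Skolemised models *)

Section Models.
Variables (C : gclass) (k : nat) (phi : formula).

Definition blockv (T : Type) (s0 : T) (l : seq T) (r : nat) : nat -> T :=
  fun c => nth s0 l (r * k + c).

(** The length [q] of a certificate in [m_ec] is not bounded in advance, so this is not a
    first-order axiom. It can be used for the final structure because each finite part of that
    structure is realised in a model. *)
Record model (mS : str) (mU : pred mS) := Model {
  mf : op -> seq mS -> mS;
  m_isC : isC C mS;
  m_ec : forall (a : seq mS) (d : pat),
    tab (a ++ mkseq (fun j => mf (OW d j) a) (size d.1 - size a)) = d \/
    exists q, dead C (a ++ mkseq (fun j => mf (OC d j) a) q) a d;
  m_UD : forall l, mU (mf OD l);
  m_UF : forall x f l, mU (mf (OF x f) l);
  m_UV : forall j b l, mU (mf (OV j b) l);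
  m_fo : forall x f l, (exists a, mU a /\ ssat mU (upd (nth (mf OD [::]) l) x a) f) ->
    ssat mU (upd (nth (mf OD [::]) l) x (mf (OF x f) l)) f;
  m_ip : forall l b,
    (exists v : nat -> mS, (forall i, mU (v i)) /\ forall r, r < size b ->
       (ssat mU (asg k (blockv (mf OD [::]) l r) v) phi <-> nth false b r)) ->
    forall r, r < size b ->
       (ssat mU (asg k (blockv (mf OD [::]) l r) (fun j => mf (OV j b) l)) phi <-> nth false b r) }.

Lemma model_of (S : str) (U : pred S) (s0 : S) : isC C S -> ec C S -> U s0 ->
  inhabited (model U).
Proof.
move=> CS ecS Us0.
have /choice[wc Hwc] : forall ad : seq S * pat, exists wW : seq S * seq S,
    tab (ad.1 ++ wW.1) = ad.2 \/ dead C (ad.1 ++ wW.2) ad.1 ad.2.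
  move=> [a d] /=; have [[w tw]|[W [aW dW]]] := ecS a d; first by exists (w, [::]); left.
  exists ([::], W); right=> -[G [CG [h [w [th tw]]]]]; apply: dW; exists G; split=> //.
  exists h, w; split=> //; apply: tabp_sub th => x; by rewrite mem_cat orbC => ->.
have /choice[fo Hfo] : forall q : nat * formula * seq S, exists a : S, U a /\
   ((exists a, U a /\ ssat U (upd (nth s0 q.2) q.1.1 a) q.1.2) ->
     ssat U (upd (nth s0 q.2) q.1.1 a) q.1.2).
  move=> [[x f] l] /=.
  have [[a [Ua fa]]|na] := pselect (exists a, U a /\ ssat U (upd (nth s0 l) x a) f).
    by exists a.
  by exists s0; split=> // /na.
have /choice[ip Hip] : forall q : seq S * seq bool, exists v : nat -> S, (forall i, U (v i)) /\
  ((exists v : nat -> S, (forall i, U (v i)) /\ forall r, r < size q.2 ->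
       (ssat U (asg k (blockv s0 q.1 r) v) phi <-> nth false q.2 r)) ->
    forall r, r < size q.2 -> (ssat U (asg k (blockv s0 q.1 r) v) phi <-> nth false q.2 r)).
  move=> [l b] /=; have [[v [Uv Hv]]|na] := pselect (exists v : nat -> S, (forall i, U (v i)) /\
       forall r, r < size b -> (ssat U (asg k (blockv s0 l r) v) phi <-> nth false b r)).
    by exists v.
  by exists (fun _ => s0); split=> // /na.
pose f (o : op) (l : seq S) : S := match o with
  | OW d j => nth s0 (wc (l, d)).1 j
  | OC d j => nth s0 (wc (l, d)).2 j
  | OF x f => fo (x, f, l)
  | OV j b => ip (l, b) j
  | OD => s0 end.
apply: inhabits; apply: (@Model S U f CS).
- move=> a d; have /= [tw|dw] := Hwc (a, d); last first.
    right; exists (size (wc (a, d)).2); move: dw.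
    by rewrite /f mkseq_nth.
  left; rewrite /f; have -> : size d.1 - size a = size (wc (a, d)).1.
    by rewrite -{1}tw size_tab size_cat addKn.
  by rewrite mkseq_nth.
- by [].
- by move=> x g l; have [] := Hfo (x, g, l).
- by move=> j b l; have [H _] := Hip (l, b); apply: H.
- by move=> x g l; have [_] := Hfo (x, g, l).
- by move=> l b; have [_] := Hip (l, b).
Qed.

End Models.

Lemma cantor_collision (H : Type) (f : (H -> Prop) -> H) : exists i j, i <> j /\ f i = f j.
Proof.
apply: contrapT => noc; have fi i j : f i = f j -> i = j.
  by move=> e; apply: contrapT => ij; apply: noc; exists i, j.
pose D : H -> Prop := fun x => exists A, f A = x /\ ~ A x.
have [/[dup] h [A [e nA]]|nD] := pselect (D (f D)); first by apply: nA; rewrite (fi A D).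
by apply: (nD); exists D.
Qed.

Definition strict_lin (Y : eqType) (lt : rel Y) : Prop :=
  [/\ irreflexive lt, transitive lt & forall x y, x != y -> lt x y || lt y x].

Lemma strict_wo_lin (Y : eqType) (lt : rel Y) : strict_wo lt -> strict_lin lt.
Proof. by case. Qed.

Section Sorting.
Variables (Y : eqType) (lt : rel Y).
Hypothesis lin : strict_lin lt.

Definition sL (L : seq Y) : seq Y := sort (fun i j => (i == j) || lt i j) (undup L).

Lemma sL_uniq L : uniq (sL L).
Proof. by rewrite sort_uniq undup_uniq. Qed.

Lemma mem_sL L : sL L =i L.
Proof. by move=> x; rewrite mem_sort mem_undup. Qed.

Lemma sL_sorted L : sorted lt (sL L).
Proof.
have [ir tr to] := lin.
have tr' : transitive (fun i j => (i == j) || lt i j).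
  move=> b a c /orP[/eqP->//|ab] /orP[/eqP<-|bc]; first by rewrite ab orbT.
  by rewrite (tr _ _ _ ab bc) orbT.
have to' : total (fun i j => (i == j) || lt i j).
  move=> a b; have [->|/to/orP[]->] := eqVneq a b; by rewrite ?orbT ?eqxx.
have := sort_sorted to' (undup L); have := sL_uniq L.
rewrite -/(sL L) !sorted_pairwise // uniq_pairwise => h1 h2.
move: (conj h1 h2) => /andP; rewrite -pairwise_relI.
by apply: sub_pairwise => a b /= /andP[/negbTE ->].
Qed.

Lemma sorted_lt_nth y0 (s : seq Y) i j : sorted lt s -> i < j -> j < size s ->
  lt (nth y0 s i) (nth y0 s j).
Proof.
have [ir tr to] := lin.
move=> so ij js; apply: (sorted_ltn_nth tr) => //; exact: ltn_trans js.
Qed.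

Lemma sorted_lt_uniq (s : seq Y) : sorted lt s -> uniq s.
Proof. by have [ir tr to] := lin; apply: sorted_uniq. Qed.

Definition rk (L : seq Y) (i : Y) : nat := index i (sL L).

Lemma rk_mono (L : seq Y) i j :
  i \in L -> j \in L -> lt i j -> rk L i < rk L j.
Proof.
move=> iL jL ij; have [ir tr _] := lin.
rewrite ltnNge leq_eqVlt; apply/negP => /orP[/eqP e|e].
  have eij : i = j.
    by rewrite -(nth_index i (s := sL L) (x := i)) ?mem_sL // -/(rk L i) -e nth_index ?mem_sL.
  by rewrite eij ir in ij.
have := @sorted_lt_nth i (sL L) _ _ (sL_sorted L) e.
rewrite index_mem mem_sL iL !nth_index ?mem_sL // => /(_ isT) ji.
by have := tr _ _ _ ij ji; rewrite ir.
Qed.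

Lemma infinite_sorted (H : pred Y) n : ~ inj_on H nat ->
  exists s, [/\ sorted lt s, all H s & size s = n].
Proof.
move=> ni; suff [s [us sH sn]] : exists s, [/\ uniq s, all H s & size s = n].
  exists (sL s); split; first exact: sL_sorted.
    by apply/allP => x; rewrite mem_sL; apply: (allP sH).
  by rewrite size_sort undup_id.
elim: n => [|n [s [us sH sn]]]; first by exists [::].
have [[y [Hy ys]]|none] := pselect (exists y, H y /\ y \notin s).
  by exists (y :: s); rewrite /= us ys Hy sH sn.
exfalso; apply: ni; exists (fun y => index y s) => x y Hx Hy e.
have mem z : H z -> z \in s.
  by move=> Hz; apply/negP => /negP zs; apply: none; exists z.
by rewrite -(nth_index x (mem x Hx)) e nth_index ?mem.
Qed.

End Sorting.

(** * Types common to arbitrarily long sequences *)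

Section Types.
Variables (C : gclass) (k l : nat) (phi : formula).

Record ty := Ty {
  tE : term nat -> term nat -> bool;
  tQ : term nat -> term nat -> bool;
  tU : term nat -> bool;
  tS : formula -> (nat -> term nat) -> Prop }.

Definition tp (S : str) (U : pred S) (M : model C k phi U) (z : nat -> nat -> S) : ty :=
  Ty (fun t t' => sE (teval (mf M) z t) (teval (mf M) z t'))
     (fun t t' => sQ (teval (mf M) z t) (teval (mf M) z t'))
     (fun t => U (teval (mf M) z t))
     (fun psi rho => ssat U (fun i => teval (mf M) z (rho i)) psi).

(* [p n] is the common type of the increasing [n]-tuples of a set that can be chosen
   in models of unbounded cardinality. *)
Definition good (n : nat) (p : nat -> ty) : Prop :=
  forall X : Type, exists (S : str) (U : pred S) (M : model C k phi U)
     (Y : eqType) (lt : rel Y) (H : pred Y) (y0 : Y) (x : Y -> nat -> S),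
  [/\ strict_wo lt, ~ inj_on H X, forall y c, U (x y c), shatters U k phi x
    & forall ys, size ys < n -> sorted lt ys -> all H ys ->
        tp M (fun i => x (nth y0 ys i)) = p (size ys)].

(** If every candidate type [t] failed at some size [Xf t], all candidates would fail beyond the
    disjoint sum of these sizes; but there the Erdos-Rado theorem yields a homogeneous set, whose
    type is one of the candidates. *)
Lemma good_step n p : good n p -> exists t, good n.+1 (fun m => if m == n then t else p m).
Proof.
move=> gp; apply: contrapT => bad.
have bad' t : exists X : Type, ~ exists (S : str) (U : pred S) (M : model C k phi U)
     (Y : eqType) (lt : rel Y) (H : pred Y) (y0 : Y) (x : Y -> nat -> S),
  [/\ strict_wo lt, ~ inj_on H X, forall y c, U (x y c), shatters U k phi x
    & forall ys, size ys < n.+1 -> sorted lt ys -> all H ys ->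
        tp M (fun i => x (nth y0 ys i)) = (fun m => if m == n then t else p m) (size ys)].
  by apply/existsNP => H; apply: bad; exists t.
have [Xf HX] := choice bad'.
have [X' HX'] := erdos_rado ty n {t : ty & Xf t}.
have [S [U [M [Y [lt [H [y0 [x [wo nH Ux sh tps]]]]]]]]] := gp X'.
have [H' [sub nH' [t Ht]]] := HX' Y lt H (fun ys => tp M (fun i => x (nth y0 ys i))) wo nH.
apply: (HX t); exists S, U, M, Y, lt, H', y0, x; split=> //.
  move=> [f fi]; apply: nH'; exists (fun y => existT _ t (f y)) => a b Ha Hb e.
  apply: fi => //; have := projT2_eq e.
  by rewrite (Prop_irrelevance (projT1_eq e) erefl).
move=> ys; rewrite ltnS leq_eqVlt => /orP[/eqP sn|sn] so aH.
  by rewrite sn eqxx; apply: Ht.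
rewrite (ltn_eqF sn); apply: tps => //; apply/allP => y /(allP aH); exact: sub.
Qed.

Lemma good_limit : good 0 (fun _ => Ty (fun _ _ => true) (fun _ _ => true) (fun _ => true) (fun _ _ => True)) ->
  exists p, forall n, good n p.
Proof.
move=> g0.
have /choice[f Hf] : forall np : nat * (nat -> ty), exists t, good np.1 np.2 ->
    good np.1.+1 (fun m => if m == np.1 then t else np.2 m).
  move=> [n p] /=; have [/good_step[t]|ng] := pselect (good n p); first by exists t.
  by exists (p 0).
pose fix g (n : nat) : nat -> ty := if n is n'.+1
  then (fun m => if m == n' then f (n', g n') else g n' m)
  else (fun _ => Ty (fun _ _ => true) (fun _ _ => true) (fun _ => true) (fun _ _ => True)).
have gg n : good n (g n) by elim: n => //= n /(Hf (n, _)).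
have gm m d : g (d + m.+1) m = g m.+1 m.
  elim: d => // d IH; rewrite addSn [LHS]/= IH.
  by rewrite ltn_eqF // addnS ltnS leq_addl.
exists (fun m => g m.+1 m) => n X.
have [S [U [M [Y [lt [H [y0 [x [wo nH Ux sh tps]]]]]]]]] := gg n X.
exists S, U, M, Y, lt, H, y0, x; split=> // ys sn so aH.
by rewrite tps // -(gm _ (n - (size ys).+1)) subnK.
Qed.

End Types.

Lemma ssat_embed (S S' : str) (iota : S -> S') (U' : pred S') psi (rho : nat -> S) :
  (forall x y, sE (iota x) (iota y) = sE x y /\ sQ (iota x) (iota y) = sQ x y) ->
  (forall s, U' s <-> exists x, iota x = s) ->
  ssat U' (fun i => iota (rho i)) psi <-> ssat predT rho psi.
Proof.
move=> ie U'P; elim: psi rho => [x y|x y|f IH|f IHf g IHg|x f IH] rho /=.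
- by rewrite (ie _ _).1.
- by rewrite (ie _ _).2.
- by rewrite IH.
- by rewrite IHf IHg.
- have e a : upd (fun i => iota (rho i)) x (iota a) = (fun i => iota (upd rho x a i)).
    by apply: funext => i; rewrite /upd; case: ifP.
  split=> [[b [/U'P[a <-]]]|[a [_ fa]]]; first by rewrite e IH => fa; exists a.
  by exists (iota a); split; [apply/U'P; exists a | rewrite e IH].
Qed.

Lemma good_base (C : gclass) k l phi p :
  (forall x, free_in x phi -> x < k + l) ->
  (forall n : nat, exists G : graph, C G /\
      exists (u : 'I_n -> 'I_k -> vtx G) (v : {set 'I_n} -> 'I_l -> vtx G),
        forall (i : 'I_n) (J : {set 'I_n}), holds_at phi (u i) (v J) <-> i \in J) ->
  good C k phi 0 p.
Proof.
move=> fr ind X.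
(* By Cantor's theorem this index set does not inject into [X]. *)
pose Y : eqType := {classic (X -> Prop)}.
have [S0 [s0 [x0 [CS0 sh0]]]] := @shattered_structure C k l phi Y fr ind.
have [N [iota [ie CN ecN]]] := ec_extension s0 CS0.
pose U : pred N := fun s => `[< exists x, iota x = s >].
have UP s : U s <-> exists x, iota x = s by split=> /asboolP.
have [M] : inhabited (model C k phi U) by apply: (model_of k phi (s0 := iota s0)) => //; apply/UP; exists s0.
have [lt wo] := strict_wo_exists Y.
exists N, U, M, Y, lt, predT, (fun _ => False), (fun y c => iota (x0 y c)); split=> //.
- move=> [f fi]; have [A [A' [ne e]]] := cantor_collision (f : (X -> Prop) -> X).
  by apply: ne; apply: fi.
- by move=> y c; apply/UP; exists (x0 y c).
- move=> ys b; have [v [_ Hv]] := sh0 ys b.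
  exists (fun i => iota (v i)); split; first by move=> i; apply/UP; exists (v i).
  move=> y yys; rewrite -(Hv y yys) -(ssat_embed phi (asg k (x0 y) v) ie UP).
  have -> : (fun i => iota (asg k (x0 y) v i)) = asg k (fun c => iota (x0 y c)) (fun i => iota (v i)).
    by apply: funext => i; rewrite /asg; case: ifP.
  by [].
Qed.

Section emstr.
Variables (C : gclass) (k : nat) (phi : formula) (p : nat -> ty).
Hypothesis gp : forall n, good C k phi n p.
Variables (I : eqType) (lt : rel I).
Hypothesis lin : strict_lin lt.

Definition TI : eqType := {classic (term I)}.
Definition pT (L : seq I) : ty := p (size (sL lt L)).
Definition std (L : seq I) (t : TI) : term nat := tren (rk lt L) t.

Definition emstr : str := @Str TI
  (fun t t' => let L := tsupp t ++ tsupp t' in tE (pT L) (std L t) (std L t'))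
  (fun t t' => let L := tsupp t ++ tsupp t' in tQ (pT L) (std L t) (std L t')).
Definition emU : pred emstr := fun t => tU (pT (tsupp t)) (std (tsupp t) t).
Definition emS (L : seq I) (psi : formula) (rho : nat -> emstr) : Prop :=
  tS (pT L) psi (fun i => std L (rho i)).

Definition supp_in (L : seq I) (t : emstr) : Prop := {subset tsupp (t : term I) <= L}.

(** [good] is used at size [nat] only to find enough increasing elements. The last clause covers all
    sublists because a relation between terms is read from the indices of these terms and not from
    [L0]. *)
Lemma realize (L0 : seq I) : exists (S : str) (U : pred S) (M : model C k phi U) (z : I -> nat -> S),
  [/\ forall i c, U (z i c),
      forall b : I -> bool, exists v : nat -> S, (forall i, U (v i)) /\
        forall i, i \in L0 -> (ssat U (asg k (z i) v) phi <-> b i)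
    & forall L : seq I, {subset L <= L0} -> exists z' : nat -> nat -> S,
        tp M z' = pT L /\ forall i, i \in L -> z' (rk lt L i) = z i].
Proof.
have [S [U [M [Y [ltY [H [y0 [x [wo nH Ux sh tps]]]]]]]]] := gp (size (sL lt L0)).+1 nat.
have linY := strict_wo_lin wo.
have [ys [sys aH sz]] := infinite_sorted linY (size (sL lt L0)) nH.
pose z i := x (nth y0 ys (rk lt L0 i)).
have rkL i : i \in L0 -> rk lt L0 i < size ys.
  by move=> iL; rewrite sz index_mem mem_sL.
exists S, U, M, z; split; first by move=> i c; apply: Ux.
  move=> b; pose b' y := has (fun i => b i && (nth y0 ys (rk lt L0 i) == y)) L0.
  have [v [Uv Hv]] := sh [seq nth y0 ys (rk lt L0 i) | i <- L0] b'.
  exists v; split=> // i iL; rewrite Hv; last exact: (map_f (fun i => nth y0 ys (rk lt L0 i))).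
  split=> [/hasP[j jL /andP[bj e]]|bi]; last by apply/hasP; exists i; rewrite ?bi ?eqxx.
  suff -> : i = j by [].
  move: e; rewrite nth_uniq ?rkL ?(sorted_lt_uniq linY) // => /eqP e.
  by rewrite -(nth_index i (s := sL lt L0) (x := i)) ?mem_sL // -/(rk lt L0 i) -e nth_index ?mem_sL.
move=> L sub; pose ys' := [seq nth y0 ys (rk lt L0 i) | i <- sL lt L].
have sub' i : i \in sL lt L -> i \in L0 by rewrite mem_sL; apply: sub.
exists (fun i => x (nth y0 ys' i)); split.
  have sz' : size ys' = size (sL lt L) by rewrite size_map.
  rewrite /pT -sz'; apply: tps.
  - rewrite ltnS sz'; apply: uniq_leq_size; first exact: sL_uniq.
    by move=> i; rewrite !mem_sL; apply: sub.
  - rewrite /ys'; have := sL_sorted lin L.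
    move: sub'; elim: (sL lt L) => // a [|b s] // IH sub' /= /andP[ab so].
    apply/andP; split; last by apply: IH => // i iL; apply: sub'; rewrite inE iL orbT.
    have aL : a \in L0 by apply: sub'; rewrite !inE eqxx.
    have bL : b \in L0 by apply: sub'; rewrite !inE eqxx orbT.
    apply: (sorted_lt_nth linY) => //; [exact: rk_mono | exact: rkL].
  - apply/allP => y /mapP[i iL ->]; apply: (allP aH); apply: mem_nth; apply: rkL; exact: sub'.
move=> i iL; rewrite /z /ys'; congr (x _).
by rewrite (nth_map i) ?index_mem ?mem_sL // nth_index ?mem_sL.
Qed.

Section Realized.
Variables (L0 : seq I) (S : str) (U : pred S) (M : model C k phi U) (z : I -> nat -> S).
Hypothesis rz : forall L : seq I, {subset L <= L0} -> exists z' : nat -> nat -> S,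
        tp M z' = pT L /\ forall i, i \in L -> z' (rk lt L i) = z i.

Let h (t : emstr) : S := teval (mf M) z t.

Lemma teval_std L (z' : nat -> nat -> S) t : supp_in L t ->
  (forall i, i \in L -> z' (rk lt L i) = z i) -> teval (mf M) z' (std L t) = h t.
Proof.
move=> tL ez; rewrite /std teval_ren; apply: teval_ext => i it /=.
by apply: ez; apply: tL.
Qed.

Lemma realized_EQ t t' : supp_in L0 t -> supp_in L0 t' ->
  sE (h t) (h t') = sE t t' /\ sQ (h t) (h t') = sQ t t'.
Proof.
move=> tL tL'; set L := tsupp (t : term I) ++ tsupp (t' : term I).
have [|z' [etp ez]] := rz (L := L).
  by move=> i; rewrite mem_cat => /orP[/tL|/tL'].
rewrite /= -/L -etp /= !teval_std //.
  by move=> i it; rewrite mem_cat it orbT.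
by move=> i it; rewrite mem_cat it.
Qed.

Lemma realized_U t : supp_in L0 t -> U (h t) = emU t.
Proof.
move=> tL; have [|z' [etp ez]] := rz (L := tsupp (t : term I)) => //.
by rewrite /emU -etp /= teval_std.
Qed.

Lemma realized_S L psi (rho : nat -> emstr) : {subset L <= L0} -> (forall i, supp_in L (rho i)) ->
  ssat U (fun i => h (rho i)) psi <-> emS L psi rho.
Proof.
move=> sub rL; have [z' [etp ez]] := rz sub.
rewrite /emS -etp /=.
by have -> : (fun i => teval (mf M) z' (std L (rho i))) = (fun i => h (rho i)) by
  apply: funext => i; rewrite teval_std.
Qed.

End Realized.
End emstr.

Section IsC.
Variables (C : gclass) (S : str).
Hypothesis CS : isC C S.
Lemma isC_refl : reflexive (@sQ S).
Proof.
move=> x; have [G [_ [h th]]] := CS [:: x].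
by have [_ <-] := th x x (mem_head _ _) (mem_head _ _); rewrite /= eqxx.
Qed.
Lemma isC_sym : symmetric (@sE S) /\ symmetric (@sQ S).
Proof.
suff H (x y : S) : sE x y = sE y x /\ sQ x y = sQ y x by split=> x y; case: (H x y).
have [G [_ [h th]]] := CS [:: x; y].
have xi : x \in [:: x; y] by rewrite inE eqxx.
have yi : y \in [:: x; y] by rewrite !inE eqxx orbT.
have [<- <-] := th x y xi yi; have [<- <-] := th y x yi xi.
by rewrite /= adj_sym eq_sym.
Qed.
End IsC.

(** [h] may identify elements of [W], but these are then related by [sQ], and [e], with values in a
    graph, identifies them too. *)
Lemma tabp_factor (C : gclass) (S S' : str) (G : graph) (W : seq S) (h : S -> S') (e : S -> gstr G)
    (g0 : gstr G) : isC C S' -> tabp h W -> tabp e W ->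
  exists th : S' -> gstr G, tabp th (map h W) /\ forall t, t \in W -> th (h t) = e t.
Proof.
move=> CS' tH te; pose th s := nth g0 (map e W) (index s (map h W)).
have the t : t \in W -> th (h t) = e t.
  move=> tW; rewrite /th; have htW : h t \in map h W by apply: map_f.
  have iW : index (h t) (map h W) < size W by rewrite -(size_map h) index_mem.
  rewrite (nth_map t) //; set t' := nth t W _; have t'W : t' \in W by apply: mem_nth.
  have ht' : h t' = h t by rewrite -(nth_map t (h t)) // nth_index.
  have [_ e1] := te t' t t'W tW; have [_ e2] := tH t' t t'W tW.
  by apply/eqP; rewrite -[_ == _]/(sQ (e t') (e t)) e1 -e2 ht' (isC_refl CS').
exists th; split=> // _ _ /mapP[x xW ->] /mapP[y yW ->].
rewrite !the //; have [-> ->] := te x y xW yW.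
by have [-> ->] := tH x y xW yW.
Qed.

Lemma tab_copy (S S' : str) (l : seq S) (l' : seq S') (dflt : S -> S') : tab l = tab l' ->
  tabp (fun x => nth (dflt x) l' (index x l)) l.
Proof.
move=> e x y xl yl; have es : size l = size l' by rewrite -!size_tab e.
rewrite (set_nth_default (dflt x) (dflt y)); last by rewrite -es index_mem.
have [|| <- <-] := @tab_nth _ _ x (dflt x) l l' (index x l) (index y l) e; rewrite ?index_mem //.
rewrite nth_index //.
by rewrite (set_nth_default y) ?index_mem // nth_index.
Qed.

Lemma free_bound psi : exists K, forall x, free_in x psi -> x < K.
Proof.
elim: psi => [x y|x y|f IH|f [K1 H1] g [K2 H2]|x f [K H]] /=.
- by exists (maxn x y).+1 => z /orP[]/eqP->; rewrite ltnS ?leq_maxl ?leq_maxr.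
- by exists (maxn x y).+1 => z /orP[]/eqP->; rewrite ltnS ?leq_maxl ?leq_maxr.
- exact: IH.
- by exists (maxn K1 K2) => z /orP[/H1|/H2] zK; rewrite leq_max zK ?orbT.
- by exists K => z /andP[_ /H].
Qed.

Lemma nth_blocks (I T : Type) (f : I -> nat -> T) (k : nat) (s0 : T) (i0 : I) (is_ : seq I) r c :
  r < size is_ -> c < k ->
  nth s0 (flatten [seq mkseq (f i) k | i <- is_]) (r * k + c) = f (nth i0 is_ r) c.
Proof.
elim: is_ r => // i is_ IH [|r] /=.
  by move=> _ ck; rewrite nth_cat size_mkseq mul0n add0n ck nth_mkseq.
move=> rs ck; rewrite nth_cat size_mkseq ifN; last by rewrite -leqNgt mulSn -addnA leq_addr.
by rewrite mulSn -addnA addKn IH.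
Qed.

Section EM.
Variables (C : gclass) (k : nat) (phi : formula) (p : nat -> ty).
Hypothesis gp : forall n, good C k phi n p.
Variables (I : eqType) (lt : rel I).
Hypothesis lin : strict_lin lt.

Notation EM := (emstr p lt).
Notation EU := (@emU p I lt).
Notation supp_in := (@supp_in p I lt).
Notation emS := (@emS p I lt).

Definition supps (F : seq EM) : seq I := flatten (map (fun t => tsupp (t : term I)) F).

Lemma suppsP (F : seq EM) (t : EM) : t \in F -> supp_in (supps F) t.
Proof.
by move=> tF i it; apply/flattenP; exists (tsupp (t : term I)) => //; apply: (map_f (fun t : EM => tsupp (t : term I))).
Qed.

Lemma suppsE (F : seq EM) (i : I) : i \in supps F -> exists t : EM, t \in F /\ i \in tsupp (t : term I).
Proof.
elim: F => //= t F IH; rewrite /supps /= mem_cat => /orP[it|/IH[u [uF iu]]].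
  by exists t; rewrite mem_head.
by exists u; rewrite inE uF orbT.
Qed.

Lemma realized (F : seq EM) : exists (S : str) (U : pred S) (M : model C k phi U) (h : EM -> S),
  (forall o (ts : seq EM), h (TApp o (ts : seq (term I)) : EM) = mf M o (map h ts)) /\
  forall F' : seq EM, {subset supps F' <= supps F} -> tabp h F'.
Proof.
have [S [U [M [z [Uz ipz rz]]]]] := realize gp lin (supps F).
exists S, U, M, (teval (mf M) z); split=> // F' sub x y xF yF.
apply: (realized_EQ rz) => i it; apply: sub; [exact: (suppsP xF) | exact: (suppsP yF)].
Qed.

Lemma EM_isC : isC C EM.
Proof.
move=> F; have [S [U [M [h [_ /(_ F)tF]]]]] := realized F.
have [G [CG [g tg]]] := m_isC M (map h F).
by exists G; split=> //; exists (g \o h); apply: tabp_comp => //; apply: tF.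
Qed.

Lemma supps_app (a : seq EM) o (i : I) : i \in tsupp (TApp o (a : seq (term I))) -> i \in supps a.
Proof. by []. Qed.

(** The elements outside [M] realise their diagram over those inside, so no certificate against it
    can exist and the witness terms realise it as well. Being built from terms over [J], they are
    over [J]. *)
Lemma EM_reflects (J : pred I) : reflects (fun t : EM => all J (tsupp (t : term I))).
Proof.
move=> W; pose MJ (t : EM) : bool := all J (tsupp (t : term I)); pose a := seq.filter MJ W; pose b := seq.filter (predC MJ) W.
pose l := a ++ b; pose d := tab l.
have [S [U [M [h [happ tlsub]]]]] := realized l.
have tl : tabp h l by apply: tlsub.
pose l' : seq EM := a ++ mkseq (fun j => TApp (OW d j) (a : seq (term I)) : EM) (size d.1 - size a).
have supa i : i \in supps a -> i \in supps l.
  by rewrite /l /supps map_cat flatten_cat mem_cat => ->.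
have subl' : {subset supps l' <= supps l}.
  move=> i /suppsE[t [tl' it]]; move: tl'.
  rewrite mem_cat => /orP[ta|/mapP[j _ et]]; apply: supa; first exact: (suppsP ta).
  by move: it; rewrite et; apply: supps_app.
have eq_d : tab l' = d.
  rewrite -(tab_map (tlsub _ subl')).
  have -> : map h l' = map h a ++ mkseq (fun j => mf M (OW d j) (map h a)) (size d.1 - size (map h a)).
    by rewrite map_cat size_map; congr (_ ++ _); rewrite /mkseq -map_comp; apply: eq_map => j /=.
  have [//|[q dd]] := m_ec M (map h a) d; exfalso; apply: dd.
  set W' := _ ++ mkseq _ _.
  have [G [CG [g tg]]] := m_isC M (W' ++ map h l).
  exists G; split=> //; exists g, (map g (map h b)); split.
    by apply: tabp_sub tg => x xW; rewrite mem_cat xW.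
  rewrite -map_cat -map_cat tab_map; first exact: (@tab_map EM S h l tl).
  by apply: tabp_sub tg => x xW; rewrite mem_cat xW orbT.
have Wl x : x \in W -> x \in l.
  by move=> xW; rewrite mem_cat !mem_filter xW !andbT /= orbN.
pose h' (x : EM) : EM := nth x l' (index x l).
have h'a x : x \in W -> MJ x -> h' x = x.
  move=> xW Mx; have xa : x \in a by rewrite mem_filter Mx.
  by rewrite /h' /l index_cat xa /l' nth_cat index_mem xa nth_index.
exists h'; split; last split=> //.
  by apply: tabp_sub (tab_copy (fun x => x) (esym eq_d)).
move=> x xW; have es : size l' = size l by rewrite -!size_tab eq_d.
have : h' x \in l' by apply: mem_nth; rewrite es index_mem Wl.
rewrite mem_cat => /orP[|/mapP[j _ ->]]; first by rewrite mem_filter => /andP[].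
apply/allP => i /supps_app /suppsE[t [ta it]].
by move: ta; rewrite mem_filter => /andP[/allP/(_ i it)].
Qed.

(** The witness terms for the diagram of [F] over the prescribed values would form a copy, so the
    certificate terms must work. A forbidden copy over an image of these terms would embed into a
    graph of [C] and contradict deadness. *)
Lemma EM_exclosed : exclosed EM.
Proof.
move=> F X al nocopy.
pose fX := seq.filter X F; pose fY := seq.filter (predC X) F; pose l := fX ++ fY.
pose d := tab l; pose a := map al fX.
have [S [U [M [h [happ tsub]]]]] := realized a.
have supl o n : {subset supps (a ++ mkseq (fun j => TApp (o j) (a : seq (term I)) : EM) n) <= supps a}.
  move=> i /suppsE[t [tl' it]]; move: tl'.
  rewrite mem_cat => /orP[ta'|/mapP[j _ et]]; first exact: (suppsP ta').
  by move: it; rewrite et; apply: supps_app.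
have mapl o n : map h (a ++ mkseq (fun j => TApp (o j) (a : seq (term I)) : EM) n) =
    map h a ++ mkseq (fun j => mf M (o j) (map h a)) n.
  by rewrite map_cat; congr (_ ++ _); rewrite /mkseq -map_comp; apply: eq_map => j /=.
have Fl x : x \in F -> x \in l.
  by move=> xF; rewrite mem_cat !mem_filter xF !andbT /= orbN.
have [tw|[q dd]] := m_ec M (map h a) d.
  exfalso; move: tw; rewrite -mapl (@tab_map EM S h _ (tsub _ (supl (OW d) _))) => tw.
  set l' := (X in tab X) in tw.
  apply: (nocopy (fun x => nth x l' (index x l))).
    by apply: tabp_sub (tab_copy (fun x => x) (esym tw)).
  move=> x xF Xx; have xa : x \in fX by rewrite mem_filter Xx.
  have ei : index x l = index x fX by rewrite /l index_cat xa.
  have si : index x fX < size fX by rewrite index_mem.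
  by rewrite ei /l' nth_cat {1}/a size_map si (nth_map x) // nth_index.
pose W : seq EM := a ++ mkseq (fun j => TApp (OC d j) (a : seq (term I)) : EM) q.
exists W => h2 t2 g tg ag; apply: dd; rewrite -mapl -/W.
have [G [CG [e te]]] := EM_isC (map h2 W ++ map g F).
exists G; split=> //.
have teW : tabp e (map h2 W) by apply: tabp_sub te => x xW; rewrite mem_cat xW.
have teF : tabp e (map g F) by apply: tabp_sub te => x xW; rewrite mem_cat xW orbT.
have thW : tabp h W by apply: tsub; apply: supl.
have [th [tth hth]] := tabp_factor (e (TApp OD [::] : EM)) (m_isC M) thW (tabp_comp t2 teW).
exists th, (map e (map g fY)); split=> //.
have -> : map th (map h a) = map e (map g fX).
  rewrite -!map_comp; apply/eq_in_map => x xa.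
  rewrite [LHS]hth; last by rewrite mem_cat map_f.
  by move: xa; rewrite mem_filter => /andP[Xx xF]; rewrite /= ag.
rewrite -!map_cat tab_map.
  rewrite tab_map //.
  by apply: tabp_sub tg => x; rewrite mem_cat !mem_filter => /orP[]/andP[].
apply: tabp_sub teF => _ /mapP[x xl ->]; apply: map_f.
by move: xl; rewrite mem_cat !mem_filter => /orP[]/andP[].
Qed.

Lemma EM_ren (r : I -> I) (F : seq EM) :
  (forall i j, i \in supps F -> j \in supps F -> lt i j -> lt (r i) (r j)) ->
  tabp (tren r : EM -> EM) F.
Proof.
have [ir tr to] := lin.
move=> mono t t' tF t'F.
set L := tsupp (t : term I) ++ tsupp (t' : term I).
have LF i : i \in L -> i \in supps F by rewrite mem_cat => /orP[/(suppsP tF)|/(suppsP t'F)].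
have esL : sL lt (map r L) = map r (sL lt L).
  apply: (irr_sorted_eq tr ir); first exact: sL_sorted.
    have : {subset sL lt L <= L} by move=> i; rewrite mem_sL.
    have := sL_sorted lin L; elim: (sL lt L) => // a [|b s] // IH /= /andP[ab so] sub.
    rewrite mono ?LF //= ?sub ?inE ?eqxx ?orbT //; apply: IH => // i iL.
    by apply: sub; rewrite inE iL orbT.
  move=> i; rewrite mem_sL; apply/mapP/mapP => -[j jL ->]; exists j => //.
    by rewrite mem_sL.
  by rewrite mem_sL in jL.
have erk i : i \in L -> rk lt (map r L) (r i) = rk lt L i.
  move=> iL; rewrite /rk esL.
  have iS : index i (sL lt L) < size (map r (sL lt L)) by rewrite size_map index_mem mem_sL.
  rewrite -[in LHS](nth_index i (s := sL lt L) (x := i)) ?mem_sL // -(nth_map _ (r i)) ?index_mem ?mem_sL //.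
  by rewrite index_uniq // -esL sL_uniq.
have estd (u : EM) : {subset tsupp (u : term I) <= L} -> std lt (map r L) (tren r u) = std lt L u.
  by move=> uL; rewrite /std tren_comp; apply: tren_ext => i iu /=; apply: erk; apply: uL.
have ep : pT p lt (map r L) = pT p lt L by rewrite /pT esL size_map.
rewrite /= !tsupp_ren -map_cat -/L ep !estd //.
  by move=> i it; rewrite mem_cat it orbT.
by move=> i it; rewrite mem_cat it.
Qed.

(** For a quantifier, a witness using further indices is absorbed by enlarging [L]; conversely a
    formula true at [L] is witnessed by a Skolem term over [L]. *)
Lemma EM_sat psi (L : seq I) (rho : nat -> EM) :
  (forall i, supp_in L (rho i)) -> (forall i, EU (rho i)) ->
  ssat EU rho psi <-> emS L psi rho.
Proof.
elim: psi L rho => [x y|x y|f IH|f IHf g IHg|x f IH] L rho rL rU;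
  have [S [U [M [z [Uz ipz rz]]]]] := realize gp lin L;
  rewrite -(realized_S rz) //=.
- by have [-> _] := realized_EQ rz (rL x) (rL y).
- by have [_ ->] := realized_EQ rz (rL x) (rL y).
- by rewrite (IH L) // -(realized_S rz).
- by rewrite (IHf L) // (IHg L) // -!(realized_S rz).
have updL L' a : (forall i, supp_in L' (rho i)) -> supp_in L' a -> forall i, supp_in L' (upd rho x a i).
  by move=> r' a' i; rewrite /upd; case: ifP.
have updU a : EU a -> forall i, EU (upd rho x a i).
  by move=> Ua i; rewrite /upd; case: ifP.
have updh T' (h : EM -> T') a : (fun i => h (upd rho x a i)) = upd (fun i => h (rho i)) x (h a).
  by apply: funext => i; rewrite /upd; case: ifP.
split=> [[a [Ua fa]]|[a [Ua fa]]].
  pose L' := L ++ tsupp (a : term I).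
  have LL' : {subset L <= L'} by move=> i iL; rewrite mem_cat iL.
  have rL' i : supp_in L' (rho i) by move=> j /rL; apply: LL'.
  have aL' : supp_in L' a by move=> j ja; rewrite /L' mem_cat ja orbT.
  have {}fa : emS L' f (upd rho x a) by apply/IH => //; [exact: updL | exact: updU].
  have [S' [U' [M' [z' [Uz' ipz' rz']]]]] := realize gp lin L'.
  have ex' : ssat U' (fun i => teval (mf M') z' (rho i : term I)) (FEx x f).
    exists (teval (mf M') z' (a : term I)); split; first by rewrite (realized_U rz').
    rewrite -(updh _ (fun t : EM => teval (mf M') z' (t : term I))).
    by apply/(realized_S rz' (L := L')) => //; apply: updL.
  have : emS L (FEx x f) rho by apply/(realized_S rz' (L := L)).
  move=> h1; have LL : {subset L <= L} by [].
  exact: (realized_S rz (FEx x f) LL rL).2 h1.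
have [K HK] := free_bound f.
pose w : EM := TApp (OF x f) (mkseq rho K : seq (term I)).
set h := fun t : EM => teval (mf M) z (t : term I).
have hw : h w = mf M (OF x f) (mkseq (fun i => h (rho i)) K).
  by rewrite /h /w /= /mkseq -map_comp.
have wL : supp_in L w.
  by move=> i /supps_app /suppsE[t [/mapP[j _ ->]]]; apply: rL.
have Uw : EU w by rewrite -(realized_U rz) // -/(h w) hw; apply: m_UF.
exists w; split=> //; apply/(IH L); [exact: updL | exact: updU |].
apply/(realized_S rz) => //; first exact: updL.
rewrite (updh _ h) hw.
have fr (b : S) y : free_in y f -> upd (fun i => h (rho i)) x b y =
    upd (nth (mf M OD [::]) (mkseq (fun i => h (rho i)) K)) x b y.
  by move=> /HK yK; rewrite /upd; case: ifP => // _; rewrite nth_mkseq.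
apply: (ssat_free U (fr _)).2; apply: m_fo; exists a; split=> //.
exact: (ssat_free U (fr _)).1.
Qed.

Lemma EM_var (i : I) c : EU (TVar i c : EM).
Proof.
have [S [U [M [z [Uz ipz rz]]]]] := realize gp lin [:: i].
by rewrite -(realized_U rz) //= Uz.
Qed.

Lemma EM_ip (L : seq I) (b : I -> bool) : uniq L -> exists v : nat -> EM, (forall j, EU (v j)) /\
  forall i, i \in L -> (ssat EU (asg k (fun c => TVar i c : EM) v) phi <-> b i).
Proof.
move=> uL; have [S [U [M [z [Uz ipz rz]]]]] := realize gp lin L.
pose ts : seq (term I) := flatten [seq mkseq (fun c => TVar i c) k | i <- L].
pose v j : EM := TApp (OV j (map b L)) ts.
have vL j : supp_in L (v j).
  move=> i /supps_app; rewrite /ts; elim: (L) => //= a L' IH.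
  rewrite /supps map_cat flatten_cat mem_cat inE => /orP[|/IH->]; last by rewrite orbT.
  rewrite /mkseq -map_comp => /flattenP[s /mapP[c _ ->]] /=.
  by rewrite inE => ->.
set h := fun t : EM => teval (mf M) z (t : term I).
have hts : map h ts = flatten [seq mkseq (z i) k | i <- L].
  rewrite map_flatten; congr flatten; rewrite -map_comp; apply: eq_map => i /=.
  by rewrite /mkseq -map_comp.
have hv j : h (v j) = mf M (OV j (map b L)) (map h ts) by [].
have vU j : EU (v j) by rewrite -(realized_U rz) // -/(h _) hv; apply: m_UV.
exists v; split=> // i iL.
have rL j : supp_in L (asg k (fun c => TVar i c : EM) v j).
  by rewrite /asg; case: ifP => // _ i'; rewrite inE => /eqP->.
rewrite (EM_sat phi rL); last by move=> j; rewrite /asg; case: ifP => // _; apply: EM_var.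
rewrite -(realized_S rz) //.
have [v0 [Uv0 Hv0]] := ipz b.
have blk w r : r < size L -> asg k (blockv k (mf M OD [::]) (map h ts) r) w = asg k (z (nth i L r)) w.
  move=> rs; apply: funext => c; rewrite /asg; case: ltnP => // ck.
  by rewrite /blockv hts (nth_blocks z (mf M OD [::]) i).
have -> : (fun j => h (asg k (fun c => TVar i c : EM) v j)) =
    asg k (z i) (fun j => mf M (OV j (map b L)) (map h ts)).
  by apply: funext => j; rewrite /asg; case: ifP.
have iS : index i L < size L by rewrite index_mem.
have := @m_ip _ _ _ _ _ M (map h ts) (map b L) _ (index i L).
rewrite size_map blk // (nth_map i) // nth_index //; apply=> //.
exists v0; split=> // r rs; rewrite blk // (nth_map i) //.
by apply: Hv0; apply: mem_nth.
Qed.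

End EM.

(** * Coding in a structure *)

Section BlockOrder.
Variables (m : nat) (lam : Type).
Definition blockI : eqType := {classic (nat + 'I_m * lam)%type}.

(* The naturals index the model [M]; they are followed by the blocks, in
   decreasing order, so that a block can be moved into [M] over the blocks of
   smaller index. *)
Definition block_lt (ltl : rel {classic lam}) : rel blockI := fun a b =>
  match (a : (nat + 'I_m * lam)%type), (b : (nat + 'I_m * lam)%type) with
  | inl x, inl y => x < y
  | inl _, inr _ => true
  | inr _, inl _ => false
  | inr (s, i), inr (s', i') => (s' < s) || ((s == s') && ltl i i')
  end.

Lemma block_lin ltl : strict_lin ltl -> strict_lin (block_lt ltl).
Proof.
move=> [ir tr to]; split.
- by move=> [x|[s i]] /=; rewrite /block_lt ?ltnn // eqxx ir.
- move=> [y|[s i]] [x|[s' i']] [z|[s'' i'']] //=; rewrite /block_lt; first exact: ltn_trans.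
  move=> /orP[h1|/andP[/eqP-> h1]] /orP[h2|/andP[/eqP<- h2]].
  + by rewrite (ltn_trans h2 h1).
  + by rewrite h1.
  + by rewrite h2.
  + by rewrite eqxx (tr _ _ _ h1 h2) orbT.
- move=> [x|[s i]] [y|[s' i']] //=; rewrite /block_lt.
    by move=> xy; rewrite -neq_ltn; apply/eqP => e; case/eqP: xy; rewrite e.
  move=> ne; case: (eqVneq s s') ne => [<-|nss] ne.
    by rewrite ltnn /=; apply: to; apply/eqP => e; case/eqP: ne; rewrite e.
  rewrite /= !orbF orbC -neq_ltn; apply: contra nss => /eqP e.
  by apply/eqP; apply: val_inj.
Qed.
End BlockOrder.

(* Without coding, the dichotomy spreads the Ehrenfeucht-Mostowski structure over
   more blocks than the parameters of [phi] can meet, and in a block that they miss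
   two tuples with the same code cannot be separated. *)
Theorem coding_structure (C : gclass) : independent C ->
  exists N : str, isC C N /\ exists (F : seq N) (X Y : pred N) (c : N),
    [/\ c \in F, ~~ X c, ~~ Y c & forall n, precode F X Y c n].
Proof.
move=> [k [l [phi [fr ind]]]].
have [p gp] := good_limit (good_base _ fr ind).
apply: contrapT => nocoding.
(* There will be [l + 2] blocks, against at most [l + 1] distinct entries in the parameter tuple
   [v']. *)
pose m := l.+1; pose q := qrank phi; pose Mi := term nat.
pose H := codeT Mi q; pose lam := H -> Prop.
have [ltl wol] := strict_wo_exists {classic lam}.
pose I : eqType := blockI m.+1 lam; pose lt : rel I := block_lt ltl.
have lin : strict_lin lt by apply: block_lin; apply: strict_wo_lin.
pose N := emstr p lt.
have CN : isC C N := EM_isC gp lin.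
have noc (F : seq N) (X Y : pred N) c : c \in F -> ~~ X c -> ~~ Y c -> ~ forall n, precode F X Y c n.
  by move=> cF nX nY h; apply: nocoding; exists N; split=> //; exists F, X, Y, c.
pose inj (x : nat) : I := inl x.
pose ixx (s : 'I_m.+1) (i : lam) : I := inr (s, i).
pose J : pred I := fun a => if (a : (nat + 'I_m.+1 * lam)%type) is inl _ then true else false.
pose M : pred N := fun t : N => all J (tsupp (t : term I)).
have ReM : reflects M := EM_reflects gp lin J.
have EC : exclosed N := EM_exclosed gp lin.
pose emb (t : Mi) : N := tren inj t.
pose back (a : I) : nat := if (a : (nat + 'I_m.+1 * lam)%type) is inl x then x else 0.
have embP (x : N) : M x -> exists i, emb i = x.
  move=> Mx; exists (tren back (x : term I)); rewrite /emb tren_comp.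
  rewrite -[RHS](tren_id (x : term I)); apply: tren_ext => a /(allP Mx).
  by case: a.
pose g0 (t : N) : option nat :=
  if (t : term I) is TVar a _ then
    (if (a : (nat + 'I_m.+1 * lam)%type) is inr (s, _) then Some (val s) else None) else None.
have good0 : goodp M m g0.
  split.
    by move=> [[a|[s i]] c|o ts] t //= [<-]; rewrite -ltnS.
  move=> s sm F.
  (* The indices of the upper blocks are moved, in their order, beyond all naturals in use. Upper
     blocks come directly after the naturals, so the order is preserved. *)
  pose B := (\max_(a <- supps F) back a).+1.
  pose r (a : I) : I := if (a : (nat + 'I_m.+1 * lam)%type) is inr (s', _) then
     (if s < s' then inj (B + rk lt (supps F) a) else a) else a.
  have rm i j : i \in supps F -> j \in supps F -> lt i j -> lt (r i) (r j).
    move=> iF jF ij; have rij := rk_mono lin iF jF ij.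
    have bB (a : I) : a \in supps F -> back a < B by move=> aF; rewrite ltnS; apply: leq_bigmax_seq.
    move: ij rij (bB i iF); rewrite /r /lt /block_lt /inj.
    case: i iF => [x|[s1 i1]] iF; case: j jF => [y|[s2 i2]] jF //=.
    - by move=> _ _ xB; case: ifP => // _; rewrite ltn_addr.
    - case: ifP => h1; case: ifP => h2 ij rij _ //; first by rewrite ltn_add2l.
      case/orP: ij => [s21|/andP[/eqP e _]].
        by rewrite (ltn_trans h2 s21) in h1.
      by rewrite e h2 in h1.
  exists (tren r : N -> N); split; first exact: EM_ren.
    move=> x xF /orP[Mx|lx].
      rewrite -[RHS](tren_id (x : term I)); apply: tren_ext => a /(allP Mx).
      by case: a.
    move: lx; rewrite /lowp /g0; case: (x : term I) => [[a|[s' i]] c|o ts] //= s's.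
    by rewrite /r ltnNge s's.
  move=> x xF; rewrite /highp /g0; case: (x : term I) => [[a|[s' i]] c|o ts] //= ss'.
  by rewrite /M /= /r ss' /J.
have [P [Pm Pg Pfs]] := fsat_partition EC ReM noc good0.
pose U := @emU p I lt.
have PV s i c : P (TVar (ixx s i) c : N) = s by apply: Pg.
have UV (i : I) c : U (TVar i c : N) by exact: (EM_var gp lin i c).
pose d0 : lam := fun _ => True.
pose other (s : 'I_m.+1) : 'I_m.+1 := if s == ord0 then inord 1 else ord0.
have otherP s : other s != s.
  rewrite /other; case: (s =P ord0) => [->|/eqP]; last by rewrite eq_sym.
  by apply/eqP => /(congr1 val); rewrite /= inordK.
(* Collisions have to be found before the parameters, which depend on them. A dummy element of
   another block holds the place of the parameters; the code of block [s] does not see it. *)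
pose rho s (i : lam) : nat -> N := fun x => if x < k then (TVar (ixx s i) x : N) else (TVar (ixx (other s) d0) 0 : N).
have /choice[ij Hij] : forall s : 'I_m.+1, exists ij : lam * lam, ij.1 <> ij.2 /\
    code U emb P s q (rho s ij.1) = code U emb P s q (rho s ij.2).
  move=> s; have [i [j [ne e]]] := cantor_collision (fun i : lam => code U emb P s q (rho s i)).
  by exists (i, j).
pose is_ s : I := ixx s (ij s).1; pose js s : I := ixx s (ij s).2.
pose L : seq I := undup ([seq is_ s | s <- enum 'I_m.+1] ++ [seq js s | s <- enum 'I_m.+1]).
pose b (a : I) : bool := if (a : (nat + 'I_m.+1 * lam)%type) is inr (s, i) then `[< i = (ij s).1 >] else false.
have [v [vU Hv]] := EM_ip gp lin b (undup_uniq ([seq is_ s | s <- enum 'I_m.+1] ++ [seq js s | s <- enum 'I_m.+1])).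
(* Only the first [l] entries of [v] matter to [phi]; making the others equal leaves finitely many
   blocks to avoid. *)
pose v' (j : nat) : N := if j < l then v j else v l.
have v'U j : U (v' j) by rewrite /v'; case: ifP => _; apply: vU.
have ssv (u : nat -> N) : ssat U (asg k u v') phi <-> ssat U (asg k u v) phi.
  apply: ssat_free => x /fr xkl; rewrite /asg; case: ltnP => // kx.
  by rewrite /v' ltn_subLR ?xkl.
have [s sfree] : exists s : 'I_m.+1, forall j, P (v' j) <> s.
  apply: contrapT => no.
  have sub : {subset iota 0 m.+1 <= [seq P (v' j) | j <- iota 0 l.+1]}.
    move=> x; rewrite mem_iota add0n => /andP[_ xm]; apply: contrapT => nx; apply: no.
    exists (Ordinal xm) => j e; apply: nx; rewrite -[x]/(nat_of_ord (Ordinal xm)) -e.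
    case: (ltnP j l.+1) => jl; first by apply/mapP; exists j => //; rewrite mem_iota.
    have -> : v' j = v' l by rewrite /v' ltnn ltnNge (ltnW jl).
    by apply/mapP; exists l => //; rewrite mem_iota /= add0n.
  have := uniq_leq_size (iota_uniq 0 m.+1) sub.
  by rewrite size_map !size_iota ltnn.
have [ne ecode] := Hij s.
pose rh (i : lam) : nat -> N := asg k (fun c => TVar (ixx s i) c : N) v'.
have inA_lt i x : x < k -> inA U P s (rh i x).
  by move=> xk; rewrite /inA /rh /asg xk UV PV eqxx.
have inA_ge i x : k <= x -> ~~ inA U P s (rh i x).
  move=> kx; rewrite /inA /rh /asg ltnNge kx /= negb_and; apply/orP; right.
  by apply/eqP; apply: sfree.
have code_rh i : code U emb P s q (rh i) = code U emb P s q (rho s i).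
  apply: code_ext => x; case: (ltnP x k) => xk.
  - by rewrite inA_lt // /inA /rho xk UV PV eqxx.
  - rewrite (negbTE (inA_ge i x xk)) /inA /rho ltnNge xk /= UV PV /=.
    by apply/esym/negbTE; apply: otherP.
  - by rewrite /rh /rho /asg xk.
  - by rewrite (negbTE (inA_ge i x xk)).
have rhU i x : U (rh i x) by rewrite /rh /asg; case: ifP.
have [sE_sym sQ_sym] := isC_sym CN.
have key : ssat U (rh (ij s).1) phi <-> ssat U (rh (ij s).2) phi.
  apply: (code_ssat (q := q) sE_sym sQ_sym embP Pm Pfs (s := s)) => //.
    by rewrite !code_rh.
  move=> x; case: (ltnP x k) => xk; first by rewrite inA_lt.
  by rewrite /rh /asg ltnNge xk.
have sin : s \in enum 'I_m.+1 by rewrite mem_enum.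
have h1 : ssat U (rh (ij s).1) phi.
  apply/ssv; apply/(Hv (is_ s)); last exact/asboolP.
  by rewrite mem_undup mem_cat map_f.
have /key/ssv/(Hv (js s)) := h1.
rewrite mem_undup mem_cat (map_f js) // orbT => /(_ isT) /asboolP e.
by apply: ne.
Qed.

(** * Configurations in graphs *)

(** The finite data of a coded grid detached from the structure: positions number the elements of
    the diagram. *)
Record template := Template {
  pos : nat;
  dE : rel 'I_pos;
  dQ : rel 'I_pos;
  pX : pred 'I_pos;
  pY : pred 'I_pos;
  pc : 'I_pos }.

Section Config.
Variable sh : template.
Notation P := (pos sh).

Definition copy (G : graph) (w : 'I_P -> vtx G) : Prop :=
  forall i j, adj (w i) (w j) = dE i j /\ (w i == w j) = dQ i j.

(** Rows are numbered backwards with respect to [precode]: values now avoid earlier rows as well as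
    earlier columns, and both directions can be treated alike. *)
Definition config (G : graph) (n : nat) (g : 'I_n -> 'I_n -> 'I_P -> vtx G) : Prop :=
  [/\ forall s t, copy (g s t),
      forall s t t' i, pX i -> g s t i = g s t' i,
      forall s s' t i, pY i -> g s t i = g s' t i,
      forall (s t v : 'I_n) w, v < t -> copy w -> (forall i, pX i -> w i = g s t i) ->
        (forall i, pY i -> w i = g s v i) -> w (pc sh) <> g s t (pc sh)
    & forall (s t u : 'I_n) w, u < s -> copy w -> (forall i, pX i -> w i = g u t i) ->
        (forall i, pY i -> w i = g s t i) -> w (pc sh) <> g s t (pc sh)].

Definition cmp (a b : nat) : bool * bool := (a < b, b < a).

Definition info (G : graph) (g1 g2 : 'I_P -> vtx G) : {ffun 'I_P * 'I_P -> bool * bool} :=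
  [ffun ij => (adj (g1 ij.1) (g2 ij.2), g1 ij.1 == g2 ij.2)].

Definition order_canonical (G : graph) (n : nat) (g : 'I_n -> 'I_n -> 'I_P -> vtx G) : Prop :=
  forall s t s' t' s1 t1 s1' t1' : 'I_n, cmp s s' = cmp s1 s1' -> cmp t t' = cmp t1 t1' ->
    info (g s t) (g s' t') = info (g s1 t1) (g s1' t1').

Lemma config_sub G n (g : 'I_n -> 'I_n -> 'I_P -> vtx G) m (a b : 'I_m -> 'I_n) :
  {homo a : i j / i < j} -> {homo b : i j / i < j} ->
  config g -> config (fun s t => g (a s) (b t)).
Proof.
move=> ha hb [c1 c2 c3 c4 c5]; split.
- by move=> s t; apply: c1.
- by move=> s t t' i; apply: c2.
- by move=> s s' t i; apply: c3.
- by move=> s t v w vt; apply: c4; apply: hb.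
- by move=> s t u w us; apply: c5; apply: ha.
Qed.

Lemma order_canonical_sub G n (g : 'I_n -> 'I_n -> 'I_P -> vtx G) m (a b : 'I_m -> 'I_n) :
  {homo a : i j / i < j} -> {homo b : i j / i < j} ->
  order_canonical g -> order_canonical (fun s t => g (a s) (b t)).
Proof.
have hcmp (f : 'I_m -> 'I_n) i j : {homo f : i j / i < j} -> cmp (f i) (f j) = cmp i j.
  move=> hf; rewrite /cmp; case: (ltngtP i j) => ij.
  - by have := hf _ _ ij; case: ltngtP.
  - by have := hf _ _ ij; case: ltngtP.
  - by rewrite (val_inj ij) ltnn.
by move=> ha hb cg s t s' t' s1 t1 s1' t1' es et; apply: cg; rewrite !hcmp.
Qed.

(** A copy in an induced subgraph is a copy in the graph, so the clauses forbidding copies pass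
    down. *)
Lemma config_induced G n (g : 'I_n -> 'I_n -> 'I_P -> vtx G) (S : {set vtx G}) :
  (forall s t i, g s t i \in S) -> config g -> order_canonical g ->
  exists g' : 'I_n -> 'I_n -> 'I_P -> vtx (induced S), config g' /\ order_canonical g'.
Proof.
move=> gS cg kg.
exists (fun s t i => exist _ (g s t i) (gS s t i) : vtx (induced S)); split; last first.
  move=> s t s' t' s1 t1 s1' t1' es et; rewrite -(ffunP) => ij.
  by have /ffunP/(_ ij) := kg _ _ _ _ _ _ _ _ es et; rewrite !ffunE.
have [c1 c2 c3 c4 c5] := cg.
have cval (w : 'I_P -> vtx (induced S)) : copy w -> copy (fun i => val (w i)).
  by move=> cw i j; have := cw i j.
split.
- by move=> s t i j; have := c1 s t i j.
- by move=> s t t' i Xi; apply: val_inj; apply: c2.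
- by move=> s s' t i Yi; apply: val_inj; apply: c3.
- move=> s t v w vt cw wX wY /(congr1 val) /=; apply: (c4 s t v _ vt (cval _ cw)).
  + by move=> i Xi; rewrite wX.
  + by move=> i Yi; rewrite wY.
- move=> s t u w us cw wX wY /(congr1 val) /=; apply: (c5 s t u _ us (cval _ cw)).
  + by move=> i Xi; rewrite wX.
  + by move=> i Yi; rewrite wY.
Qed.

Definition spanned G n (g : 'I_n -> 'I_n -> 'I_P -> vtx G) : {set vtx G} :=
  [set x | [exists s, [exists t, [exists i, x == g s t i]]]]%SET.

Lemma spannedP G n (g : 'I_n -> 'I_n -> 'I_P -> vtx G) s t i : g s t i \in spanned g.
Proof.
by rewrite inE; apply/existsP; exists s; apply/existsP; exists t; apply/existsP; exists i.
Qed.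

Lemma card_spanned G n (g : 'I_n -> 'I_n -> 'I_P -> vtx G) : gsize (induced (spanned g)) <= P * n ^ 2.
Proof.
rewrite /gsize /= card_sig.
have sub : spanned g \subset [set g st.1.1 st.1.2 st.2 | st in [set: ('I_n * 'I_n) * 'I_P]]%SET.
  apply/fintype.subsetP => x; rewrite inE => /existsP[s /existsP[t /existsP[i /eqP->]]].
  by apply/imsetP; exists (s, t, i).
rewrite (eq_card (B := spanned g)) //.
apply: leq_trans (subset_leq_card sub) _.
apply: leq_trans (leq_imset_card _ _) _.
by rewrite cardsT !card_prod !card_ord mulnC mulnn.
Qed.

End Config.

(** The graph is cut down to the images of the cells, so that every copy in it lifts to [N] and the
    forbidding clauses transfer. *)
Lemma config_of_precode (C : gclass) (N : str) (F : seq N) (X Y : pred N) (c : N) :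
  hereditary C -> isC C N -> c \in F -> ~~ X c -> ~~ Y c -> (forall n, precode F X Y c n) ->
  exists sh : template, forall n, exists G, C G /\ exists g : 'I_n -> 'I_n -> 'I_(pos sh) -> vtx G, config g.
Proof.
move=> [isoC hC] CN cF nX nY pre.
pose f (i : 'I_(size F)) : N := tnth (in_tuple F) i.
have fF i : f i \in F by apply: mem_tnth.
have cs : index c F < size F by rewrite index_mem.
pose sh := @Template (size F) (fun i j => sE (f i) (f j)) (fun i j => sQ (f i) (f j))
  (fun i => X (f i)) (fun i => Y (f i)) (Ordinal cs).
have fc : f (Ordinal cs) = c by rewrite /f (tnth_nth c) nth_index.
exists sh => n; have [al [be [g [H1 H2 H3]]]] := pre n.
pose Z := flatten [seq flatten [seq map (g s t) F | t <- iota 0 n] | s <- iota 0 n].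
have gZ s t x : s < n -> t < n -> x \in F -> g s t x \in Z.
  move=> sn tn xF; apply/flattenP; exists (flatten [seq map (g s t) F | t <- iota 0 n]).
    by apply/mapP; exists s; rewrite ?mem_iota.
  by apply/flattenP; exists (map (g s t) F); [apply/mapP; exists t; rewrite ?mem_iota | exact: map_f].
have [G0 [CG0 [h th]]] := CN Z.
pose S : {set vtx G0} := [set x | x \in map h Z]%SET.
exists (induced S); split; first exact: hC.
have rev_lt (s : 'I_n) : n - s.+1 < n by rewrite ltn_subrL /= (leq_trans _ (ltn_ord s)).
have gS (s t : 'I_n) (i : 'I_(size F)) : (h (g (n - s.+1) t (f i)) : vtx G0) \in S.
  by rewrite inE map_f // gZ.
exists (fun (s t : 'I_n) (i : 'I_(size F)) => exist (fun x : vtx G0 => x \in S) (h (g (n - s.+1) t (f i))) (gS s t i) : vtx (induced S)).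
have lift (w : 'I_(size F) -> vtx (induced S)) (s t : nat) (e : N) : @copy sh (induced S) w ->
    s < n -> t < n -> 
    (forall i, X (f i) -> val (w i) = h (g s t (f i))) ->
    (forall i, Y (f i) -> val (w i) = h (g s t (f i))) ->
    e \in Z -> val (w (Ordinal cs)) = h e ->
    exists wN : N -> N, [/\ tabp wN F, agree_on F X wN (al s), agree_on F Y wN (be t) & wN c = e].
  move=> cw sn tn wX wY eZ we.
  have [g1 g2 g3] := H1 s t sn tn.
  have /choice[z Hz] : forall i, exists z : N, z \in Z /\ val (w i) = h z.
    by move=> i; have := valP (w i); rewrite inE => /mapP[z zZ ez]; exists z.
  (* The map [h] may identify elements, so the lifts on the row part, on the column part and at [c]
     are prescribed; elsewhere any preimage will do. *)
  pose wN (x : N) : N := if x == c then e else if X x || Y x then g s t x else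
     (if insub (index x F) is Some i then z i else x).
  have wNP x (xs : index x F < size F) : x \in F -> wN x \in Z /\ h (wN x) = val (w (Ordinal xs)).
    move=> xF; have fx : f (Ordinal xs) = x by rewrite /f (tnth_nth x) nth_index.
    rewrite /wN; case: eqP => [xc|_].
      split=> //; rewrite -we; congr (val (w _)); apply: val_inj => /=; by rewrite xc.
    case: ifP => [|_]; last by rewrite insubT; have [? ?] := Hz (Ordinal xs).
    have := wX (Ordinal xs); have := wY (Ordinal xs); rewrite fx => eY eX.
    by move=> /orP[Xx|Yx]; (split; first exact: gZ); [rewrite eX | rewrite eY].
  exists wN; split.
  - move=> x y xF yF; have xs : index x F < size F by rewrite index_mem.
    have ys : index y F < size F by rewrite index_mem.
    have [xZ ex] := wNP x xs xF; have [yZ ey] := wNP y ys yF.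
    have [<- <-] := th _ _ xZ yZ; rewrite ex ey.
    have := cw (Ordinal xs) (Ordinal ys).
    have -> : dE (t := sh) (Ordinal xs) (Ordinal ys) = sE x y.
      by rewrite /= /f !(tnth_nth x) !nth_index.
    have -> : dQ (t := sh) (Ordinal xs) (Ordinal ys) = sQ x y.
      by rewrite /= /f !(tnth_nth x) !nth_index.
    by [].
  - move=> x xF Xx; rewrite /wN; case: eqP => [xc|_]; first by rewrite -xc Xx in nX.
    by rewrite Xx /= g2.
  - move=> x xF Yx; rewrite /wN; case: eqP => [xc|_]; first by rewrite -xc Yx in nY.
    by rewrite Yx orbT g3.
  - by rewrite /wN eqxx.
split.
- move=> s t i j; have [g1 g2 g3] := H1 (n - s.+1) t (rev_lt s) (ltn_ord t).
  have [e1 e2] := th _ _ (gZ _ _ _ (rev_lt s) (ltn_ord t) (fF i)) (gZ _ _ _ (rev_lt s) (ltn_ord t) (fF j)).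
  have [e3 e4] := g1 _ _ (fF i) (fF j).
  by split; rewrite /= -?e3 -?e4 -?e1 -?e2.
- move=> s t t' i Xi; apply: val_inj => /=.
  have [_ g2 _] := H1 (n - s.+1) t (rev_lt s) (ltn_ord t).
  have [_ g2' _] := H1 (n - s.+1) t' (rev_lt s) (ltn_ord t').
  by rewrite g2 // g2'.
- move=> s s' t i Yi; apply: val_inj => /=.
  have [_ _ g3] := H1 (n - s.+1) t (rev_lt s) (ltn_ord t).
  have [_ _ g3'] := H1 (n - s'.+1) t (rev_lt s') (ltn_ord t).
  by rewrite g3 // g3'.
- move=> s t v w vt cw wX wY wc.
  have [_ gst _] := H1 (n - s.+1) t (rev_lt s) (ltn_ord t).
  have [_ gsv _] := H1 (n - s.+1) v (rev_lt s) (ltn_ord v).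
  have [||||wN [w1 w2 w3 w4]] := lift w (n - s.+1) v (g (n - s.+1) t c) cw (rev_lt s) (ltn_ord v).
  + by move=> i Xi; rewrite wX //= gst // gsv.
  + by move=> i Yi; rewrite wY.
  + exact: gZ.
  + by rewrite wc /= fc.
  exact: (H2 (n - s.+1) t v wN (rev_lt s) (ltn_ord t) vt w1 w2 w3 w4).
- move=> s t u w us cw wX wY wc.
  have [_ _ gst] := H1 (n - s.+1) t (rev_lt s) (ltn_ord t).
  have [_ _ gut] := H1 (n - u.+1) t (rev_lt u) (ltn_ord t).
  have [||||wN [w1 w2 w3 w4]] := lift w (n - u.+1) t (g (n - s.+1) t c) cw (rev_lt u) (ltn_ord t).
  + by move=> i Xi; rewrite wX.
  + by move=> i Yi; rewrite wY //= gst // gut.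
  + exact: gZ.
  + by rewrite wc /= fc.
  apply: (H3 (n - s.+1) t (n - u.+1) wN _ (ltn_ord t) (rev_lt u) w1 w2 w3 w4).
  by apply: ltn_sub2l; [exact: leq_ltn_trans us (ltn_ord s) | exact: us].
Qed.

(** * Ramsey's theorem for pairs *)

Lemma pigeonhole_count (A : Type) (T : finType) (col : A -> T) (s : seq A) m :
  0 < #|T| -> #|T| * m <= size s -> exists t, m <= count (fun x => col x == t) s.
Proof.
move=> T0; case: m => [|m] sz; first by case/card_gt0P: T0 => t _; exists t.
apply: contrapT => no.
have lt t : count (fun x => col x == t) s <= m.
  by rewrite -ltnS ltnNge; apply/negP => h; apply: no; exists t.
have e : size s = \sum_(t : T) count (fun x => col x == t) s.
  elim: (s) => [|a s' IH] /=; first by rewrite big1.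
  by rewrite big_split /= -IH (bigD1 (col a)) //= eqxx big1 ?addn0 // => t /negbTE; rewrite eq_sym => ->.
have : size s <= #|T| * m by rewrite e -sum_nat_const; apply: leq_sum.
by move=> /(leq_trans sz); rewrite leq_mul2l -leqn0 leqNgt T0 ltnn.
Qed.

Lemma end_homogeneous (T : finType) m : 0 < #|T| -> exists N,
  forall (A : eqType) (f : A -> A -> T) (s : seq A), N <= size s ->
  exists B : seq (A * T),
    [/\ subseq (map fst B) s, size B = m & pairwise (fun x y => f x.1 y.1 == x.2) B].
Proof.
move=> T0; elim: m => [|m [N IH]].
  by exists 0 => A f s _; exists [::]; rewrite sub0seq.
exists (#|T| * N).+1 => A f [|a s] //=; rewrite ltnS => sz.
have [t Ht] := pigeonhole_count (f a) T0 sz.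
have [|B [sub sB pB]] := IH A f [seq b <- s | f a b == t]; first by rewrite size_filter.
exists ((a, t) :: B); split; rewrite /= ?sB ?eqxx //.
  exact: subseq_trans sub (filter_subseq _ _).
rewrite pB andbT; apply/allP => -[b u] bB /=.
have /(mem_subseq sub) : b \in map fst B by apply: (map_f fst bB).
by rewrite mem_filter => /andP[].
Qed.

Lemma ramsey_pairs (T : finType) n : 0 < #|T| -> exists N, forall f : 'I_N -> 'I_N -> T,
  exists (h : 'I_n -> 'I_N) (t : T),
    {homo h : i j / i < j} /\ forall i j : 'I_n, i < j -> f (h i) (h j) = t.
Proof.
move=> T0; have [N HN] := end_homogeneous (#|T| * n) T0.
exists N => f; have [|B [sub sB pB]] := HN _ f (enum 'I_N); first by rewrite size_enum_ord.
have [|t Ht] := @pigeonhole_count _ T (fun x : 'I_N * T => x.2) B n T0; first by rewrite sB.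
pose D := [seq x.1 | x <- B & x.2 == t].
have sD : n <= size D by rewrite size_map size_filter.
have pD : pairwise (fun x y : 'I_N => (x < y) && (f x y == t)) D.
  rewrite /D pairwise_map.
  have subD : subseq (map fst B) (enum 'I_N) := sub.
  have lt1 : pairwise (fun x y : 'I_N * T => x.1 < y.1) B.
    rewrite -(pairwise_map fst (fun x y : 'I_N => x < y)); apply: subseq_pairwise sub _.
    rewrite -(pairwise_map val ltn) val_enum_ord -sorted_pairwise ?iota_ltn_sorted //.
    exact: ltn_trans.
  have both : pairwise (fun x y : 'I_N * T => (x.1 < y.1) && (f x.1 y.1 == x.2)) B.
    by rewrite pairwise_relI lt1 pB.
  have := subseq_pairwise (filter_subseq (fun x => x.2 == t) B) both.
  apply: sub_in_pairwise (filter_all _ _) => x y /eqP ex _ /= /andP[-> /eqP->].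
  by rewrite ex eqxx.
case: (posnP n) => n0.
  have no (i : 'I_n) : False by have := leq_ltn_trans (leq0n i) (ltn_ord i); rewrite n0.
  by case/card_gt0P: T0 => t0 _; exists (fun i : 'I_n => match no i with end), t0; split=> i; case: (no i).
have d0 : 'I_N by case: (D) (leq_trans n0 sD) => // d.
have key (i j : 'I_n) : i < j -> (nth d0 D i < nth d0 D j) && (f (nth d0 D i) (nth d0 D j) == t).
  by move=> ij; apply: (pairwiseP d0 pD); rewrite ?inE //; apply: leq_trans sD.
by exists (fun i => nth d0 D i), t; split=> i j /key /andP[] // _ /eqP.
Qed.

(** A colour records both orders of a pair and the diagonal value at its first entry. The extra
    point serves as a second entry for the last one. *)
Lemma ramsey_cmp (T : finType) n : exists N, forall f : 'I_N -> 'I_N -> T,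
  exists h : 'I_n -> 'I_N, {homo h : i j / i < j} /\
    forall i j i' j' : 'I_n, cmp i j = cmp i' j' -> f (h i) (h j) = f (h i') (h j').
Proof.
have [T0|T0] := posnP #|T|.
  by exists n => f; exists id; split=> // i; have := card0_eq T0 (f i i).
have [|N HN] := @ramsey_pairs (T * T * T)%type n.+1; first by rewrite !card_prod !muln_gt0 T0.
exists N => f; have [h [[[t1 t2] t3] [hh Hh]]] := HN (fun a b => (f a b, f b a, f a a)).
exists (fun i => h (widen_ord (leqnSn n) i)); split; first by move=> i j ij; apply: hh.
have H (i j : 'I_n) : f (h (widen_ord (leqnSn n) i)) (h (widen_ord (leqnSn n) j)) =
   if i < j then t1 else if j < i then t2 else t3.
  case: ltngtP => ij.
  - by have [-> _ _] := Hh (widen_ord (leqnSn n) i) (widen_ord (leqnSn n) j) ij.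
  - by have [_ -> _] := Hh (widen_ord (leqnSn n) j) (widen_ord (leqnSn n) i) ij.
  - have -> : i = j by apply: val_inj.
    by have [_ _ ->] := Hh (widen_ord (leqnSn n) j) ord_max (ltn_ord j).
by move=> i j i' j' [e1 e2]; rewrite !H e1 e2.
Qed.

(** * Canonical grids inside few parts of a decomposition *)

Section Canonical.
Variable sh : template.
Notation P := (pos sh).

(** A pair of rows is coloured by its whole table over pairs of columns, so the later choice of
    columns keeps the rows homogeneous. For this the number [Mc] of columns has to be fixed
    first. *)
Lemma canonical_config (C : gclass) :
  (forall n, exists G, C G /\ exists g : 'I_n -> 'I_n -> 'I_P -> vtx G, config g) ->
  forall n, exists G, C G /\ exists g : 'I_n -> 'I_n -> 'I_P -> vtx G, config g /\ order_canonical g.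
Proof.
move=> H n; pose Inf : finType := {ffun 'I_P * 'I_P -> bool * bool}.
have [Mc Hc] := ramsey_cmp {ffun 'I_n * 'I_n -> Inf} n.
have [Mr Hr] := ramsey_cmp {ffun 'I_Mc * 'I_Mc -> Inf} n.
have [G [CG [g cg]]] := H (maxn Mr Mc); exists G; split=> //.
pose wr : 'I_Mr -> 'I_(maxn Mr Mc) := widen_ord (leq_maxl _ _).
pose wc : 'I_Mc -> 'I_(maxn Mr Mc) := widen_ord (leq_maxr _ _).
have [a [ha Ha]] := Hr (fun s s' => [ffun tt => info (g (wr s) (wc tt.1)) (g (wr s') (wc tt.2))]).
have [b [hb Hb]] := Hc (fun t t' => [ffun ss => info (g (wr (a ss.1)) (wc t)) (g (wr (a ss.2)) (wc t'))]).
exists (fun s t => g (wr (a s)) (wc (b t))); split.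
  apply: (config_sub (a := fun s => wr (a s)) (b := fun t => wc (b t))) cg.
    by move=> i j ij; apply: ha.
  by move=> i j ij; apply: hb.
move=> s t s' t' s1 t1 s1' t1' es et.
have /ffunP/(_ (b t, b t')) := Ha _ _ _ _ es; rewrite !ffunE => ->.
by have /ffunP/(_ (s1, s1')) := Hb _ _ _ _ et; rewrite !ffunE.
Qed.

(** Each row is monochromatic on some [t] of its first [#|K| * t] columns, and [t] rows share both
    the columns and the colour. For fixed [t] the bound is polynomial in [#|K|], as a subpolynomial
    number of parts requires. *)
Lemma monochromatic_grid (K : finType) t n (col : 'I_n -> 'I_n -> K) :
  0 < #|K| -> 0 < t -> t * (#|K| * (#|K| * t) ^ t) <= n ->
  exists (a b : 'I_t -> 'I_n) (kap : K), [/\ {homo a : i j / i < j}, {homo b : i j / i < j}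
    & forall i j, col (a i) (b j) = kap].
Proof.
move=> K0 t0 le_n; pose m := #|K| * t.
have m0 : 0 < m by rewrite muln_gt0 K0.
have mn : m <= n.
  apply: leq_trans le_n; rewrite -/m mulnCA leq_pmul2l // leq_pmulr // expn_gt0 m0 //.
have n0 : 0 < n := leq_trans m0 mn.
pose wm : 'I_m -> 'I_n := widen_ord mn.
have row s : exists ct : K * t.-tuple 'I_m, sorted ltn (map val ct.2) /\ forall j, col s (wm (tnth ct.2 j)) = ct.1.
  have [|k Hk] := @pigeonhole_count _ K (fun j => col s (wm j)) (enum 'I_m) t K0.
    by rewrite size_enum_ord.
  pose D := take t [seq j <- enum 'I_m | col s (wm j) == k].
  have sD : size D == t by rewrite size_takel // size_filter.
  have subD : subseq D (enum 'I_m) by apply: subseq_trans (take_subseq _ _) (filter_subseq _ _).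
  exists (k, Tuple sD); split=> /=.
    rewrite (sorted_pairwise ltn_trans) pairwise_map; apply: subseq_pairwise subD _.
    rewrite -(pairwise_map val ltn) val_enum_ord -sorted_pairwise ?iota_ltn_sorted //.
    exact: ltn_trans.
  move=> j; have : tnth (Tuple sD) j \in D by apply: mem_tnth.
  by move=> /mem_take; rewrite mem_filter => /andP[/eqP].
have [ct Hct] := choice row.
have [||[k tup] Hk] := @pigeonhole_count _ _ ct (enum 'I_n) t.
- by rewrite card_prod muln_gt0 K0 card_tuple card_ord expn_gt0 m0.
- by rewrite size_enum_ord card_prod card_tuple card_ord mulnC.
pose D := take t [seq s <- enum 'I_n | ct s == (k, tup)].
have sD : size D = t by rewrite size_takel // size_filter.
have subD : subseq D (enum 'I_n) by apply: subseq_trans (take_subseq _ _) (filter_subseq _ _).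
have pD : pairwise (fun x y : 'I_n => x < y) D.
  apply: subseq_pairwise subD _.
  rewrite -(pairwise_map val ltn) val_enum_ord -sorted_pairwise ?iota_ltn_sorted //.
  exact: ltn_trans.
pose d0 : 'I_n := Ordinal n0.
have inD (i : 'I_t) : ct (nth d0 D i) = (k, tup).
  have : nth d0 D i \in D by apply: mem_nth; rewrite sD.
  by move=> /mem_take; rewrite mem_filter => /andP[/eqP].
exists (fun i => nth d0 D i), (fun j => wm (tnth tup j)), k; split.
- by move=> i j ij; apply: (pairwiseP d0 pD); rewrite ?inE ?sD.
- move=> i j ij; have [so _] := Hct (nth d0 D i); rewrite inD /= in so.
  have := sorted_ltn_nth ltn_trans 0 so; move=> /(_ i j).
  rewrite !inE !size_map size_tuple !ltn_ord => /(_ isT isT ij).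
  by rewrite !(nth_map (Ordinal m0)) ?size_tuple // -!tnth_nth.
- by move=> i j; have [_ /(_ j)] := Hct (nth d0 D i); rewrite inD.
Qed.

Lemma decomposition_transfer (C : gclass) : hereditary C -> Pi_star Pi_NIP C ->
  (forall n, exists G, C G /\ exists g : 'I_n -> 'I_n -> 'I_P -> vtx G, config g /\ order_canonical g) ->
  exists D, [/\ hereditary D, NIP D &
    forall n, exists G, D G /\ exists g : 'I_n -> 'I_n -> 'I_P -> vtx G, config g /\ order_canonical g].
Proof.
move=> [isoC hC] [_ /(_ P)] dec cfg.
have P0 : 0 < P by case: (pos sh) (pc sh) => // -[].
have [f [ndf [spf [D [[hD nipD] HD]]]]] := dec P0.
exists D; split=> // t0; pose t := t0.+1.
suff [G [DG [g [cg kg]]]] : exists G, D G /\ exists g : 'I_t -> 'I_t -> 'I_P -> vtx G, config g /\ order_canonical g.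
  exists G; split=> //; pose w : 'I_t0 -> 'I_t := widen_ord (leqnSn t0).
  exists (fun s u => g (w s) (w u)); split.
    exact: (config_sub (a := w) (b := w)).
  exact: (order_canonical_sub (a := w) (b := w)).
(* Fourth powers are compared with the bound of [monochromatic_grid]: [Np ^ q] is at most
   [P * n ^ 2], which bounds the number of vertices, and the remaining factor [t ^ (4 * t.+1) * P]
   is at most [n], so the product is at most [n ^ 4]. The summand [N0] in [n] brings [P * n ^ 2]
   into the range where [f] is known to be small. *)
pose q := 4 * (P * t.+1).
have q0 : 0 < q by rewrite !muln_gt0 P0.
have [N0 HN0] := spf q q0.
pose n := N0 + t ^ (4 * t.+1) * P + 1.
have [G0 [CG0 [g0 [cg0 kg0]]]] := cfg n.
pose S := spanned g0.
have [g [cg kg]] := config_induced (spannedP g0) cg0 kg0.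
set G := induced S in g cg kg.
have CG : C G by apply: hC.
have [Np [part [leN HDp]]] := HD G CG.
have szG : gsize G <= P * n ^ 2 by apply: card_spanned.
have leF : Np <= f (P * n ^ 2) by apply: leq_trans leN (ndf _ _ szG).
have n0 : 0 < n by rewrite /n addn1.
have x0 : vtx G := g (Ordinal n0) (Ordinal n0) (pc sh).
have Np0 : 0 < Np by case: (Np) (part x0) => // -[].
pose K : finType := {ffun 'I_P -> 'I_Np}.
have cK : #|K| = Np ^ P by rewrite card_ffun !card_ord.
have big : t * (#|K| * (#|K| * t) ^ t) <= n.
  rewrite cK -(@leq_exp2r _ _ 4) //.
  have -> : t * (Np ^ P * (Np ^ P * t) ^ t) = t ^ t.+1 * Np ^ (P * t.+1).
    have e A u : u * (A * (A * u) ^ u) = u ^ u.+1 * A ^ u.+1.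
      by rewrite expnMn !expnS mulnA (mulnC (A ^ u)) mulnACA.
    by rewrite e expnM.
  rewrite expnMn -!expnM.
  have xN : N0 <= P * n ^ 2.
    apply: (leq_trans (n := n)); first by rewrite /n -addnA leq_addr.
    by apply: (@leq_trans (n ^ 2)); rewrite ?leq_pmull // -mulnn leq_pmulr.
  have [_ fq] := HN0 _ xN.
  have h1 : Np ^ (P * t.+1 * 4) <= P * n ^ 2.
    by apply: leq_trans fq; rewrite /q (mulnC 4) leq_exp2r // !muln_gt0 P0.
  apply: leq_trans (leq_mul (leqnn _) h1) _.
  rewrite mulnA -[4]/(2 + 2) expnD leq_mul2r; apply/orP; right.
  apply: (@leq_trans n); last by rewrite -mulnn leq_pmulr.
  by rewrite /n (mulnC t.+1) -addnA addnCA leq_addr.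
have [|a [b [kap [ha hb Hab]]]] := @monochromatic_grid K t n (fun s u => [ffun i => part (g s u i)]) _ isT big.
  by rewrite cK expn_gt0 Np0.
have DG := HDp kap.
have mem s u i : g (a s) (b u) i \in [set x | [exists j : 'I_P, part x == kap j]]%SET.
  by rewrite inE; apply/existsP; exists i; rewrite -(Hab s u) ffunE.
exists (induced [set x | [exists j : 'I_P, part x == kap j]]%SET); split=> //.
apply: (config_induced mem); first exact: config_sub.
exact: order_canonical_sub.
Qed.

End Canonical.

(** * Independence from canonical configurations *)

Definition ftrue : formula := FNeg (FEx 0 (FNeg (FEq 0 0))).
Definition fconj (I : Type) (F : I -> formula) (s : seq I) : formula :=
  foldr (fun i f => FAnd (F i) f) ftrue s.
Definition exs (vs : seq nat) (f : formula) : formula := foldr FEx f vs.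
Definition lit (b : bool) (f : formula) : formula := if b then f else FNeg f.
Definition fif (b : bool) (f : formula) : formula := if b then f else ftrue.

Section Syntax.
Variable G : graph.
Implicit Type rho : nat -> vtx G.

Lemma sat_and f g rho : sat rho (FAnd f g) <-> sat rho f /\ sat rho g.
Proof. by []. Qed.

Lemma sat_ex x f rho : sat rho (FEx x f) <-> exists a, sat (upd rho x a) f.
Proof. by []. Qed.

Lemma sat_neg f rho : sat rho (FNeg f) <-> ~ sat rho f.
Proof. by []. Qed.

Lemma sat_ftrue rho : sat rho ftrue.
Proof. by move=> [a []]. Qed.

Lemma sat_fconj (I : eqType) (F : I -> formula) s rho :
  sat rho (fconj F s) <-> forall i, i \in s -> sat rho (F i).
Proof.
elim: s => [|a s IH] /=; first by split=> // _; apply: sat_ftrue.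
split=> [[h1 /IH h2] i|h]; first by rewrite inE => /orP[/eqP->|/h2].
split; first by apply: h; rewrite inE eqxx.
by apply/IH => i is_; apply: h; rewrite inE is_ orbT.
Qed.

Lemma sat_exs vs f rho : sat rho (exs vs f) <->
  exists rho', (forall x, x \notin vs -> rho' x = rho x) /\ sat rho' f.
Proof.
elim: vs rho => [|v vs IH] rho /=.
  split=> [h|[rho' [e h]]]; first by exists rho.
  by have <- : rho' = rho by apply: funext => x; apply: e.
split=> [[a /IH[rho' [e h]]]|[rho' [e h]]].
  exists rho'; split=> // x; rewrite inE negb_or => /andP[xv /e ->].
  by rewrite /upd (negbTE xv).
exists (rho' v); apply/IH; exists rho'; split=> // x xvs.
by rewrite /upd; case: eqP => [->//|/eqP xv]; apply: e; rewrite inE negb_or xv.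
Qed.

Lemma sat_lit b f rho (p : bool) : (sat rho f <-> p) -> (sat rho (lit b f) <-> p = b).
Proof.
by move=> h; case: b => /=; [exact: h | rewrite h; case: p {h}; split].
Qed.

Lemma sat_fif b f rho : sat rho (fif b f) <-> (b -> sat rho f).
Proof.
case: b; first by split=> [//|h]; exact: h.
by split=> // _; exact: sat_ftrue.
Qed.

End Syntax.

Lemma free_and f g x : free_in x (FAnd f g) = free_in x f || free_in x g.
Proof. by []. Qed.

Lemma free_ex y f x : free_in x (FEx y f) = (x != y) && free_in x f.
Proof. by []. Qed.

Lemma free_fconj (I : eqType) (F : I -> formula) s x :
  free_in x (fconj F s) -> exists i, i \in s /\ free_in x (F i).
Proof.
elim: s => [|a s IH] /=; first by rewrite orbb; case: (x == 0).
move=> /orP[h|/IH[i [is_ h]]]; first by exists a; rewrite inE eqxx.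
by exists i; rewrite inE is_ orbT.
Qed.

Lemma free_exs vs f x : free_in x (exs vs f) = (x \notin vs) && free_in x f.
Proof. by elim: vs => //= v vs ->; rewrite inE negb_or andbA. Qed.

Lemma free_lit b f x : free_in x (lit b f) = free_in x f.
Proof. by case: b. Qed.

Lemma free_fif b f x : free_in x (fif b f) -> free_in x f.
Proof. by case: b => //=; rewrite orbb; case: (x == 0). Qed.

Section Formula.
Variable sh : template.
Notation P := (pos sh).
Let P0 : 0 < P. Proof. by case: (pos sh) (pc sh) => // -[]. Qed.
Let q := P.+1.
(** A copy involves at most [P] rows besides the last one of the block; with [P + 2] rows per block
    there is room to push all of them down so that the last one moves. The same holds for
    columns. *)
Let B := P.+2.
Let K := B * P.
(** Layout of the variables: the row tuples of a block, its column tuples, the coded value, and then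
    the bound vertices of a copy. *)
Let xv (u : nat) (i : 'I_P) : nat := u * P + i.
Let yv (v : nat) (i : 'I_P) : nat := K + (v * P + i).
Let zv : nat := K + K.
Let wv (i : nat) : nat := (zv + i).+1.

Definition chi_f (u v : nat) : formula :=
  exs (map wv (iota 0 P))
   (FAnd (fconj (fun ij : 'I_P * 'I_P => FAnd (lit (dE ij.1 ij.2) (FAdj (wv ij.1) (wv ij.2)))
                                             (lit (dQ ij.1 ij.2) (FEq (wv ij.1) (wv ij.2))))
               (enum {: 'I_P * 'I_P}))
         (fconj (fun i : 'I_P => FAnd (fif (pX i) (FEq (wv i) (xv u i)))
                  (FAnd (fif (pY i) (FEq (wv i) (yv v i))) (fif (i == pc sh) (FEq (wv i) zv))))
               (enum 'I_P))).

(* Blocks have [q.+1] rows and columns; only the last cell of a block is tested. *)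
Definition code_f : formula :=
  FEx zv (FAnd (chi_f q q) (FAnd (fconj (fun v => FNeg (chi_f q v)) (iota 0 q))
                                 (fconj (fun u => FNeg (chi_f u q)) (iota 0 q)))).

Section Semantics.
Variable G : graph.

Definition chi (xs ys : 'I_P -> vtx G) (z : vtx G) : Prop :=
  exists w : 'I_P -> vtx G, [/\ copy w, forall i, pX i -> w i = xs i,
    forall i, pY i -> w i = ys i & w (pc sh) = z].

Lemma xv_lt u (i : 'I_P) : u < B -> xv u i < K.
Proof.
move=> uB; rewrite /xv /K; apply: (@leq_trans (u.+1 * P)); last by rewrite leq_mul2r uB orbT.
by rewrite mulSn addnC ltn_add2r.
Qed.

Lemma wvP x : reflect (exists i : 'I_P, x = wv i) (x \in map wv (iota 0 P)).
Proof.
apply: (iffP mapP) => [[i]|[i ->]]; last by exists (i : nat); rewrite ?mem_iota /=.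
by rewrite mem_iota => /= iP ->; exists (Ordinal iP).
Qed.

Lemma sat_chi rho u v : u < B -> v < B -> @sat G rho (chi_f u v) <->
  chi (fun i => rho (xv u i)) (fun i => rho (yv v i)) (rho zv).
Proof.
move=> uB vB.
have nw x : x <= zv -> x \notin map wv (iota 0 P).
  by move=> xz; apply/wvP => -[i e]; move: xz; rewrite e /wv ltnNge leq_addr.
have nx (i : 'I_P) : xv u i \notin map wv (iota 0 P).
  by apply: nw; rewrite /zv (leq_trans (ltnW (xv_lt i uB))) // leq_addr.
have ny (i : 'I_P) : yv v i \notin map wv (iota 0 P).
  by apply: nw; rewrite /zv /yv leq_add2l ltnW // xv_lt.
rewrite sat_exs; split=> [[rho' [e [h1 h2]]]|[w [cw wX wY wz]]].
  exists (fun i => rho' (wv i)).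
  have h1' i j := (sat_fconj _ _ _).1 h1 (i, j) (mem_enum _ _).
  have h2' i := (sat_fconj _ _ _).1 h2 i (mem_enum _ _).
  split.
  - move=> i j; have [l1 l2] := h1' i j; split.
      by apply: (sat_lit (f := FAdj (wv i) (wv j)) _ _).1 l1 => //=.
    by apply: (sat_lit (f := FEq (wv i) (wv j)) _ _).1 l2 => //=; split=> /eqP.
  - by move=> i Xi; have [/sat_fif/(_ Xi) /= -> _] := h2' i; apply: e.
  - by move=> i Yi; have [_ [/sat_fif/(_ Yi) /= -> _]] := h2' i; apply: e.
  - by have [_ [_ /sat_fif/(_ (eqxx _)) /= ->]] := h2' (pc sh); apply: e; apply: nw.
pose rho' x := if x < zv.+1 then rho x else (if insub (x - zv.+1) is Some i then w i else rho x).
have rw (i : 'I_P) : rho' (wv i) = w i.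
  by rewrite /rho' /wv ltnS -addSn ltnNge leq_addr /= addKn valK.
have rx x : x <= zv -> rho' x = rho x by move=> xz; rewrite /rho' ltnS xz.
exists rho'; split; last split.
- move=> x xw; rewrite /rho'; case: ltnP => // zx; case: insubP => // i _ ei.
  by case/wvP: xw; exists i; rewrite /wv ei -addSn subnKC.
- apply/sat_fconj => -[i j] _ /=; have [l1 l2] := cw i j; split.
    by apply/sat_lit; [|exact: l1]; rewrite /= !rw.
  by apply/sat_lit; [|exact: l2]; rewrite /= !rw; split=> /eqP.
- apply/sat_fconj => i _; split; last split; apply/sat_fif => /=; rewrite rw.
  + by move=> Xi; rewrite wX // rx // /zv (leq_trans (ltnW (xv_lt i uB))) // leq_addr.
  + by move=> Yi; rewrite wY // rx // /zv /yv leq_add2l ltnW // xv_lt.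
  + by move=> /eqP->; rewrite rx.
Qed.

Definition tup (T : Type) (A : nat -> 'I_P -> T) (j : 'I_K) : T :=
  A (j %/ P) (Ordinal (ltn_pmod j P0)).

Lemma holds_code (A A' : nat -> 'I_P -> vtx G) :
  holds_at code_f (tup A) (tup A') <-> exists z, [/\ chi (A q) (A' q) z,
    forall v, v < q -> ~ chi (A q) (A' v) z & forall u, u < q -> ~ chi (A u) (A' q) z].
Proof.
have tupE T (D : nat -> 'I_P -> T) u (i : 'I_P) (h : xv u i < K) : tup D (Ordinal h) = D u i.
  rewrite /tup /= /xv divnMDl // divn_small // addn0; congr (D u _); apply: val_inj => /=.
  by rewrite modnMDl modn_small.
have qB : q < B by [].
have lB v : v < q -> v < B by move=> h; apply: ltn_trans h _.
have main (rho : nat -> vtx G) : (forall j : 'I_K, rho j = tup A j) ->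
    (forall j : 'I_K, rho (K + j) = tup A' j) -> forall z u v, u < B -> v < B ->
    sat (upd rho zv z) (chi_f u v) <-> chi (A u) (A' v) z.
  move=> r1 r2 z u v uB vB; rewrite sat_chi //.
  have -> : (fun i => upd rho zv z (xv u i)) = A u.
    apply: funext => i; rewrite /upd ltn_eqF; last first.
      by apply: leq_trans (xv_lt i uB) _; rewrite /zv leq_addr.
    by rewrite -(tupE _ A u i (xv_lt i uB)) -r1.
  have -> : (fun i => upd rho zv z (yv v i)) = A' v.
    apply: funext => i; rewrite /upd ltn_eqF; last by rewrite /zv /yv ltn_add2l xv_lt.
    by rewrite -(tupE _ A' v i (xv_lt i vB)) -r2.
  by rewrite /upd eqxx.
split=> [[rho [r1 [r2 /sat_ex[z /sat_and[h1 /sat_and[h2 h3]]]]]]|[z [h1 h2 h3]]].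
  exists z; split; first by apply/(main rho).
  - move=> v vq; have /sat_fconj/(_ v) := h2; rewrite mem_iota => /(_ vq) /sat_neg h c.
    by apply: h; apply/(main rho) => //; apply: lB.
  - move=> u uq; have /sat_fconj/(_ u) := h3; rewrite mem_iota => /(_ uq) /sat_neg h c.
    by apply: h; apply/(main rho) => //; apply: lB.
pose rho x := if insub x is Some j then tup A j else
   if insub (x - K) is Some j then tup A' j else z.
have r1 (j : 'I_K) : rho j = tup A j by rewrite /rho valK.
have r2 (j : 'I_K) : rho (K + j) = tup A' j.
  by rewrite /rho insubF ?addKn ?valK // ltnNge leq_addr.
exists rho; split=> //; split=> //; apply/sat_ex; exists z; apply/sat_and; split; first by apply/(main rho).
apply/sat_and; split; apply/sat_fconj => v; rewrite mem_iota => vq; apply/sat_neg.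
- by move=> /(main rho r1 r2 z q v qB (lB _ vq)); apply: h2.
- by move=> /(main rho r1 r2 z v q (lB _ vq) qB); apply: h3.
Qed.

End Semantics.

Lemma free_code x : free_in x code_f -> x < K + K.
Proof.
have fchi u v : u < B -> v < B -> free_in x (chi_f u v) -> x != zv -> x < K + K.
  move=> uB vB; rewrite free_exs => /andP[/wvP nw].
  have nwi (i : 'I_P) : (x == wv i) = false by apply/eqP => e; apply: nw; exists i.
  move=> /orP[/free_fconj[[i j] [_]]|/free_fconj[i [_]]] /=.
    by rewrite !free_lit /= !nwi.
  move=> /or3P[] /free_fif /=; rewrite nwi /=.
  - by move=> /eqP-> _; apply: leq_trans (xv_lt i uB) _; rewrite leq_addr.
  - by move=> /eqP-> _; rewrite /yv ltn_add2l xv_lt.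
  - by move=> ->.
have lB v : v < q -> v < B by move=> h; apply: ltn_trans h _.
rewrite free_ex free_and (free_and (fconj _ _)) => /andP[xz /or3P[h|/free_fconj[v [vq h]]|/free_fconj[u [uq h]]]].
- exact: (fchi q q).
- by rewrite mem_iota in vq; apply: (fchi q v) => //; apply: lB.
- by rewrite mem_iota in uq; apply: (fchi u q) => //; apply: lB.
Qed.

End Formula.

(* Inside the block [b, b + P + 2) the points of [U] are pushed down to the first
   positions; the last position of the block has to move. *)
Lemma push_down (n P b : nat) (x0 : 'I_n) (c : 'I_P -> 'I_n) : x0 = b + P.+1 :> nat ->
  exists f : 'I_n -> 'I_n,
  [/\ forall x y, x \in x0 :: codom c -> y \in x0 :: codom c -> cmp (f x) (f y) = cmp x y,
      forall x : 'I_n, ~~ (b <= x < b + P.+2) -> f x = x,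
      forall x : 'I_n, x \in x0 :: codom c -> b <= x < b + P.+2 -> b <= f x < b + P.+2
    & exists2 v, v < P.+1 & f x0 = b + v :> nat].
Proof.
move=> ex0; pose U := x0 :: codom c.
have x0n : b + P.+1 < n by rewrite -ex0.
pose below (x : 'I_n) : {set 'I_n} := [set y in U | (b <= y) && (y < x)]%SET.
have bx x : #|below x| < P.+2.
  have sU : below x \subset U by apply/fintype.subsetP => y; rewrite inE => /andP[].
  have := leq_trans (subset_leq_card sU) (card_size U).
  by rewrite /U /= size_codom card_ord.
have fn x : b + #|below x| < n.
  by apply: leq_ltn_trans x0n; rewrite leq_add2l -ltnS.
pose f (x : 'I_n) : 'I_n := if b <= x < b + P.+2 then Ordinal (fn x) else x.
have mono (x y : 'I_n) : x \in U -> y \in U -> x < y -> f x < f y.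
  move=> xU yU xy; rewrite /f; case: ifP => [/andP[bx1 bx2]|/negbT nx]; case: ifP => [/andP[by1 by2]|/negbT ny] //=.
  - rewrite ltn_add2l; apply: proper_card; apply/properP; split.
      by apply/fintype.subsetP => z; rewrite !inE => /andP[-> /andP[-> zx]] /=; apply: ltn_trans xy.
    by exists x; rewrite !inE ?xU ?bx1 ?xy ?ltnn ?andbF //= -?in_cons ?xU.
  - move: ny; rewrite negb_and -leqNgt -ltnNge; case/orP=> ny.
      by rewrite ltnNge (leq_trans bx1 (ltnW xy)) in ny.
    by apply: leq_trans ny; rewrite ltn_add2l.
  - move: nx; rewrite negb_and -ltnNge -leqNgt; case/orP=> nx.
      by apply: leq_trans nx _; rewrite leq_addr.
    by have := leq_ltn_trans nx (ltn_trans xy by2); rewrite ltnn.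
exists f; split.
- move=> x y xU yU; rewrite /cmp; case: (ltngtP x y) => xy.
  + by have := mono x y xU yU xy; case: ltngtP.
  + by have := mono y x yU xU xy; case: ltngtP.
  + by rewrite (val_inj xy) ltnn.
- by move=> x /negbTE nx; rewrite /f nx.
- by move=> x xU h; rewrite /f h /= leq_addr ltn_add2l bx.
exists #|below x0|; last by rewrite /f ex0 leq_addr ltn_add2l ltnSn.
have sU : below x0 \subset codom c.
  apply/fintype.subsetP => y; rewrite !inE => /andP[/orP[/eqP->|//]].
  by rewrite ltnn andbF.
have := leq_trans (subset_leq_card sU) (card_size (codom c)).
by rewrite size_codom card_ord.
Qed.

Lemma mem_cons_codom (I : finType) (T : eqType) (x0 : T) (c : I -> T) i : c i \in x0 :: codom c.
Proof. by rewrite in_cons codom_f orbT. Qed.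

Section Independence.
Variable sh : template.
Notation P := (pos sh).
Let q := P.+1.
Let B := P.+2.

Section OneGraph.
Variables (G : graph) (m n : nat) (g : 'I_m -> 'I_m -> 'I_P -> vtx G) (Rel : nat -> nat -> bool).
Hypotheses (cg : config g) (kg : order_canonical g).
Hypothesis mB : forall i, i < n -> i * B + B <= m.
Variables (i0 j0 : nat).
Hypotheses (i0n : i0 < n) (j0n : j0 < n) (R0 : Rel i0 j0).

(** A vertex may occur in several cells, and one justified occurrence is enough to keep it. Row and
    column parts are always kept, so that the tuples of all blocks remain available. *)
Definition kept : {set vtx G} :=
  [set x | [exists s : 'I_m, [exists t : 'I_m, [exists j : 'I_P,
     (x == g s t j) && [|| Rel (s %/ B) (t %/ B), pX j | pY j]]]]]%SET.

Lemma keptP x : reflect (exists s t j, x = g s t j /\ [|| Rel (s %/ B) (t %/ B), pX j | pY j]) (x \in kept).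
Proof.
rewrite inE; apply: (iffP existsP).
  by move=> [s /existsP[t /existsP[j /andP[/eqP-> h]]]]; exists s, t, j.
move=> [s [t [j [-> h]]]]; exists s; apply/existsP; exists t; apply/existsP; exists j.
by rewrite eqxx.
Qed.

Lemma idx_lt i a : i < n -> a < B -> i * B + a < m.
Proof. by move=> hi ha; apply: leq_trans (mB hi); rewrite ltn_add2l. Qed.

Lemma idx_div i a : a < B -> (i * B + a) %/ B = i.
Proof. by move=> ha; rewrite divnMDl // divn_small // addn0. Qed.

Let H := induced kept.

Lemma in_kept (s t : 'I_m) (j : 'I_P) : [|| Rel (s %/ B) (t %/ B), pX j | pY j] -> g s t j \in kept.
Proof. by move=> h; apply/keptP; exists s, t, j. Qed.

Definition mk (s t : 'I_m) (j : 'I_P) (h : [|| Rel (s %/ B) (t %/ B), pX j | pY j]) : vtx H :=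
  exist (fun x : vtx G => x \in kept) (g s t j) (in_kept h).

Definition xtup (i a : nat) (j : 'I_P) (x : vtx H) : Prop :=
  pX j -> forall s t : 'I_m, s = i * B + a :> nat -> val x = g s t j.
Definition ytup (i a : nat) (j : 'I_P) (x : vtx H) : Prop :=
  pY j -> forall s t : 'I_m, t = i * B + a :> nat -> val x = g s t j.

Lemma tuples_exist : exists (xs ys : nat -> nat -> 'I_P -> vtx H),
  (forall i a j, i < n -> a < B -> xtup i a j (xs i a j)) /\
  (forall i a j, i < n -> a < B -> ytup i a j (ys i a j)).
Proof.
have [c1 c2 c3 c4 c5] := cg.
pose o i (hi : i < n) : 'I_m := Ordinal (@idx_lt i 0 hi isT).
(* A related pair of blocks provides a vertex of the induced subgraph, used as the default value. *)
have hd : [|| Rel (o _ i0n %/ B) (o _ j0n %/ B), pX (pc sh) | pY (pc sh)].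
  by rewrite /= !idx_div // R0.
pose d : vtx H := mk hd.
have /choice[xs Hxs] : forall iaj : nat * nat * 'I_P, exists x : vtx H,
    iaj.1.1 < n -> iaj.1.2 < B -> xtup iaj.1.1 iaj.1.2 iaj.2 x.
  move=> [[i a] j] /=; case: (ltnP i n) => hi; last by exists d.
  case: (ltnP a B) => ha; last by exists d.
  case Xj: (pX j); last by exists d => _ _; rewrite /xtup Xj.
  have h : [|| Rel (Ordinal (idx_lt hi ha) %/ B) (o _ i0n %/ B), pX j | pY j] by rewrite Xj orbT.
  exists (mk h) => _ _ _ s t es /=.
  have -> : s = Ordinal (idx_lt hi ha) by apply: val_inj.
  exact: c2.
have /choice[ys Hys] : forall iaj : nat * nat * 'I_P, exists x : vtx H,
    iaj.1.1 < n -> iaj.1.2 < B -> ytup iaj.1.1 iaj.1.2 iaj.2 x.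
  move=> [[i a] j] /=; case: (ltnP i n) => hi; last by exists d.
  case: (ltnP a B) => ha; last by exists d.
  case Yj: (pY j); last by exists d => _ _; rewrite /ytup Yj.
  have h : [|| Rel (o _ i0n %/ B) (Ordinal (idx_lt hi ha) %/ B), pX j | pY j] by rewrite Yj !orbT.
  exists (mk h) => _ _ _ s t es /=.
  have -> : t = Ordinal (idx_lt hi ha) by apply: val_inj.
  exact: c3.
exists (fun i a j => xs (i, a, j)), (fun i a j => ys (i, a, j)).
by split=> i a j hi ha; [exact: (Hxs (i, a, j)) | exact: (Hys (i, a, j))].
Qed.

Variables (xs ys : nat -> nat -> 'I_P -> vtx H).
Hypotheses (Hxs : forall i a j, i < n -> a < B -> xtup i a j (xs i a j))
           (Hys : forall i a j, i < n -> a < B -> ytup i a j (ys i a j)).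

Lemma copy_val (w : 'I_P -> vtx H) : copy w -> copy (fun j => val (w j)).
Proof. by move=> cw i j; have := cw i j. Qed.

(** The last cell of the pair of blocks is kept entirely, and its value is the witness; the
    forbidding clauses of [config] rule out the earlier rows and columns. *)
Lemma coded_of_rel i k : i < n -> k < n -> Rel i k -> exists z : vtx H,
  [/\ chi (xs i q) (ys k q) z, forall v, v < q -> ~ chi (xs i q) (ys k v) z
    & forall u, u < q -> ~ chi (xs i u) (ys k q) z].
Proof.
have [c1 c2 c3 c4 c5] := cg; move=> hi hk Rik.
have qB : q < B by [].
pose s := Ordinal (idx_lt hi qB); pose t := Ordinal (idx_lt hk qB).
have hst (j : 'I_P) : [|| Rel (s %/ B) (t %/ B), pX j | pY j] by rewrite /= !idx_div // Rik.
exists (mk (hst (pc sh))); split.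
- exists (fun j => mk (hst j)); split=> //.
  + by move=> j j'; have := c1 s t j j'.
  + by move=> j Xj; apply: val_inj; rewrite (Hxs hi qB Xj (s := s) t).
  + by move=> j Yj; apply: val_inj; rewrite (Hys hk qB Yj s (t := t)).
- move=> v vq [w [cw wX wY wz]].
  have vB : v < B := ltn_trans vq qB.
  apply: (c4 s t (Ordinal (idx_lt hk vB)) _ _ (copy_val cw)).
  + by rewrite /= ltn_add2l.
  + by move=> j Xj; rewrite wX // (Hxs hi qB Xj (s := s) t).
  + by move=> j Yj; rewrite wY // (Hys hk vB Yj s (t := Ordinal (idx_lt hk vB))).
  + by rewrite wz.
- move=> u uq [w [cw wX wY wz]].
  have uB : u < B := ltn_trans uq qB.
  apply: (c5 s t (Ordinal (idx_lt hi uB)) _ _ (copy_val cw)).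
  + by rewrite /= ltn_add2l.
  + by move=> j Xj; rewrite wX // (Hxs hi uB Xj (s := Ordinal (idx_lt hi uB)) t).
  + by move=> j Yj; rewrite wY // (Hys hk qB Yj s (t := t)).
  + by rewrite wz.
Qed.

Lemma in_block (x b : nat) : (b * B <= x < b * B + B) = (x %/ B == b).
Proof.
apply/idP/eqP => [/andP[h1 h2]|<-].
  by rewrite -(subnKC h1) idx_div // ltn_subLR.
by rewrite leq_divM /= {1}(divn_eq x B) ltn_add2l ltn_pmod.
Qed.

(** Suppose that the blocks are unrelated. Then [z] was kept for another occurrence: in a row or
    column part, or in a related pair of blocks, hence outside the rows of [i] or outside the
    columns of [k]. So [z] is unaffected either by moving columns within block [k] or by moving rows
    within block [i]. Pushing these down turns the copy, by order-canonicity, into one that reaches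
    [z] from an earlier column or row, which the formula forbids. *)
Lemma rel_of_coded i k z : i < n -> k < n ->
  chi (xs i q) (ys k q) z -> (forall v, v < q -> ~ chi (xs i q) (ys k v) z) ->
  (forall u, u < q -> ~ chi (xs i u) (ys k q) z) -> Rel i k.
Proof.
have [c1 c2 c3 c4 c5] := cg; move=> hi hk [w [cw wX wY wz]] nv nu.
have qB : q < B by [].
pose s0 := Ordinal (idx_lt hi qB); pose t0 := Ordinal (idx_lt hk qB).
case Rik: (Rel i k) => //; exfalso.
(* For each vertex of the copy an occurrence that justifies keeping it; for the row and column
   parts, the occurrence in the last cell, which makes them follow the moves. *)
have /choice[r Hr] : forall j, exists r : 'I_m * 'I_m * 'I_P,
    [/\ val (w j) = g r.1.1 r.1.2 r.2, [|| Rel (r.1.1 %/ B) (r.1.2 %/ B), pX r.2 | pY r.2]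
      & pX j || pY j -> r = (s0, t0, j)].
  move=> j; case Xj: (pX j || pY j); last first.
    have /keptP[s [t [k' [e h]]]] := valP (w j).
    by exists (s, t, k').
  exists (s0, t0, j); split=> //=; last by rewrite Xj orbT.
  case/orP: Xj => [Xj|Yj]; first by rewrite wX // (Hxs hi qB Xj (s := s0) t0).
  by rewrite wY // (Hys hk qB Yj s0 (t := t0)).
have main (fs ft : 'I_m -> 'I_m) :
    (forall x y, x \in s0 :: codom (fun j => (r j).1.1) -> y \in s0 :: codom (fun j => (r j).1.1) ->
      cmp (fs x) (fs y) = cmp x y) ->
    (forall x y, x \in t0 :: codom (fun j => (r j).1.2) -> y \in t0 :: codom (fun j => (r j).1.2) ->
      cmp (ft x) (ft y) = cmp x y) ->
    (forall j, fs (r j).1.1 %/ B = (r j).1.1 %/ B) -> (forall j, ft (r j).1.2 %/ B = (r j).1.2 %/ B) ->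
    exists w' : 'I_P -> vtx H, copy w' /\ forall j, val (w' j) = g (fs (r j).1.1) (ft (r j).1.2) (r j).2.
  move=> ms mt ds dt.
  have h (j : 'I_P) : [|| Rel (fs (r j).1.1 %/ B) (ft (r j).1.2 %/ B), pX (r j).2 | pY (r j).2].
    by rewrite ds dt; have [_ ? _] := Hr j.
  exists (fun j => mk (h j)); split=> // j j'.
  have [e _ _] := Hr j; have [e' _ _] := Hr j'.
  have := cw j j'.
  rewrite -[adj (w j) _]/(adj (val (w j)) (val (w j'))) -[w j == _]/(val (w j) == val (w j')) e e'.
  rewrite -[adj (mk _) _]/(adj (g _ _ _) (g _ _ _)) -[mk _ == _]/(g _ _ _ == g _ _ _).
  have inr1 (j1 : 'I_P) : (r j1).1.1 \in s0 :: codom (fun j => (r j).1.1).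
    exact: (mem_cons_codom _ (fun j => (r j).1.1)).
  have inr2 (j1 : 'I_P) : (r j1).1.2 \in t0 :: codom (fun j => (r j).1.2).
    exact: (mem_cons_codom _ (fun j => (r j).1.2)).
  have := kg (ms _ _ (inr1 j) (inr1 j')) (mt _ _ (inr2 j) (inr2 j')).
  by move/ffunP/(_ ((r j).2, (r j').2)); rewrite !ffunE /= => -[-> ->].
have [ez hz rz] := Hr (pc sh); rewrite wz in ez.
have [colfree|rowfree] : (pX (r (pc sh)).2 \/ (r (pc sh)).1.2 %/ B != k) \/
    (pY (r (pc sh)).2 \/ (r (pc sh)).1.1 %/ B != i).
- case/or3P: hz => h; [|by left; left|by right; left].
  case: (eqVneq ((r (pc sh)).1.2 %/ B) k) => [ek|]; last by left; right.
  case: (eqVneq ((r (pc sh)).1.1 %/ B) i) => [ei|]; last by right; right.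
  by rewrite ek ei Rik in h.
- have [f [fm fout fin [v vq fv]]] := @push_down m P (k * B) t0 (fun j => (r j).1.2) erefl.
  have fdiv j : f (r j).1.2 %/ B = (r j).1.2 %/ B.
    case: (boolP (k * B <= (r j).1.2 < k * B + P.+2)) => [hb|/fout->//].
    have := fin _ (mem_cons_codom _ (fun j => (r j).1.2) j) hb.
    by move: hb; rewrite !in_block => /eqP-> /eqP.
  have [w' [cw' ew']] := main id f (fun x y _ _ => erefl) fm (fun j => erefl) fdiv.
  apply: (nv v vq); exists w'; split=> //.
  + move=> j Xj; apply: val_inj; rewrite ew'; have [_ _ ->] := Hr j; last by rewrite Xj.
    by rewrite (Hxs hi qB Xj (s := s0) (f t0)).
  + move=> j Yj; apply: val_inj; rewrite ew'; have [_ _ ->] := Hr j; last by rewrite Yj orbT.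
    by rewrite (Hys hk (ltn_trans vq qB) Yj s0 (t := f t0)).
  + apply: val_inj; rewrite ew' ez /=; case: colfree => [Xc|nk]; first exact: c2.
    by rewrite fout // in_block.
- have [f [fm fout fin [u uq fu]]] := @push_down m P (i * B) s0 (fun j => (r j).1.1) erefl.
  have fdiv j : f (r j).1.1 %/ B = (r j).1.1 %/ B.
    case: (boolP (i * B <= (r j).1.1 < i * B + P.+2)) => [hb|/fout->//].
    have := fin _ (mem_cons_codom _ (fun j => (r j).1.1) j) hb.
    by move: hb; rewrite !in_block => /eqP-> /eqP.
  have [w' [cw' ew']] := main f id fm (fun x y _ _ => erefl) fdiv (fun j => erefl).
  apply: (nu u uq); exists w'; split=> //.
  + move=> j Xj; apply: val_inj; rewrite ew'; have [_ _ ->] := Hr j; last by rewrite Xj.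
    by rewrite (Hxs hi (ltn_trans uq qB) Xj (s := f s0) t0).
  + move=> j Yj; apply: val_inj; rewrite ew'; have [_ _ ->] := Hr j; last by rewrite Yj orbT.
    by rewrite (Hys hk qB Yj (f s0) (t := t0)).
  + apply: val_inj; rewrite ew' ez /=; case: rowfree => [Yc|nk]; first exact: c3.
    by rewrite fout // in_block.
Qed.

End OneGraph.

Theorem independent_of_canonical (D : gclass) : hereditary D ->
  (forall n, exists G, D G /\ exists g : 'I_n -> 'I_n -> 'I_P -> vtx G, config g /\ order_canonical g) ->
  independent D.
Proof.
move=> [_ hD] cfg; exists (P.+2 * P), (P.+2 * P), (code_f sh); split; first exact: free_code.
suff main n : exists G : graph, D G /\ exists (u : 'I_n.+1 -> 'I_(P.+2 * P) -> vtx G)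
    (v : {set 'I_n.+1} -> 'I_(P.+2 * P) -> vtx G),
    forall i J, holds_at (code_f sh) (u i) (v J) <-> i \in J.
  move=> n; have [G [DG [u [v H]]]] := main n; exists G; split=> //.
  pose w : 'I_n -> 'I_n.+1 := widen_ord (leqnSn n).
  exists (fun i => u (w i)), (fun J : {set 'I_n} => v (w @: J)%SET) => i J.
  by rewrite H mem_imset // => a b /(congr1 val) e; apply: val_inj.
(* Blocks of rows stand for elements and blocks of columns for subsets; with [n.+1] elements the
   relation holds somewhere, as the default vertex requires. *)
pose N := maxn n.+1 #|{set 'I_n.+1}|.
have [G [DG [g [cg kg]]]] := cfg (N * P.+2).
pose Rel (a b : nat) : bool :=
  if insub a is Some i then
    if insub b is Some k then (i : 'I_n.+1) \in enum_val (k : 'I_#|{set 'I_n.+1}|) else false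
  else false.
have mB i : i < N -> i * P.+2 + P.+2 <= N * P.+2 by move=> h; rewrite -mulSnr leq_mul2r h.
have relE (i : 'I_n.+1) (J : {set 'I_n.+1}) : Rel i (enum_rank J) = (i \in J).
  by rewrite /Rel !valK enum_rankK.
have iN (i : 'I_n.+1) : i < N by apply: leq_trans (ltn_ord i) (leq_maxl _ _).
have JN (J : {set 'I_n.+1}) : enum_rank J < N by apply: leq_trans (ltn_ord _) (leq_maxr _ _).
have R0 : Rel (@ord0 n) (enum_rank [set: 'I_n.+1]%SET) by rewrite relE inE.
have [xs [ys [Hxs Hys]]] := tuples_exist cg mB (iN ord0) (JN _) R0.
exists (induced (kept g Rel)); split; first exact: hD.
exists (fun i => tup (xs i)), (fun J => tup (ys (enum_rank J))) => i J.
rewrite holds_code -relE; split=> [[z [h1 h2 h3]]|h].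
  exact: (rel_of_coded cg kg mB Hxs Hys (iN i) (JN J) h1 h2 h3).
exact: (coded_of_rel cg mB Hxs Hys (iN i) (JN J) h).
Qed.

End Independence.

Theorem mainTheorem1 : decomposition_horizon Pi_NIP.
Proof.
move=> C; split=> [starC|[hC nipC]].
  have [hC _] := starC; split=> // indC.
  have [N [CN [F [X [Y [c [cF nX nY pre]]]]]]] := coding_structure indC.
  have [sh cfg] := config_of_precode hC CN cF nX nY pre.
  have [D [hD nipD cfgD]] := decomposition_transfer hC starC (canonical_config cfg).
  exact: nipD (independent_of_canonical hD cfgD).
(* For the converse a single part is enough, because [C] is closed under induced subgraphs. *)
split=> // p p0; exists (fun=> 1); split; last split.
- by [].
- by move=> q q0; exists 1 => n n1; rewrite exp1n.
exists C; split=> // G CG; exists 1, (fun=> ord0); split=> // idx.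
by case: hC => _; apply.
Qed.
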